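(* Let $\hat r = 1 + \left\lceil e^{LH}H(M_{1}+L)\left(\alpha^{*}+\sqrt{\alpha^{*}(\alpha^{*}+1)}\right) - LH\right\rceil$ with $\alpha^{*}=\alpha_2/\alpha_1$, where the constants $L, M_1, \alpha_1,\alpha_2$ and the matrices $\mathcal{K}_r$ are those defined in the context. The system $$\dot{x}(t) = \sum_{j=0}^{m} A_{j} x(t-h_{j}) + \int_{-H}^{0} G(\theta) x(t+\theta)\, d\theta,\quad t\ge 0,$$ is exponentially stable if and only if the Lyapunov condition holds and $$\mathcal{K}_{\hat r} > 0 .$$
   Context: System: $A_0,\dots,A_m\in\mathbb{R}^{n\times n}$, $0=h_0<h_1<\dots<h_m=H$, and $G:[-H,0]\to\mathbb{R}^{n\times n}$ is piecewise continuous. Initial functions $\varphi$ are in $\mathcal H=PC([-H,0],\mathbb{R}^n)$ (piecewise continuous functions); $x(t,\varphi)$ denotes the corresponding solution. $\|\cdot\|$ is the Euclidean norm for vectors and the induced norm for matrices, and $\|\varphi\|_H=\sup_{\theta\in[-H,0]}\|\varphi(\theta)\|$. For a symmetric matrix $Q$, $Q>0$ means positive definite, and $\lambda_{\min}(Q)$ is its smallest eigenvalue. Exponential stability: there exist $\gamma\ge 1$, $\sigma>0$ such that $\|x(t,\varphi)\|\le \gamma e^{-\sigma t}\|\varphi\|_H$ for all $t\ge 0$ and all $\varphi\in\mathcal H$. Lyapunov condition: the spectrum $\Lambda=\{s\in\mathbb{C}: \det(sI-\sum_{j=0}^m A_je^{-sh_j}-\int_{-H}^0 e^{s\theta}G(\theta)d\theta)=0\}$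 contains no $\hat s$ such that $-\hat s\in\Lambda$ as well. Delay Lyapunov matrix: fix a symmetric positive definite $W\in\mathbb{R}^{n\times n}$. The delay Lyapunov matrix $U$ associated with $W$ is the continuous function $U:\mathbb{R}\to\mathbb{R}^{n\times n}$ satisfying $\frac{d}{d\tau}U(\tau)=\sum_{j=0}^m U(\tau-h_j)A_j+\int_{-H}^0U(\tau+\theta)G(\theta)d\theta$ for $\tau\ge0$; $U(\tau)=U^T(-\tau)$ for $\tau\ge 0$; and $-W=\sum_{j=0}^m[A_j^TU^T(-h_j)+U(-h_j)A_j]+\int_{-H}^0[G^T(\theta)U^T(\theta)+U(\theta)G(\theta)]d\theta$. It exists and is unique if and only if the Lyapunov condition holds; the condition $\mathcal K_{\hat r}>0$ and the quantities depending on $U$ are considered when the Lyapunov condition holds. Matrices: for $r\ge2$, $\mathcal K_r=\left\{U\left(\frac{j-i}{r-1}H\right)\right\}_{i,j=1}^r\in\mathbb{R}^{nr\times nr}$ (block matrix with $(i,j)$ block as indicated), and $\mathcal K_1=U(0)$. Fundamental matrix: $K(t)$ satisfies $\dot K(t)=\sum_{j=0}^mK(t-h_j)A_j+\int_{-H}^0K(t+\theta)G(\theta)d\theta$, $t\ge0$, with $K(t)=0$ for $t<0$, $K(0)=I_n$. Constants: $M=\sum_{j=0}^m\|A_j\|$, $b=\sup_{\theta\in[-H,0]}\|G(\theta)\|$, $M_1=M+bH$ (assumed positive). $L>0$ is a number such that $\|\dot K(t)\|\le L$ for almost all $t\in[0,H]$; one may take $L=M_2e^{M_1H}$ with $M_2=\sum_{j=0}^m\|A_j\|e^{-M_1h_j}+\frac{b}{M_1}(1-e^{-M_1H})$.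 $\alpha_1=\frac{\lambda_{\min}(W)}{4M_1}e^{-2M_1H}\cos^2(b_1)$, where $b_1$ is the unique solution in $(0,\pi/2)$ of $\sin^4(b_1)\left((HM_1)^2+b_1^2\right)-(HM_1)^2=0$. $\alpha_2=\nu(1+N_1)^2+b\nu H^2(1+N_1)+\frac14b^2\nu H^2\cdot H^2+H\|W\|$, with $\nu=\max_{\tau\in[0,H]}\|U(\tau)\|$ and $N_1=\sum_{j=1}^m\|A_j\|h_j$. *)

(* Defs.v *)
From HB Require Import structures.
From mathcomp Require Import all_boot all_order all_algebra.
From mathcomp Require Import all_classical all_reals all_analysis.
From mathcomp Require Import complex.

Set Implicit Arguments.
Unset Strict Implicit.
Unset Printing Implicit Defensive.

Import Order.TTheory GRing.Theory Num.Theory.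
Import numFieldNormedType.Exports.

Local Open Scope classical_set_scope.
Local Open Scope ring_scope.
Local Open Scope complex_scope.

Section LinearAlgebra.
Variable R : realType.

(* The norm carried by the library's normed module of matrices is the
   entrywise maximum; it is used below only through its topology. *)
Definition enorm n (v : 'cV[R]_n) : R := Num.sqrt (\sum_i v i 0 ^+ 2).

Definition opnorm n (Q : 'M[R]_n) : R :=
  sup [set enorm (Q *m v) | v in [set v : 'cV[R]_n | enorm v <= 1]].

Definition posdefmx n (Q : 'M[R]_n) : Prop :=
  Q^T = Q /\ forall v : 'cV[R]_n, v != 0 -> 0 < (v^T *m Q *m v) 0 0.

Definition lambda_min n (Q : 'M[R]_n) : R := inf [set a : R | eigenvalue Q a].

End LinearAlgebra.

Section Calculus.
Variable R : realType.

(* Finitely many discontinuities in ]a, b[, and finite one-sided limits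
   wherever they make sense in [a, b]. *)
Definition piecewise_continuous (V : normedModType R) (a b : R) (f : R -> V) :
  Prop :=
  [/\ exists s : seq R,
        forall t : R, a < t < b -> t \notin s -> {for t, continuous f},
      forall t : R, a <= t < b -> cvg (f x @[x --> t^'+])
    & forall t : R, a < t <= b -> cvg (f x @[x --> t^'-]) ].

Definition supnorm n (H : R) (phi : R -> 'cV[R]_n) : R :=
  sup [set enorm (phi t) | t in `[- H, 0]].

Definition mxint p q (a b : R) (F : R -> 'M[R]_(p, q)) : 'M[R]_(p, q) :=
  \matrix_(i, j) (\int[@lebesgue_measure R]_(t in `[a, b]) F t i j).

Definition cexp (z : R[i]) : R[i] :=
  let: x +i* y := z in (expR x * cos y) +i* (expR x * sin y).

Definition cmxint n (a b : R) (F : R -> 'M[R[i]]_n) : 'M[R[i]]_n :=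
  \matrix_(i, j)
    ((\int[@lebesgue_measure R]_(t in `[a, b]) complex.Re (F t i j)) +i*
     (\int[@lebesgue_measure R]_(t in `[a, b]) complex.Im (F t i j))).

End Calculus.

Section DelaySystem.
Variables (R : realType) (n m : nat).
Variables (A : 'I_m.+1 -> 'M[R]_n) (h : 'I_m.+1 -> R) (H : R).
Variable G : R -> 'M[R]_n.

Definition sys_rhs (x : R -> 'cV[R]_n) (t : R) : 'cV[R]_n :=
  \sum_j A j *m x (t - h j) + mxint (- H) 0 (fun th => G th *m x (t + th)).

(* The right-hand side inherits the jumps of phi, so the equation holds, as
   usual for piecewise continuous initial functions, off finitely many t;
   together with continuity this is equivalent to its integrated form. *)
Definition is_solution (phi x : R -> 'cV[R]_n) : Prop :=
  [/\ forall t : R, - H <= t <= 0 -> x t = phi t,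
      {within `[0, +oo[, continuous x}
    & exists s : seq R, forall t : R, 0 < t -> t \notin s ->
        is_derive t (1 : R) x (sys_rhs x t) ].

(* The solution exists and is unique for every phi. *)
Definition exp_stable : Prop :=
  exists gamma sigma : R, [/\ 1 <= gamma, 0 < sigma
    & forall phi x : R -> 'cV[R]_n,
        piecewise_continuous (- H) 0 phi -> is_solution phi x ->
        forall t : R, 0 <= t ->
          enorm (x t) <= gamma * expR (- sigma * t) * supnorm H phi ].

Definition char_mx (s : R[i]) : 'M[R[i]]_n :=
  s%:M - \sum_j cexp (- s * (h j)%:C) *: map_mx (real_complex R) (A j)
  - cmxint (- H) 0
      (fun th => cexp (s * th%:C) *: map_mx (real_complex R) (G th)).

Definition spectrum : set R[i] := [set s | \det (char_mx s) = 0].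

Definition lyapunov_condition : Prop :=
  ~ exists s : R[i], spectrum s /\ spectrum (- s).

Definition mx_rhs (X : R -> 'M[R]_n) (t : R) : 'M[R]_n :=
  \sum_j X (t - h j) *m A j + mxint (- H) 0 (fun th => X (t + th) *m G th).

(* K jumps at 0, hence mx_rhs K jumps at the delays h j. *)
Definition is_fundamental_matrix (K : R -> 'M[R]_n) : Prop :=
  [/\ forall t : R, t < 0 -> K t = 0,
      K 0 = 1%:M,
      {within `[0, +oo[, continuous K}
    & exists s : seq R, forall t : R, 0 < t -> t \notin s ->
        is_derive t (1 : R) K (mx_rhs K t) ].

(* At tau = 0 the derivative is the right one: U has in general a corner
   there. *)
Definition is_delay_lyapunov_matrix (W : 'M[R]_n) (U : R -> 'M[R]_n) : Prop :=
  [/\ continuous U,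
      (forall t : R, 0 < t -> is_derive t (1 : R) U (mx_rhs U t)) /\
        (t^-1 *: (U t - U 0) @[t --> 0^'+] --> mx_rhs U 0),
      forall t : R, 0 <= t -> U t = (U (- t))^T
    & - W = \sum_j ((A j)^T *m (U (- h j))^T + U (- h j) *m A j)
            + mxint (- H) 0
                (fun th => (G th)^T *m (U th)^T + U th *m G th) ].

(* For r = 1 the only block is U 0, since 0 / 0 = 0. *)
Definition lyap_block_mx (U : R -> 'M[R]_n) (r : nat) :
    'M[R]_(\sum_(i < r) n) :=
  \mxblock_(i < r, j < r) U ((j%:R - i%:R) / (r%:R - 1) * H).

Definition bG : R := sup [set opnorm (G th) | th in `[- H, 0]].

Definition M1 : R := \sum_j opnorm (A j) + bG * H.

Definition alpha1 (W : 'M[R]_n) (b1 : R) : R :=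
  lambda_min W / (4 * M1) * expR (- 2 * M1 * H) * cos b1 ^+ 2.

Definition nu (U : R -> 'M[R]_n) : R := sup [set opnorm (U t) | t in `[0, H]].

Definition N1 : R := \sum_(j < m.+1 | (0 < j)%N) opnorm (A j) * h j.

Definition alpha2 (W : 'M[R]_n) (U : R -> 'M[R]_n) : R :=
  nu U * (1 + N1) ^+ 2 + bG * nu U * H ^+ 2 * (1 + N1)
  + 4^-1 * bG ^+ 2 * nu U * H ^+ 2 * H ^+ 2 + H * opnorm W.

(* The ceiling is positive: -W is the value of a sum that is bounded by
   2 * nu * M1 in norm, so alpha2 / alpha1 >= 2. Hence the absolute value
   only converts int to nat. *)
Definition rhat (W : 'M[R]_n) (L b1 : R) (U : R -> 'M[R]_n) : nat :=
  let a := alpha2 W U / alpha1 W b1 in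
  (1 + `|Num.ceil (expR (L * H) * H * (M1 + L) * (a + Num.sqrt (a * (a + 1)))
                   - L * H)|)%N.

End DelaySystem.

(* Main.v *)
Require Import Defs.
From mathcomp Require Import all_boot all_order all_algebra.
From mathcomp Require Import all_classical all_reals all_analysis.
From mathcomp Require Import measurable_realfun complex ring lra.

Set Implicit Arguments.
Unset Strict Implicit.
Unset Printing Implicit Defensive.

Import Order.TTheory GRing.Theory Num.Theory.
Import numFieldNormedType.Exports.

Local Open Scope classical_set_scope.
Local Open Scope ring_scope.

(* Sufficiency. For x = K g, the Lyapunov matrix U yields a bilinear form v1 on
   states such that g^T U(0) g - v1(x_t, x_t) is the integral of x^T W x over
   [0, t - H], |v1(f, f')| <= alpha2 |f| |f'|, and the value of v1 at the shifts
   K(a + .) g and K(b + .) g' is g'^T U(a - b) g. Hence v1 at a combination of r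
   equally spaced shifts of K is a value of the quadratic form of K_r. A state
   bounded by N with Lipschitz constant M1 N is interpolated at r nodes by such
   a combination, and for r = rhat the error is small enough for K_r > 0 to give
   v1(phi, phi) >= - alpha1 N^2. Together with the energy identity this bounds
   K, first in supremum norm and then in L^2, so that K tends to 0; by the
   variation of constants formula the system is exponentially stable.

   Necessity. Each s in the spectrum is the exponent of a solution, so Re s < 0.
   The integral of K(t)^T W K(t + tau) over t is a Lyapunov matrix, and the
   matrices K_r it defines are Gram matrices of shifts of K. *)

(** The constant in [rhat] arises as follows. With [p = r - 1] steps of length [d = H / p], the
    relative interpolation error is at most [e = d (1 + L d)^(p - 1) (L + M1)], hence at most
    [exp (L H) H (L + M1) / (p + L H)]. An error [e N] in the state changes [v1] by at most
    [alpha2 (2 e + e^2) N^2], and with [a = alpha2 / alpha1] the requirement [a (2 e + e^2) <= 1]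
    amounts to [e <= 1 / (a + sqrt (a (a + 1)))]. The main obstacle is that a Lyapunov matrix comes
    with a differential equation on nonnegative times only, whereas [v1] evaluates [U] at
    differences of both signs. On negative times the derivative of [U] differs from the delay
    operator applied to [U] by [K (- t)^T W]. This is derived from the algebraic property, and it is
    how [W] enters the energy identity. A second obstacle is that [K] is defined by the equation
    with coefficients on the right, while its columns have to solve the system, where they stand on
    the left. In both cases the delays are moved from one factor to the other by associativity of
    convolution. *)

Lemma causal_recursion (T : Type) (x0 : T) (F : nat -> (nat -> T) -> T) :
  (forall k f g, (forall l, (l < k)%N -> f l = g l) -> F k f = F k g) ->
  exists d : nat -> T, forall k, d k = F k d.
Proof.
(* The value at index [k] no longer changes from stage [k + 1] on, so the diagonal of the iteration
   solves the equation. *)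
move=> hF; pose it := fix it i := if i is i'.+1 then fun k => F k (it i') else fun=> x0.
have stab k : forall i, (k < i)%N -> it i k = it k.+1 k.
  elim/ltn_ind: k => k IH [//|i]; rewrite ltnS => ki /=; apply: hF => l lk.
  by rewrite IH ?(leq_trans lk)// [RHS]IH.
by exists (fun k => it k.+1 k) => k /=; apply: hF => l lk; exact: stab.
Qed.

Lemma big_ord_trunc (Z : nmodType) (F : nat -> Z) k p : (k <= p)%N ->
  (forall l, (k <= l)%N -> F l = 0) -> \sum_(l < p) F l = \sum_(l < k) F l.
Proof.
move=> kp F0; rewrite -(subnKC kp) big_split_ord /= [X in _ + X]big1 ?addr0// => l _.
by rewrite F0// leq_addr.
Qed.

Lemma mulmx_ext (T : nzRingType) p q (P Q : 'M[T]_(p, q)) :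
  (forall v : 'cV_q, P *m v = Q *m v) -> P = Q.
Proof.
move=> PQ; apply/matrixP => i j.
have := congr1 (fun w : 'cV_p => w i 0) (PQ (delta_mx j 0)).
by rewrite -!colE !mxE.
Qed.

(** The last nonzero block matters in [corr_block_pos]: the shift of [K] with the largest index is
    the first to become nonzero. *)
Lemma mxcol_neq0 (T : nmodType) r q (w : 'cV[T]_(\sum_(i < r) q)) : w != 0 ->
  exists2 i, submxcol w i != 0 & forall j : 'I_r, (i < j)%N -> submxcol w j = 0.
Proof.
move=> w0; have [i0 wi0] : exists i, submxcol w i != 0.
  apply: contrapT => hn; case/negP: w0; apply/eqP; rewrite -[w]submxcolK -[RHS](mxcol0 1).
  apply: eq_mxcol => i; apply/eqP; apply: contrapT => /negP h'; by apply: hn; exists i.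
have := @arg_maxnP _ i0 (fun i => submxcol w i != 0) (fun i => i : nat) wi0.
case=> i wi imax; exists i => // j ij; apply/eqP; apply: contrapT => /negP wj.
by have := imax j wj; rewrite /= leqNgt ij.
Qed.

(** * Integration on the real line *)

Section Integral.
Variable R : realType.
Implicit Types (f g p q : R -> R) (a b c : R).

Notation mu := (@lebesgue_measure R).

(** Integrals over intervals carry the indicators [ico] and [icc] as factors, so that shifts and
    exchanges of integrals never change the domain. *)
Definition Int f : R := \int[mu]_x f x.

Definition L1 f : Prop := mu.-integrable setT (EFin \o f).

Lemma L1_meas f : L1 f -> measurable_fun setT f.
Proof. by move=> /measurable_int/measurable_EFinP. Qed.

Lemma L1_le f g : measurable_fun setT f -> L1 g ->
  (forall t, `|f t| <= g t) -> L1 f.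
Proof.
move=> mf ig fg; apply: le_integrable ig => //.
  exact/measurable_EFinP.
move=> x _ /=; rewrite lee_fin; apply: le_trans (fg x) _; exact: ler_norm.
Qed.

Lemma eq_Int f g : f =1 g -> Int f = Int g.
Proof. by move=> fg; apply: eq_Rintegral => x _. Qed.

Lemma eq_L1 f g : f =1 g -> L1 f -> L1 g.
Proof. by move=> /funext ->. Qed.

Lemma L1D f g : L1 f -> L1 g -> L1 (fun t => f t + g t).
Proof.
move=> lf lg; rewrite /L1.
have -> : EFin \o (fun t => f t + g t) = ((EFin \o f) \+ (EFin \o g))%E by [].
exact: integrableD.
Qed.

Lemma IntD f g : L1 f -> L1 g -> Int (fun t => f t + g t) = Int f + Int g.
Proof. by move=> lf lg; apply: RintegralD. Qed.

Lemma L1Z c f : L1 f -> L1 (fun t => c * f t).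
Proof.
move=> lf; rewrite /L1.
have -> : EFin \o (fun t => c * f t) = (fun t => c%:E * (EFin \o f) t)%E by [].
exact: integrableZl.
Qed.

Lemma IntZ c f : L1 f -> Int (fun t => c * f t) = c * Int f.
Proof. by move=> lf; apply: RintegralZl. Qed.

Lemma L1N f : L1 f -> L1 (fun t => - f t).
Proof.
by move=> lf; apply: (eq_L1 _ (L1Z (-1) lf)) => t; rewrite mulN1r.
Qed.

Lemma IntN f : L1 f -> Int (fun t => - f t) = - Int f.
Proof.
by move=> lf; rewrite -mulN1r -IntZ//; apply: eq_Int => t; rewrite mulN1r.
Qed.

Lemma L1B f g : L1 f -> L1 g -> L1 (fun t => f t - g t).
Proof. by move=> lf lg; apply: L1D => //; exact: L1N. Qed.

Lemma IntB f g : L1 f -> L1 g -> Int (fun t => f t - g t) = Int f - Int g.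
Proof. by move=> lf lg; rewrite IntD ?IntN//; exact: L1N. Qed.

Lemma L1_0 : L1 (fun=> 0).
Proof. exact: integrable0. Qed.

Lemma Int0 : Int (fun=> 0) = 0.
Proof.
rewrite -[RHS](mul0r (Int (fun=> 0))) -(IntZ 0 L1_0).
by apply: eq_Int => t; rewrite mul0r.
Qed.

Lemma L1_sum (I : Type) (r : seq I) (F : I -> R -> R) :
  (forall i, L1 (F i)) -> L1 (fun t => \sum_(i <- r) F i t).
Proof.
move=> lF; elim: r => [|i r IH].
  by apply: (eq_L1 _ L1_0) => t; rewrite big_nil.
by apply: (eq_L1 _ (L1D (lF i) IH)) => t; rewrite big_cons.
Qed.

Lemma Int_sum (I : Type) (r : seq I) (F : I -> R -> R) :
  (forall i, L1 (F i)) ->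
  Int (fun t => \sum_(i <- r) F i t) = \sum_(i <- r) Int (F i).
Proof.
move=> lF; elim: r => [|i r IH].
  by rewrite big_nil -[RHS]Int0; apply: eq_Int => t; rewrite big_nil.
rewrite big_cons -IH -IntD//; last exact: L1_sum.
by apply: eq_Int => t; rewrite big_cons.
Qed.

Lemma le_Int f g : L1 f -> L1 g -> (forall t, f t <= g t) -> Int f <= Int g.
Proof. by move=> lf lg fg; apply: le_Rintegral. Qed.

Lemma Int_ge0 f : (forall t, 0 <= f t) -> 0 <= Int f.
Proof. by move=> f0; apply: Rintegral_ge0. Qed.

Lemma L1_norm f : L1 f -> L1 (fun t => `|f t|).
Proof. by move=> /integrable_norm. Qed.

Lemma norm_Int_le f g : L1 f -> L1 g -> (forall t, `|f t| <= g t) ->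
  `|Int f| <= Int g.
Proof.
move=> lf lg fg; apply: (@le_trans _ _ (Int (fun t => `|f t|))).
  exact: le_normr_Rintegral.
by apply: le_Int => //; exact: L1_norm.
Qed.

(** Lebesgue measure is determined by the lengths of half-open intervals, which a translation
    preserves. *)
Lemma measure_shift a (A : set R) : measurable A ->
  pushforward mu ((fun x => x + a) : R -> measurableTypeR R) A = mu A.
Proof.
have mphi : measurable_fun setT ((fun x => x + a) : R -> measurableTypeR R).
  exact: measurable_funD.
move=> mA; apply/esym.
pose nu : {measure set (measurableTypeR R) -> \bar R} :=
  measure_function_pushforward__canonical__measure_function_Measure mu mphi.
apply: (@lebesgue_measure_unique _ nu) => //= _ [[u v]] _ <-.
rewrite /pushforward.
have -> : (fun x => x + a) @^-1` `]u, v]%classic = `]u - a, v - a]%classic.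
  by apply/seteqP; split => x /=; rewrite !in_itv/= ltrBlDr lerBrDr.
rewrite !lebesgue_measure_itv/= !lte_fin ltrD2r -!EFinB.
by case: ifP => // _; congr (_%:E); ring.
Qed.

Lemma measurable_addr a : measurable_fun setT ((fun x => x + a) : R -> R).
Proof. exact: measurable_funD. Qed.

Lemma L1_push (phi : R -> R) f : measurable_fun setT phi ->
  (forall A, measurable A ->
     pushforward mu (phi : R -> measurableTypeR R) A = mu A) ->
  L1 f -> L1 (f \o phi) /\ Int (f \o phi) = Int f.
Proof.
move=> mphi muphi lf.
have mf := L1_meas lf.
pose nu : {measure set (measurableTypeR R) -> \bar R} :=
  measure_function_pushforward__canonical__measure_function_Measure mu
    (mphi : measurable_fun setT (phi : R -> measurableTypeR R)).
have mfp : measurable_fun setT (f \o phi) by exact: measurableT_comp.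
have eqI (g : R -> \bar R) : (\int[nu]_x g x = \int[mu]_x g x)%E.
  by apply: eq_measure_integral => A mA _; exact: muphi.
have lfp : L1 (f \o phi).
  apply/integrableP; split; first exact/measurable_EFinP.
  have /integrableP[_] := lf; apply: le_lt_trans.
  rewrite -[leRHS]eqI /= ge0_integral_pushforward//=.
  by do 2 apply: measurableT_comp => //.
split=> //; rewrite /Int /Rintegral; congr fine.
rewrite -[RHS]eqI /= integral_pushforward//=.
exact/measurable_EFinP.
Qed.

Lemma L1_shift a f : L1 f -> L1 (fun t => f (t + a)).
Proof.
by move=> lf; have [] := L1_push (measurable_addr a) (measure_shift a) lf.
Qed.

Lemma Int_shift a f : L1 f -> Int (fun t => f (t + a)) = Int f.
Proof.
by move=> lf; have [] := L1_push (measurable_addr a) (measure_shift a) lf.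
Qed.

(** Half-open, so that adjacent intervals concatenate exactly, as in [Int_ico_split]; the closed
    variant [icc] matches the integrals in the system. *)
Definition ico a b : R -> R := fun x => (a <= x < b)%R%:R.

Definition icc a b : R -> R := fun x => (a <= x <= b)%R%:R.

Lemma icoE a b : ico a b = \1_(`[a, b[ : set R).
Proof.
apply/funext => x; rewrite /ico indicE; congr (nat_of_bool _)%:R.
by apply/idP/idP => [h|]; rewrite ?inE ?in_itv//= => /set_mem; rewrite /= in_itv.
Qed.

Lemma iccE a b : icc a b = \1_(`[a, b] : set R).
Proof.
apply/funext => x; rewrite /icc indicE; congr (nat_of_bool _)%:R.
by apply/idP/idP => [h|]; rewrite ?inE ?in_itv//= => /set_mem; rewrite /= in_itv.
Qed.

Lemma L1_indic_itv (i : interval R) : (mu [set` i] < +oo)%E ->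
  L1 (\1_[set` i] : R -> R).
Proof.
move=> fin; apply/integrableP; split.
  by apply/measurable_EFinP; exact: measurable_indic.
under eq_integral do rewrite /= ger0_norm//.
by rewrite integral_indic// setIT.
Qed.

Lemma L1_icc a b : L1 (icc a b).
Proof.
rewrite iccE; apply: L1_indic_itv; rewrite lebesgue_measure_itv /=.
by case: ifP => // _; rewrite -EFinB ltry.
Qed.

Lemma L1_ico a b : L1 (ico a b).
Proof.
rewrite icoE; apply: L1_indic_itv; rewrite lebesgue_measure_itv /=.
by case: ifP => // _; rewrite -EFinB ltry.
Qed.

Lemma Int_ico a b : a <= b -> Int (ico a b) = b - a.
Proof.
move=> ab; rewrite icoE /Int /Rintegral integral_indic//= setIT.
rewrite lebesgue_measure_itv /= lte_fin; case: ltP => //= ba.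
by apply/eqP; rewrite eq_sym subr_eq0 eq_le ba ab.
Qed.

Lemma Int_itv f a b : \int[mu]_(x in `[a, b]) f x = Int (fun t => icc a b t * f t).
Proof.
rewrite Rintegral_mkcond; apply: eq_Rintegral => x _.
rewrite patchE iccE indicE; case: ifP => _; rewrite ?mul1r ?mul0r//.
Qed.

Lemma negligible_seq (s : seq R) : mu.-negligible [set` s].
Proof.
exists [set` s]; split=> //; last first.
  apply: countable_lebesgue_measure0; apply: finite_set_countable.
  exact: finite_seq.
elim: s => [|x s IH].
  by rewrite (_ : [set` [::]] = set0); [exact: measurable0|apply/seteqP; split].
rewrite (_ : [set` x :: s] = [set x] `|` [set` s]).
  exact: measurableU.
apply/seteqP; split => y /=; rewrite in_cons.
  by move/predU1P.
by move=> h; apply/predU1P.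
Qed.

Lemma eq_Int_off (s : seq R) f g : measurable_fun setT f -> measurable_fun setT g ->
  (forall t, t \notin s -> f t = g t) -> Int f = Int g.
Proof.
move=> mf mg fg; rewrite /Int /Rintegral; congr fine.
apply: ae_eq_integral => //; [exact/measurable_EFinP|exact/measurable_EFinP|].
have [N [mN N0 sN]] := negligible_seq s.
exists N; split=> // t nt; apply: sN => /=; apply: contrapT => /negP ts.
by apply: nt => _ /=; rewrite fg.
Qed.

Lemma ico_ge0 a b t : 0 <= ico a b t. Proof. exact: ler0n. Qed.
Lemma icc_ge0 a b t : 0 <= icc a b t. Proof. exact: ler0n. Qed.

Lemma L1_bounded a b C f : measurable_fun setT f ->
  (forall t, a <= t <= b -> `|f t| <= C) ->
  (forall t, ~~ (a <= t <= b) -> f t = 0) -> L1 f.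
Proof.
move=> mf fC f0; apply: (L1_le mf (L1Z C (L1_icc a b))) => t.
rewrite /icc; case: (boolP (a <= t <= b)) => [/fC|/f0 ->].
  by rewrite mulr1.
by rewrite normr0 mulr0.
Qed.

(** Supplies the integrable majorant on the plane under which Fubini's theorem is applied. *)
Lemma prod_L1 p q : L1 p -> L1 q -> (forall t, 0 <= p t) -> (forall t, 0 <= q t) ->
  (mu \x mu)%E.-integrable setT (EFin \o (fun z : R * R => p z.1 * q z.2)).
Proof.
move=> lp lq p0 q0.
have mpq : measurable_fun setT (fun z : R * R => p z.1 * q z.2).
  apply: measurable_funM; apply: measurableT_comp => //; exact: L1_meas.
apply/integrable12ltyP; first exact/measurable_EFinP.
have fq : (\int[mu]_x (q x)%:E)%E = (Int q)%:E.
  by rewrite /Int /Rintegral fineK//; exact: integrable_fin_num.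
have fp : (\int[mu]_x (p x)%:E)%E = (Int p)%:E.
  by rewrite /Int /Rintegral fineK//; exact: integrable_fin_num.
have -> : (fun x => \int[mu]_y `|(EFin \o (fun z : R * R => p z.1 * q z.2)%R) (x, y)|)%E
    = (fun x => (Int q)%:E * (p x)%:E)%E.
  apply/funext => x; rewrite -fq muleC -integralZl//.
  by apply: eq_integral => y _ /=; rewrite ger0_norm ?EFinM// mulr_ge0.
by rewrite integralZl// fp -EFinM ltry.
Qed.

Section Fubini.
Variables (F : R * R -> R) (p q : R -> R).
Hypotheses (mF : measurable_fun setT F) (lp : L1 p) (lq : L1 q).
Hypothesis Fpq : forall s t, `|F (s, t)| <= p s * q t.
Hypotheses (p0 : forall s, 0 <= p s) (q0 : forall t, 0 <= q t).

Let iF : (mu \x mu)%E.-integrable setT (EFin \o F).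
Proof.
apply: le_integrable (prod_L1 lp lq p0 q0) => //; first exact/measurable_EFinP.
move=> [s t] _ /=; rewrite lee_fin; apply: le_trans (Fpq s t) _.
exact: ler_norm.
Qed.

Let lF1 s : L1 (fun t => F (s, t)).
Proof.
apply: (@L1_le _ (fun t => p s * q t)) => //; last exact: L1Z.
exact: measurableT_comp.
Qed.

Let lF2 t : L1 (fun s => F (s, t)).
Proof.
apply: (@L1_le _ (fun s => q t * p s)) => //; last first.
- by move=> s; rewrite mulrC.
- exact: L1Z.
exact: measurableT_comp.
Qed.

Let E1 s : (\int[mu]_t (F (s, t))%:E = (Int (fun t => F (s, t)))%:E)%E.
Proof.
by rewrite /Int /Rintegral fineK//; exact: (integrable_fin_num _ (lF1 s)).
Qed.

Let E2 t : (\int[mu]_s (F (s, t))%:E = (Int (fun s => F (s, t)))%:E)%E.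
Proof.
by rewrite /Int /Rintegral fineK//; exact: (integrable_fin_num _ (lF2 t)).
Qed.

Lemma Fubini_L1 : L1 (fun s => Int (fun t => F (s, t))).
Proof.
have := integrable_fubini_F iF; apply: eq_integrable => // s _.
by rewrite /fubini_F /= E1.
Qed.

Lemma Fubini_Int : Int (fun s => Int (fun t => F (s, t))) =
                   Int (fun t => Int (fun s => F (s, t))).
Proof.
rewrite [LHS]/Int [RHS]/Int /Rintegral; congr fine.
under eq_integral do rewrite -E1.
under [in RHS]eq_integral do rewrite -E2.
exact: Fubini iF.
Qed.

End Fubini.

Lemma Fubini_L1' (F : R * R -> R) p q : measurable_fun setT F -> L1 p -> L1 q ->
  (forall s t, `|F (s, t)| <= p s * q t) ->
  (forall s, 0 <= p s) -> (forall t, 0 <= q t) ->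
  L1 (fun t => Int (fun s => F (s, t))).
Proof.
move=> mF lp lq Fpq p0 q0.
apply: (@Fubini_L1 (fun z => F (z.2, z.1)) q p) => //.
  apply: (measurableT_comp mF); exact: measurable_fun_pair.
by move=> s t; rewrite mulrC.
Qed.

Lemma DCT (fn : nat -> R -> R) f g : (forall k, measurable_fun setT (fn k)) ->
  measurable_fun setT f -> L1 g ->
  {ae mu, forall t, fn k t @[k --> \oo] --> f t} ->
  (forall k t, `|fn k t| <= g t) -> Int (fn k) @[k --> \oo] --> Int f.
Proof.
move=> mfn mf lg cv fg.
have cv' : {ae mu, forall x, setT x -> (EFin \o fn k) x @[k --> \oo] --> (EFin \o f) x}.
  case: cv => N [mN N0 sN]; exists N; split=> // t nt; apply: sN => ct; apply: nt.
  by move=> _; apply: cvg_EFin => //; exact: nearW.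
have fg' : {ae mu, forall x (k : nat), setT x -> (`|(EFin \o fn k) x| <= (EFin \o g) x)%E}.
  by apply: aeW => t k _ /=; rewrite lee_fin.
have [lf _ h] := @dominated_convergence _ _ R mu setT measurableT
  (fun k => EFin \o fn k) (EFin \o f) (EFin \o g)
  (fun k => (measurable_EFinP _ _).2 (mfn k)) ((measurable_EFinP _ _).2 mf)
  cv' lg fg'.
apply: fine_cvg; rewrite /Int /Rintegral fineK//.
exact: integrable_fin_num.
Qed.

(* Locally bounded measurable functions: integrable on bounded intervals and, unlike
   piecewise continuous ones, stable under the convolutions below without further proof. *)
Definition lbm f := measurable_fun setT f /\
  forall T : R, exists2 C : R, 0 <= C & forall t, `|t| <= T -> `|f t| <= C.

Lemma lbm_meas f : lbm f -> measurable_fun setT f. Proof. by case. Qed.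

Lemma eq_lbm f g : f =1 g -> lbm f -> lbm g.
Proof. by move=> /funext ->. Qed.

Lemma lbm_itv f a b : lbm f ->
  exists2 C, 0 <= C & forall t, a <= t <= b -> `|f t| <= C.
Proof.
case=> _ /(_ (`|a| + `|b|)) [C C0 h]; exists C => // t /andP[at_ tb].
apply: h; have := ler_norm b; have := ler_norm (- a); rewrite normrN ler_norml.
have := normr_ge0 a; have := normr_ge0 b; lra.
Qed.

Lemma lbm_cst c : lbm (fun=> c).
Proof. by split=> // T; exists `|c|. Qed.

Lemma lbmD f g : lbm f -> lbm g -> lbm (fun t => f t + g t).
Proof.
case=> mf bf [mg bg]; split; first exact: measurable_funD.
move=> T; have [C C0 fC] := bf T; have [D D0 gD] := bg T.
exists (C + D); first exact: addr_ge0.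
by move=> t tT; rewrite (le_trans (ler_normD _ _))// lerD ?fC ?gD.
Qed.

Lemma lbmM f g : lbm f -> lbm g -> lbm (fun t => f t * g t).
Proof.
case=> mf bf [mg bg]; split; first exact: measurable_funM.
move=> T; have [C C0 fC] := bf T; have [D D0 gD] := bg T.
exists (C * D); first exact: mulr_ge0.
by move=> t tT; rewrite normrM ler_pM ?fC ?gD.
Qed.

Lemma lbmZ c f : lbm f -> lbm (fun t => c * f t).
Proof. by move=> bf; apply: lbmM => //; exact: lbm_cst. Qed.

Lemma lbmN f : lbm f -> lbm (fun t => - f t).
Proof.
by move=> bf; apply: (eq_lbm _ (lbmZ (-1) bf)) => t; rewrite mulN1r.
Qed.

Lemma lbmB f g : lbm f -> lbm g -> lbm (fun t => f t - g t).
Proof. by move=> bf bg; apply: lbmD => //; exact: lbmN. Qed.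

Lemma lbm_sum (I : Type) (r : seq I) (P : pred I) (F : I -> R -> R) :
  (forall i, lbm (F i)) -> lbm (fun t => \sum_(i <- r | P i) F i t).
Proof.
move=> bF; elim: r => [|i r IH].
  by apply: (eq_lbm _ (lbm_cst 0)) => t; rewrite big_nil.
case Pi: (P i).
  by apply: (eq_lbm _ (lbmD (bF i) IH)) => t; rewrite big_cons Pi.
by apply: (eq_lbm _ IH) => t; rewrite big_cons Pi.
Qed.

Lemma lbm_shift a f : lbm f -> lbm (fun t => f (t + a)).
Proof.
case=> mf bf; split; first exact: (measurableT_comp mf (measurable_addr a)).
move=> T; have [C C0 fC] := bf (T + `|a|); exists C => // t tT; apply: fC.
by rewrite (le_trans (ler_normD _ _))// lerD2r.
Qed.

Lemma lbm_opp f : lbm f -> lbm (fun t => f (- t)).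
Proof.
case=> mf bf; split; first exact: (measurableT_comp mf (@oppr_measurable _ _)).
move=> T; have [C C0 fC] := bf T; exists C => // t tT; apply: fC.
by rewrite normrN.
Qed.

Lemma lbm_refl a f : lbm f -> lbm (fun t => f (a - t)).
Proof.
move=> bf; apply: (eq_lbm _ (lbm_opp (lbm_shift a bf))) => t /=.
by rewrite addrC.
Qed.

Lemma measurable_bool01 (P : R -> bool) (i : interval R) : (forall t, P t = (t \in i)) ->
  measurable_fun setT (fun t => (P t)%:R : R).
Proof.
move=> Pi; rewrite (_ : (fun t => _) = \1_[set` i]); first exact: measurable_indic.
by apply/funext => t; rewrite indicE Pi mem_setE.
Qed.

Lemma lbm_bool01 (P : R -> bool) (i : interval R) : (forall t, P t = (t \in i)) ->
  lbm (fun t => (P t)%:R : R).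
Proof.
move=> Pi; split; first exact: (measurable_bool01 Pi).
move=> T; exists 1 => // t _; rewrite ger0_norm ?ler0n//.
by case: (P t).
Qed.

Lemma lbm_ico a b : lbm (ico a b).
Proof. by apply: (@lbm_bool01 _ `[a, b[) => t; rewrite in_itv. Qed.

Lemma lbm_icc a b : lbm (icc a b).
Proof. by apply: (@lbm_bool01 _ `[a, b]) => t; rewrite in_itv. Qed.

Lemma lbm_lt a : lbm (fun t => (t < a)%R%:R).
Proof. by apply: (@lbm_bool01 _ `]-oo, a[) => t; rewrite in_itv. Qed.

Lemma lbm_ge a : lbm (fun t => (a <= t)%R%:R).
Proof. by apply: (@lbm_bool01 _ `[a, +oo[) => t; rewrite in_itv /= andbT. Qed.

Lemma lbm_L1 a b f : lbm f -> (forall t, ~~ (a <= t <= b) -> f t = 0) -> L1 f.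
Proof.
move=> bf f0; have [C C0 fC] := lbm_itv a b bf.
exact: (L1_bounded (lbm_meas bf) fC f0).
Qed.

Lemma L1_ico_lbm a b f : lbm f -> L1 (fun t => ico a b t * f t).
Proof.
move=> bf; apply: (@lbm_L1 a b) => [|t]; first exact: lbmM (lbm_ico a b) bf.
by rewrite /ico; case: (leP a t); case: (ltgtP t b); rewrite /= ?mul0r.
Qed.

Lemma L1_icc_lbm a b f : lbm f -> L1 (fun t => icc a b t * f t).
Proof.
move=> bf; apply: (@lbm_L1 a b) => [|t]; first exact: lbmM (lbm_icc a b) bf.
by rewrite /icc => /negbTE ->; rewrite mul0r.
Qed.

Lemma Int_icc_ico a b f : lbm f ->
  Int (fun t => icc a b t * f t) = Int (fun t => ico a b t * f t).
Proof.
move=> bf; apply: (@eq_Int_off [:: b]).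
- by case: (lbmM (lbm_icc a b) bf).
- by case: (lbmM (lbm_ico a b) bf).
move=> t; rewrite inE => tb; congr (_%:R * _); congr (nat_of_bool (_ && _)).
by rewrite lt_neqAle tb.
Qed.

Lemma Int_ico_split a b c f : a <= b <= c -> lbm f ->
  Int (fun t => ico a c t * f t) =
  Int (fun t => ico a b t * f t) + Int (fun t => ico b c t * f t).
Proof.
move=> /andP[ab bc] bf; rewrite -IntD; [|exact: L1_ico_lbm..].
apply: eq_Int => t; rewrite -mulrDl; congr (_ * _).
rewrite /ico; case: (leP b t) => bt; last first.
  by rewrite (lt_le_trans bt bc) !andbT addr0.
by rewrite (le_trans ab bt) andbF add0r.
Qed.

Lemma lbm_continuous f : continuous f -> lbm f.
Proof.
move=> cf; split; first exact: continuous_measurable_fun.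
move=> T; case: (leP (0 : R) T) => [T0|T0]; last first.
  by exists 0 => // t tT; have := le_lt_trans tT T0; rewrite ltNge normr_ge0.
have TT : - T <= T by lra.
have [c _ fc] := @EVT_max R (fun t => `|f t|) (- T) T TT
  (continuous_subspaceT (fun t => continuous_comp (cf t) (@norm_continuous _ _ _))).
exists `|f c| => // t tT; apply: fc.
by rewrite in_itv /= -ler_norml.
Qed.

Lemma icoP a b t : (a <= t /\ t < b) /\ ico a b t = 1 \/ ico a b t = 0.
Proof.
rewrite /ico; case: (boolP (a <= t < b)) => [/andP h|_]; last by right.
by left.
Qed.

(** Serves [K_lipschitz], where the bound on the derivative of [K] holds almost everywhere only. *)
Lemma ae_le_Int (f g : R -> R) : L1 f -> L1 g ->
  {ae @lebesgue_measure R, forall t, f t <= g t} -> Int f <= Int g.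
Proof.
move=> lf lg fg; rewrite -subr_ge0 -IntB//; have l := L1B lg lf.
suff -> : Int (fun t => g t - f t) = Int (fun t => `|g t - f t|) by apply: Int_ge0.
have m1 := L1_meas l; have m2 := L1_meas (L1_norm l).
rewrite /Int /Rintegral; congr fine.
apply: ae_eq_integral => //; [exact/measurable_EFinP|exact/measurable_EFinP|].
apply: negligibleS fg => t; apply: contra_not => fgt _ /=.
by rewrite ger0_norm// subr_ge0.
Qed.

Lemma Int_ico_sub a b c d (f : R -> R) : lbm f -> (forall s, 0 <= f s) -> a <= c -> d <= b ->
  Int (fun s => ico c d s * f s) <= Int (fun s => ico a b s * f s).
Proof.
move=> bf f0 ac db; apply: le_Int; [exact: L1_ico_lbm|exact: L1_ico_lbm|move=> s].
case: (icoP c d s) => [[[s1 s2] ->]|->]; last by rewrite mul0r mulr_ge0 ?ico_ge0.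
by rewrite /ico (le_trans ac s1) (lt_le_trans s2 db).
Qed.

End Integral.

(** * Piecewise differentiable functions *)

Section PiecewiseDerivative.
Variable R : realType.
Implicit Types (f g df dg : R -> R) (a b c t e d C : R) (s : seq R).

(* [s] lists the exceptional points, where nothing is claimed on the derivative. *)
Definition pder s a b f df :=
  {within `[a, b], continuous f} /\
  forall t, a < t < b -> t \notin s -> is_derive t 1 f (df t).

Lemma within_sub a b c d f : a <= c -> d <= b ->
  {within `[a, b], continuous f} -> {within `[c, d], continuous f}.
Proof.
move=> ac db; apply: continuous_subspaceW => t /=; rewrite !in_itv/= => /andP[ct td].
by rewrite (le_trans ac ct) (le_trans td db).
Qed.

Lemma pder_sub s a b c d f df : a <= c -> d <= b ->
  pder s a b f df -> pder s c d f df.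
Proof.
move=> ac db [cf h]; split; first exact: within_sub cf.
move=> t /andP[ct td]; apply: h.
by rewrite (le_lt_trans ac ct) (lt_le_trans td db).
Qed.

Lemma eq_pder s a b f df dg : (forall t, a < t < b -> df t = dg t) ->
  pder s a b f df -> pder s a b f dg.
Proof. by move=> e [cf h]; split=> // t tab ts; rewrite -e//; exact: h. Qed.

Lemma within_itvP a b f : {within `[a, b], continuous f} <->
  forall t, a <= t <= b -> forall e, 0 < e -> exists2 d, 0 < d &
    forall u, a <= u <= b -> `|u - t| < d -> `|f u - f t| < e.
Proof.
split.
  move=> cf t tab e e0; have /subspace_continuousP/(_ t) := cf.
  rewrite /= in_itv/= => /(_ tab) /cvgrPdist_lt/(_ e e0).
  rewrite near_withinE => -[d /= d0 h]; exists d => // u uab utd.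
  rewrite distrC; apply: h; last by rewrite /= in_itv.
  by rewrite /ball_/= distrC.
move=> h; apply/subspace_continuousP => t /=; rewrite in_itv/= => tab.
apply/cvgrPdist_lt => e e0; have [d d0 hd] := h t tab e e0.
rewrite near_withinE; exists d => //= u utd; rewrite in_itv/= => uab.
by rewrite distrC; apply: hd; rewrite 1?distrC.
Qed.

Lemma within_open a b f t : {within `[a, b], continuous f} -> a < t < b ->
  {for t, continuous f}.
Proof.
move=> /within_itvP cf /andP[at_ tb].
have tab : a <= t <= b by rewrite !ltW.
apply/cvgrPdist_lt => e e0; have [d d0 h] := cf t tab e e0.
exists (Num.min d (Num.min (t - a) (b - t))) => /=.
  by rewrite !lt_min d0 !subr_gt0 at_.
move=> u /=; rewrite !lt_min => /and3P[ud ua ub]; rewrite distrC; apply: h.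
  by move: ua ub; rewrite !ltr_norml; lra.
by rewrite distrC.
Qed.

Lemma pderD s1 s2 a b f g df dg : pder s1 a b f df -> pder s2 a b g dg ->
  pder (s1 ++ s2) a b (fun t => f t + g t) (fun t => df t + dg t).
Proof.
move=> [cf hf] [cg hg]; split.
  by move=> x; apply: continuousD; [exact: cf|exact: cg].
move=> t tab; rewrite mem_cat negb_or => /andP[t1 t2].
have := hf t tab t1; have := hg t tab t2 => dg' df'.
exact: is_deriveD.
Qed.

Lemma pderM s1 s2 a b f g df dg : pder s1 a b f df -> pder s2 a b g dg ->
  pder (s1 ++ s2) a b (fun t => f t * g t) (fun t => df t * g t + f t * dg t).
Proof.
move=> [cf hf] [cg hg]; split.
  by move=> x; apply: continuousM; [exact: cf|exact: cg].
move=> t tab; rewrite mem_cat negb_or => /andP[t1 t2].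
have df' := hf t tab t1; have dg' := hg t tab t2.
apply: is_derive_eq (is_deriveM df' dg') _.
by rewrite /GRing.scale /= addrC mulrC.
Qed.

Lemma pder_cst s a b c : pder s a b (fun=> c) (fun=> 0).
Proof.
split; first by apply: continuous_subspaceT => x; exact: cvg_cst.
by move=> t _ _; exact: is_derive_cst.
Qed.

Lemma pderZ s a b c f df : pder s a b f df ->
  pder s a b (fun t => c * f t) (fun t => c * df t).
Proof.
move=> hf; have := pderM (pder_cst [::] a b c) hf; rewrite /=.
by apply: eq_pder => t _; rewrite mul0r add0r.
Qed.

Lemma pderN s a b f df : pder s a b f df ->
  pder s a b (fun t => - f t) (fun t => - df t).
Proof.
move=> /(pderZ (-1)); under eq_fun do rewrite mulN1r.
by apply: eq_pder => t _; rewrite mulN1r.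
Qed.

Lemma pder_id s a b : pder s a b id (fun=> 1).
Proof.
split; first by apply: continuous_subspaceT => x; exact: cvg_id.
by move=> t _ _; exact: is_derive_id.
Qed.

Lemma pder_sum (I : Type) (r : seq I) s a b (F dF : I -> R -> R) :
  (forall i, pder s a b (F i) (dF i)) ->
  pder s a b (fun t => \sum_(i <- r) F i t) (fun t => \sum_(i <- r) dF i t).
Proof.
move=> h; elim: r => [|i r IH].
  under eq_fun do rewrite big_nil.
  by apply: (eq_pder _ (pder_cst s a b 0)) => t _; rewrite big_nil.
under eq_fun do rewrite big_cons.
have [c1 d1] := pderD (h i) IH; split=> // t tab ts.
by rewrite big_cons; apply: d1; rewrite // mem_cat negb_or ts.
Qed.

Lemma pder_shift s a b c f df : pder s (a + c) (b + c) f df ->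
  pder [seq u - c | u <- s] a b (fun t => f (t + c)) (fun t => df (t + c)).
Proof.
move=> [/within_itvP cf h]; split.
  apply/within_itvP => t tab e e0.
  have [|d d0 hd] := cf (t + c) _ e e0; first by rewrite !lerD2r.
  by exists d => // u uab utd; apply: hd; rewrite ?lerD2r// opprD addrACA subrr addr0.
move=> t tab ts.
have h1 : is_derive (t + c) 1 f (df (t + c)).
  apply: h; first by rewrite !ltrD2r.
  by apply: contra ts => ts; apply/mapP; exists (t + c) => //; rewrite addrK.
have h2 : is_derive t 1 (fun x : R => x + c) 1.
  have := is_deriveD (is_derive_id t (1 : R)) (is_derive_cst c t (1 : R)).
  by rewrite addr0.
by have := @is_derive1_comp _ f (fun x => x + c) _ _ _ h1 h2; rewrite mulr1.
Qed.

Lemma pder_refl s a b c f df : pder s (c - b) (c - a) f df ->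
  pder [seq c - u | u <- s] a b (fun t => f (c - t)) (fun t => - df (c - t)).
Proof.
move=> [/within_itvP cf h]; split.
  apply/within_itvP => t tab e e0.
  have [|d d0 hd] := cf (c - t) _ e e0; first by move: tab; lra.
  exists d => // u uab utd; apply: hd; first by move: uab; lra.
  by rewrite (_ : c - u - (c - t) = t - u) ?(distrC t)//; ring.
move=> t tab ts.
have h1 : is_derive (c - t) 1 f (df (c - t)).
  apply: h; first by move: tab; lra.
  apply: contra ts => ts; apply/mapP; exists (c - t) => //; ring.
have h2 : is_derive t 1 (fun x : R => c - x) (-1).
  have := is_deriveD (is_derive_cst c t (1 : R)) (is_deriveN (is_derive_id t (1 : R))).
  by rewrite add0r.
by have := @is_derive1_comp _ f (fun x => c - x) _ _ _ h1 h2; rewrite mulrN1.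
Qed.

(** Induction on the exceptional points: the interval is cut at the head of the list, and continuity
    carries the inequality across the cut. *)
Lemma pder_le s a b f df : a <= b -> pder s a b f df ->
  (forall t, a < t < b -> t \notin s -> df t <= 0) -> f b <= f a.
Proof.
elim: s a b => [|x s IH] a b ab [cf hf] df0.
  apply: (@ler0_derive1_nincr _ _ a b) => // t; rewrite in_itv/= => tab.
    by have [] := hf t tab.
  have dt := hf t tab isT; rewrite derive1E derive_val.
  exact: df0.
have sub c d : a <= c -> c <= d -> d <= b -> (x <= c) || (d <= x) -> f d <= f c.
  move=> ac cd db xcd; apply: IH => //.
    split; first exact: within_sub cf.
    move=> t /andP[ct td] ts; apply: hf.
      by rewrite (le_lt_trans ac ct) (lt_le_trans td db).
    rewrite inE negb_or ts andbT; apply/eqP => tx; subst t.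
    by move: xcd; rewrite leNgt ct /= leNgt td.
  move=> t /andP[ct td] ts; apply: df0.
    by rewrite (le_lt_trans ac ct) (lt_le_trans td db).
  rewrite inE negb_or ts andbT; apply/eqP => tx; subst t.
  by move: xcd; rewrite leNgt ct /= leNgt td.
case: (leP x a) => xa; first by apply: sub; rewrite ?xa.
case: (leP b x) => xb; first by apply: sub; rewrite ?xb ?orbT.
apply: (@le_trans _ _ (f x)).
  by apply: (sub x b (ltW xa) (ltW xb) (lexx b)); rewrite lexx.
by apply: (sub a x (lexx a) (ltW xa) (ltW xb)); rewrite lexx orbT.
Qed.

Lemma pder_norm s a b C f df : a <= b -> pder s a b f df ->
  (forall t, a < t < b -> t \notin s -> `|df t| <= C) ->
  `|f b - f a| <= C * (b - a).
Proof.
move=> ab hf dfC.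
have hC : pder s a b (fun t => - C * t) (fun=> - C).
  have := pderZ (- C) (pder_id s a b); apply: eq_pder => t _; by rewrite mulr1.
have h1 := pderD hf hC; have h2 := pderD (pderN hf) hC.
have /= l1 := pder_le ab h1; have /= l2 := pder_le ab h2.
rewrite ler_norml; apply/andP; split.
  suff : - f b + - C * b <= - f a + - C * a by lra.
  apply: l2 => t tab; rewrite mem_cat negb_or => /andP[ts _].
  by have := dfC t tab ts; rewrite ler_norml; lra.
suff : f b + - C * b <= f a + - C * a by lra.
apply: l1 => t tab; rewrite mem_cat negb_or => /andP[ts _].
by have := dfC t tab ts; rewrite ler_norml; lra.
Qed.

(** A sequence of increments replaces the filter at 0 because dominated convergence is stated for
    sequences. *)
Lemma is_derive_seq f t l : is_derive t 1 f l ->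
  (k.+1%:R * (f (t + k.+1%:R^-1) - f t)) @[k --> \oo] --> l.
Proof.
move=> [df <-]; have /cvg_ex[l' hl'] := df.
have -> : 'D_1 f t = l' by apply/cvg_lim.
have hs : (fun k : nat => k.+1%:R^-1) @ \oo --> (0 : R)^'.
  move=> A /= [d /= d0 h]; have /cvgrPdist_lt/(_ d d0) := @cvg_harmonic R.
  apply: filterS => k kd; apply: h => //=.
have := cvg_comp _ _ hs hl'.
apply: cvg_trans; apply: near_eq_cvg; apply: nearW => k /=.
by rewrite /GRing.scale /= invrK mulr1 (addrC t).
Qed.

Lemma ico_out a b t : t != a -> ~~ (a < t < b) -> ico a b t = 0.
Proof. by move=> ta; rewrite lt_neqAle eq_sym ta /= /ico => /negbTE ->. Qed.

(** Composition with [clamp] extends a function on [[a, b]] by its end values, so that its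
    difference quotients make sense on the whole line. *)
Definition clamp a b t := Num.max a (Num.min t b).

Lemma clampP a b t : a < b ->
  [\/ t <= a /\ clamp a b t = a, a <= t <= b /\ clamp a b t = t
   | b <= t /\ clamp a b t = b].
Proof.
move=> ab; rewrite /clamp; case: (leP t b) => tb; last first.
  by constructor 3; split; [exact: ltW|rewrite max_r// ltW].
case: (leP a t) => at_; first by constructor 2.
by constructor 1; split => //; exact: ltW.
Qed.

Lemma clamp_itv a b t : a < b -> a <= clamp a b t <= b.
Proof. by move=> ab; case: (clampP t ab) => -[h ->]; rewrite ?h ?lexx// ltW. Qed.

Lemma clamp_lip a b t u : a < b -> t <= u ->
  0 <= clamp a b u - clamp a b t <= u - t.
Proof.
move=> ab tu; case: (clampP t ab) => -[ht ->]; case: (clampP u ab) => -[hu ->];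
  by move: hu ht; lra.
Qed.

(** Over an interval of length [d] that starts at [a], the mean of [F] differs from [F a] by at most
    [C d]. *)
Lemma lip_mean_cvg a C (F : R -> R) : 0 <= C -> lbm F ->
  (forall u v, `|F v - F u| <= C * `|v - u|) ->
  k.+1%:R * Int (fun t => ico a (a + k.+1%:R^-1) t * F t) @[k --> \oo] --> F a.
Proof.
move=> C0 bF Flip.
have alg2 (x y p : R) : x * y = 1 -> x * (p * y * y) = y * p.
  by move=> xy; rewrite -[RHS]mul1r -xy; ring.
apply/cvgrPdist_le => e e0.
have /cvgrPdist_lt/(_ (e / (C + 1))) := @cvg_harmonic R.
rewrite divr_gt0 ?ltr_wpDl// => /(_ isT).
apply: filterS => k; rewrite sub0r normrN ger0_norm ?invr_ge0//= => ke.
have k0 : 0 < k.+1%:R^-1 :> R by rewrite invr_gt0.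
have kd : k.+1%:R * k.+1%:R^-1 = 1 :> R by rewrite divff.
set d := k.+1%:R^-1 in k0 ke kd *.
have Id : Int (ico a (a + d)) = d by rewrite Int_ico ?lerDl ?(ltW k0)// (addrC a) addrK.
have -> : F a - k.+1%:R * Int (fun t => ico a (a + d) t * F t) =
   k.+1%:R * Int (fun t => ico a (a + d) t * (F a - F t)).
  rewrite (_ : Int (fun t => _ * (F a - F t)) = d * F a - Int (fun t => ico a (a + d) t * F t)).
    by rewrite mulrBr mulrA kd mul1r.
  have -> : d * F a = Int (fun t => ico a (a + d) t * F a).
    rewrite -[in LHS]Id mulrC -IntZ; last exact: L1_ico.
    by apply: eq_Int => t; rewrite mulrC.
  rewrite -IntB; [|by apply: L1_ico_lbm; exact: lbm_cst|exact: L1_ico_lbm].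
  by apply: eq_Int => t; rewrite mulrBr.
rewrite normrM ger0_norm//.
apply: (@le_trans _ _ (k.+1%:R * (C * d * d))).
  apply: ler_wpM2l => //.
  have -> : C * d * d = Int (fun t => (C * d) * ico a (a + d) t).
    by rewrite IntZ ?Id//; exact: L1_ico.
  apply: norm_Int_le.
  - by apply: L1_ico_lbm; apply: lbmB => //; exact: lbm_cst.
  - by apply: L1Z; exact: L1_ico.
  move=> t; case: (icoP a (a + d) t) => [[[ta td] ->]|->]; rewrite ?mul0r ?mulr0 ?normr0//.
  rewrite mul1r mulr1; apply: le_trans (Flip _ _) _; apply: ler_wpM2l => //.
  by rewrite ler_norml; move: ta td k0; clear; lra.
rewrite alg2//.
move: ke; rewrite ltr_pdivlMr ?ltr_wpDl// => /ltW; apply: le_trans.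
by apply: ler_wpM2l; [exact: ltW|rewrite lerDl].
Qed.

(** The derivative is merely bounded and measurable. The integral of the difference quotients of the
    clamped function tends to that of [df] by dominated convergence. A change of variable shows that
    it also equals [f b] minus the mean of the clamped function over a short interval at [a], which
    tends to [f a]. *)
Lemma pder_FTC s a b C f df : a <= b -> measurable_fun setT df ->
  pder s a b f df -> (forall t, a < t < b -> `|df t| <= C) ->
  Int (fun t => ico a b t * df t) = f b - f a.
Proof.
move=> ab mdf hf dfC.
have [-> |ab'] := eqVneq a b.
  rewrite subrr -[RHS](@Int0 R); apply: eq_Int => t.
  by rewrite /ico; case: leP; case: ltP; rewrite ?mul0r//; lra.
have {ab ab'}ab : a < b by rewrite lt_neqAle ab' ab.
pose cl := clamp a b; pose F t := f (cl t).
have clab t : a <= cl t <= b by exact: clamp_itv.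
have cl_lip u v : u <= v -> 0 <= cl v - cl u <= v - u by exact: clamp_lip.
have C0 : 0 <= C.
  have := dfC ((a + b) / 2); have := normr_ge0 (df ((a + b) / 2)).
  by move=> h1 h2; apply: le_trans h1 (h2 _); lra.
have Flip u v : u <= v -> `|F v - F u| <= C * (v - u).
  move=> uv; have /andP[h0 h1] := cl_lip u v uv.
  have /andP[au ub] := clab u; have /andP[av vb] := clab v.
  apply: (@le_trans _ _ (C * (cl v - cl u))); last exact: ler_wpM2l.
  have uv' : cl u <= cl v by rewrite -subr_ge0.
  apply: (pder_norm uv' (pder_sub au vb hf)).
  move=> t tab _; apply: dfC; lra.
have Flip' u v : `|F v - F u| <= C * `|v - u|.
  case: (leP u v) => uv.
    by rewrite [in leRHS]ger0_norm ?subr_ge0// Flip.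
  by rewrite distrC [in leRHS]distrC [in leRHS]ger0_norm ?subr_ge0 ?Flip// ltW.
have cF : continuous F.
  move=> t; apply/cvgrPdist_lt => e e0.
  exists (e / (C + 1)) => /=; first by rewrite divr_gt0 ?ltr_wpDl.
  move=> u /=; rewrite distrC => ut; rewrite distrC.
  apply: le_lt_trans (Flip' _ _) _.
  apply: (@le_lt_trans _ _ ((C + 1) * `|u - t|)).
    by apply: ler_wpM2r => //; lra.
  by rewrite mulrC -ltr_pdivlMr// ltr_wpDl.
have bF := lbm_continuous cF.
pose fn (k : nat) t := ico a b t * (k.+1%:R * (F (t + k.+1%:R^-1) - F t)).
have bfn k : lbm (fn k).
  by apply: lbmM (lbm_ico a b) _; apply: lbmZ; apply: lbmB => //; exact: lbm_shift.
have Ft u : a <= u -> u <= b -> F u = f u.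
  move=> au ub; rewrite /F; case: (clampP u ab) => -[hu]; rewrite -/cl => ->//;
    congr f; move: hu; lra.
have Fnear t d : a < t < b -> d < b - t -> 0 < d -> F (t + d) = f (t + d) /\ F t = f t.
  by move=> tab db d0; rewrite !Ft//; move: db d0 tab; lra.
have cv : Int (fn k) @[k --> \oo] --> Int (fun t => ico a b t * df t).
  apply: (@DCT _ _ _ (fun t => C * ico a b t)).
  - by move=> k; case: (bfn k).
  - by apply: measurable_funM => //; case: (lbm_ico a b).
  - by apply: L1Z; exact: L1_ico.
  - have [N [mN N0 sN]] := negligible_seq (a :: s).
    exists N; split=> // t nt; apply: sN => /=; apply: contrapT => /negP.
    rewrite inE negb_or => /andP[ta ts]; apply: nt; rewrite /fn /=.
    case: (boolP (a < t < b)) => tab; last first.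
      rewrite (ico_out ta tab).
      by under eq_fun do rewrite mul0r; rewrite mul0r; exact: cvg_cst.
    apply: cvgM; first exact: cvg_cst.
    have [_ /(_ t tab ts) dft] := hf.
    have := is_derive_seq dft; apply: cvg_trans; apply: near_eq_cvg.
    have bt : 0 < b - t by lra.
    have /cvgrPdist_lt/(_ _ bt) := @cvg_harmonic R.
    apply: filterS => k; rewrite sub0r normrN ger0_norm ?invr_ge0//= => kbt.
    by have [-> ->] := Fnear t k.+1%:R^-1 tab kbt (ltac:(by rewrite invr_gt0)).
  - move=> k t; rewrite /fn normrM ger0_norm ?ico_ge0// mulrC.
    apply: ler_wpM2r; first exact: ico_ge0.
    rewrite normrM ger0_norm//; have := Flip' t (t + k.+1%:R^-1).
    have -> : t + k.+1%:R^-1 - t = k.+1%:R^-1 by rewrite addrC addKr.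
    rewrite [X in _ <= C * X]ger0_norm ?invr_ge0// => h.
    by rewrite mulrC -ler_pdivlMr//.
have alg1 (x y p q r : R) : x * y = 1 -> x * (p + y * q - (r + p)) = q - x * r.
  by move=> xy; rewrite -[in RHS](mul1r q) -xy; ring.
(* The shifted and the unshifted integral cancel on [[a + d, b]]; on [[b, b + d]] the clamped
   function is the constant [f b]. *)
have E (k : nat) : k.+1%:R^-1 <= b - a -> Int (fn k) =
   f b - k.+1%:R * Int (fun t => ico a (a + k.+1%:R^-1) t * F t).
  set d := k.+1%:R^-1 => dba.
  have d0 : 0 < d by rewrite invr_gt0.
  have bFs := lbm_shift d bF.
  have -> : Int (fn k) = k.+1%:R * (Int (fun t => ico a b t * F (t + d)) -
      Int (fun t => ico a b t * F t)).
    rewrite -IntB; [|exact: L1_ico_lbm..].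
    rewrite -IntZ; last by apply: L1B; exact: L1_ico_lbm.
    by apply: eq_Int => t; rewrite /fn; ring.
  have -> : Int (fun t => ico a b t * F (t + d)) = Int (fun t => ico (a + d) (b + d) t * F t).
    rewrite -[RHS](@Int_shift _ d) ?L1_ico_lbm//; last exact: L1_ico_lbm.
    by apply: eq_Int => t; rewrite /ico lerD2r ltrD2r.
  have -> : Int (fun t => ico (a + d) (b + d) t * F t) = Int (fun t => ico (a + d) b t * F t) +
       d * f b.
    rewrite (@Int_ico_split _ (a + d) b)//; last by lra.
    congr (_ + _).
    rewrite -[in RHS](addrK b d) (addrC d b) -Int_ico; last lra.
    rewrite mulrC -IntZ; last exact: L1_ico.
    apply: eq_Int => t; rewrite mulrC /ico; case: (leP b t) => bt /=; last by rewrite !mulr0.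
    by congr (_ * _); rewrite /F; case: (clampP t ab) => -[ht]; rewrite -/cl => ->//;
      congr f; move: ht; lra.
  rewrite [X in _ - X](@Int_ico_split _ a (a + d) b)//; last by lra.
  have kd : k.+1%:R * d = 1 by rewrite divff.
  exact: alg1.
have E2 : Int (fn k) @[k --> \oo] --> f b - f a.
  have Fa : F a = f a by rewrite Ft// ltW.
  have h := @lip_mean_cvg a C F C0 bF Flip'; rewrite Fa in h.
  have h2 : f b - k.+1%:R * Int (fun t => ico a (a + k.+1%:R^-1) t * F t) @[k --> \oo]
     --> f b - f a by apply: cvgB => //; exact: cvg_cst.
  apply: cvg_trans h2; apply: near_eq_cvg.
  have ba : 0 < b - a by rewrite subr_gt0.
  have /cvgrPdist_lt/(_ _ ba) := @cvg_harmonic R.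
  apply: filterS => k; rewrite sub0r normrN ger0_norm ?invr_ge0//= => /ltW kba.
  by rewrite E.
by rewrite -(cvg_lim _ cv)// -(cvg_lim _ E2).
Qed.

End PiecewiseDerivative.

(** * Euclidean norm and smallest eigenvalue *)

Section Norms.
Variable R : realType.
Implicit Types (a b c C : R).

Definition dot n (u v : 'cV[R]_n) : R := \sum_i u i 0 * v i 0.

Lemma dotE n (u v : 'cV[R]_n) : (u^T *m v) 0 0 = dot u v.
Proof. by rewrite mxE; apply: eq_bigr => i _; rewrite mxE. Qed.

Lemma dotC n (u v : 'cV[R]_n) : dot u v = dot v u.
Proof. by apply: eq_bigr => i _; rewrite mulrC. Qed.

Lemma dotDl n (u v w : 'cV[R]_n) : dot (u + v) w = dot u w + dot v w.
Proof. by rewrite /dot -big_split; apply: eq_bigr => i _; rewrite mxE mulrDl. Qed.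

Lemma dotDr n (u v w : 'cV[R]_n) : dot u (v + w) = dot u v + dot u w.
Proof. by rewrite dotC dotDl !(dotC u). Qed.

Lemma dotZl n c (u v : 'cV[R]_n) : dot (c *: u) v = c * dot u v.
Proof. by rewrite /dot mulr_sumr; apply: eq_bigr => i _; rewrite mxE mulrA. Qed.

Lemma dotZr n c (u v : 'cV[R]_n) : dot u (c *: v) = c * dot u v.
Proof. by rewrite dotC dotZl dotC. Qed.

Lemma dotNl n (u v : 'cV[R]_n) : dot (- u) v = - dot u v.
Proof. by rewrite -scaleN1r dotZl mulN1r. Qed.

Lemma dotNr n (u v : 'cV[R]_n) : dot u (- v) = - dot u v.
Proof. by rewrite dotC dotNl dotC. Qed.

Lemma dot0l n (v : 'cV[R]_n) : dot 0 v = 0.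
Proof. by rewrite /dot big1 // => i _; rewrite mxE mul0r. Qed.

Lemma dot0r n (v : 'cV[R]_n) : dot v 0 = 0.
Proof. by rewrite dotC dot0l. Qed.

Lemma dot_mulmx n (u v : 'cV[R]_n) (Q : 'M[R]_n) : dot u (Q *m v) = dot (Q^T *m u) v.
Proof. by rewrite -!dotE trmx_mul trmxK mulmxA. Qed.

Lemma dot_delta n (v : 'cV[R]_n) i : dot (delta_mx i 0) v = v i 0.
Proof.
rewrite /dot (bigD1 i)//= !mxE !eqxx mul1r big1 ?addr0// => j ji.
by rewrite !mxE (negbTE ji) mul0r.
Qed.

Lemma dot_ge0 n (v : 'cV[R]_n) : 0 <= dot v v.
Proof. by apply: sumr_ge0 => i _; rewrite -expr2 sqr_ge0. Qed.

Lemma dot_eq0 n (v : 'cV[R]_n) : (dot v v == 0) = (v == 0).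
Proof.
apply/idP/eqP => [|->]; last by rewrite dot0l.
rewrite /dot psumr_eq0 => [/allP h|i _]; last by rewrite -expr2 sqr_ge0.
apply/matrixP => i j; rewrite ord1 mxE; apply/eqP.
by rewrite -sqrf_eq0 expr2; apply: h; rewrite mem_index_enum.
Qed.

Lemma enormE n (v : 'cV[R]_n) : enorm v = Num.sqrt (dot v v).
Proof. by congr Num.sqrt; apply: eq_bigr => i _; rewrite expr2. Qed.

Lemma sqr_enorm n (v : 'cV[R]_n) : enorm v ^+ 2 = dot v v.
Proof. by rewrite enormE sqr_sqrtr// dot_ge0. Qed.

Lemma enorm_ge0 n (v : 'cV[R]_n) : 0 <= enorm v.
Proof. exact: sqrtr_ge0. Qed.

Lemma enorm_eq0 n (v : 'cV[R]_n) : (enorm v == 0) = (v == 0).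
Proof. by rewrite -sqrf_eq0 sqr_enorm dot_eq0. Qed.

Lemma enorm0 n : enorm (0 : 'cV[R]_n) = 0.
Proof. by apply/eqP; rewrite enorm_eq0. Qed.

Lemma enorm_gt0 n (v : 'cV[R]_n) : (0 < enorm v) = (v != 0).
Proof. by rewrite lt_neqAle enorm_ge0 andbT eq_sym enorm_eq0. Qed.

Lemma enormZ n c (v : 'cV[R]_n) : enorm (c *: v) = `|c| * enorm v.
Proof.
by rewrite !enormE dotZl dotZr mulrA -expr2 sqrtrM ?sqr_ge0// sqrtr_sqr.
Qed.

Lemma enormN n (v : 'cV[R]_n) : enorm (- v) = enorm v.
Proof. by rewrite -scaleN1r enormZ normrN1 mul1r. Qed.

Lemma cauchy_schwarz n (u v : 'cV[R]_n) : dot u v <= enorm u * enorm v.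
Proof.
have [->|u0] := eqVneq u 0; first by rewrite dot0l enorm0 mul0r.
have [->|v0] := eqVneq v 0; first by rewrite dot0r enorm0 mulr0.
have pu : 0 < enorm u by rewrite enorm_gt0.
have pv : 0 < enorm v by rewrite enorm_gt0.
have := dot_ge0 ((enorm v) *: u - (enorm u) *: v).
rewrite dotDl !dotDr !dotNl !dotNr !dotZl !dotZr -!sqr_enorm (dotC v u).
set p := enorm u in pu *; set q := enorm v in pv *; set d := dot u v => h.
have : 0 <= 2 * (p * q) * (p * q - d) by move: h; congr (0 <= _); ring.
by rewrite pmulr_rge0 ?subr_ge0// !mulr_gt0.
Qed.

Lemma norm_dot n (u v : 'cV[R]_n) : `|dot u v| <= enorm u * enorm v.
Proof.
rewrite ler_norml cauchy_schwarz andbT lerNl -dotNl -(enormN u).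
exact: cauchy_schwarz.
Qed.

(** Reduces norm estimates for vector integrals and increments to scalar ones, by pairing with a
    fixed vector. *)
Lemma enorm_dual n (v : 'cV[R]_n) c : 0 <= c ->
  (forall u, dot u v <= c * enorm u) -> enorm v <= c.
Proof.
move=> c0 /(_ v); rewrite -sqr_enorm expr2.
have [->|v0] := eqVneq v 0; first by rewrite enorm0.
by rewrite ler_pM2r ?enorm_gt0.
Qed.

Lemma enormD n (u v : 'cV[R]_n) : enorm (u + v) <= enorm u + enorm v.
Proof.
apply: enorm_dual => [|w]; first by rewrite addr_ge0 ?enorm_ge0.
by rewrite dotDr mulrDl lerD// mulrC cauchy_schwarz.
Qed.

Lemma enorm_sum n (I : Type) (r : seq I) (F : I -> 'cV[R]_n) :
  enorm (\sum_(i <- r) F i) <= \sum_(i <- r) enorm (F i).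
Proof.
elim: r => [|i r IH]; first by rewrite !big_nil enorm0.
by rewrite !big_cons (le_trans (enormD _ _))// lerD2l.
Qed.

Lemma enorm_delta n (i : 'I_n) : enorm (delta_mx i 0 : 'cV[R]_n) = 1.
Proof. by rewrite enormE dot_delta !mxE !eqxx sqrtr1. Qed.

Lemma coord_le_enorm n (v : 'cV[R]_n) i : `|v i 0| <= enorm v.
Proof. by rewrite -dot_delta (le_trans (norm_dot _ _))// enorm_delta mul1r. Qed.

Lemma enorm_le_sum n (v : 'cV[R]_n) : enorm v <= \sum_i `|v i 0|.
Proof.
have {1}-> : v = \sum_i v i 0 *: delta_mx i 0.
  apply/colP => i; rewrite summxE (bigD1 i)//= !mxE !eqxx mulr1 big1 ?addr0// => j ji.
  by rewrite !mxE eq_sym (negbTE ji) mulr0.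
apply: le_trans (enorm_sum _ _) _; apply: ler_sum => i _.
by rewrite enormZ enorm_delta mulr1.
Qed.

Definition mxabs n (Q : 'M[R]_n) := \sum_i \sum_j `|Q i j|.

Lemma mxabs_ge0 n (Q : 'M[R]_n) : 0 <= mxabs Q.
Proof. by apply: sumr_ge0 => i _; apply: sumr_ge0. Qed.

Lemma enorm_mulmx_abs n (Q : 'M[R]_n) v : enorm (Q *m v) <= mxabs Q * enorm v.
Proof.
apply: le_trans (enorm_le_sum _) _; rewrite mulr_suml; apply: ler_sum => i _.
rewrite mxE mulr_suml; apply: le_trans (ler_norm_sum _ _ _) _.
by apply: ler_sum => j _; rewrite normrM ler_wpM2l// coord_le_enorm.
Qed.

Lemma opnorm_has_sup n (Q : 'M[R]_n) :
  has_sup [set enorm (Q *m v) | v in [set v : 'cV[R]_n | enorm v <= 1]].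
Proof.
split; first by exists (enorm (Q *m 0)), 0 => //=; rewrite enorm0 ler01.
exists (mxabs Q) => _ [v /= v1 <-]; apply: le_trans (enorm_mulmx_abs _ _) _.
by rewrite ler_piMr// mxabs_ge0.
Qed.

Lemma opnorm_ub n (Q : 'M[R]_n) v : enorm v <= 1 -> enorm (Q *m v) <= opnorm Q.
Proof.
move=> v1; apply: sup_upper_bound; first exact: opnorm_has_sup.
by exists v.
Qed.

Lemma opnorm_ge0 n (Q : 'M[R]_n) : 0 <= opnorm Q.
Proof. by rewrite -(enorm0 n) -(mulmx0 _ Q) opnorm_ub// enorm0 ler01. Qed.

Lemma opnormP n (Q : 'M[R]_n) v : enorm (Q *m v) <= opnorm Q * enorm v.
Proof.
have [->|v0] := eqVneq v 0; first by rewrite mulmx0 enorm0 mulr0.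
have pv : 0 < enorm v by rewrite enorm_gt0.
rewrite -ler_pdivrMr// mulrC.
have := @opnorm_ub _ Q ((enorm v)^-1 *: v).
rewrite -scalemxAr !enormZ ger0_norm ?invr_ge0 ?enorm_ge0//.
by apply; rewrite mulVf// gt_eqF.
Qed.

Lemma opnorm_le n (Q : 'M[R]_n) c : 0 <= c ->
  (forall v, enorm (Q *m v) <= c * enorm v) -> opnorm Q <= c.
Proof.
move=> c0 h; apply: ge_sup; first by case: (opnorm_has_sup Q).
move=> _ [v /= v1 <-]; apply: le_trans (h v) _.
by rewrite ler_piMr.
Qed.

Lemma opnorm_abs n (Q : 'M[R]_n) : opnorm Q <= mxabs Q.
Proof. by apply: opnorm_le; [exact: mxabs_ge0|exact: enorm_mulmx_abs]. Qed.

Lemma norm_dot_opnorm n (u v : 'cV[R]_n) (Q : 'M[R]_n) :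
  `|dot u (Q *m v)| <= opnorm Q * enorm u * enorm v.
Proof.
apply: le_trans (norm_dot _ _) _; rewrite mulrAC mulrC.
by rewrite ler_wpM2r ?enorm_ge0// opnormP.
Qed.

Lemma continuous_bigsum (T : topologicalType) (I : Type) (r : seq I) (F : I -> T -> R) :
  (forall i, continuous (F i)) -> continuous (fun t => \sum_(i <- r) F i t).
Proof.
move=> cF; elim: r => [|i r IH] t.
  rewrite (_ : (fun _ => _) = fun=> 0); first exact: cst_continuous.
  by apply/funext => u; rewrite big_nil.
rewrite (_ : (fun _ => _) = fun u => F i u + \sum_(i0 <- r) F i0 u).
  by apply: continuousD; [exact: cF|exact: IH].
by apply/funext => u; rewrite big_cons.
Qed.

Lemma continuous_quadratic n (Q : 'M[R]_n) :
  continuous (fun v : 'rV[R]_n => dot v^T (Q *m v^T)).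
Proof.
have cc i : continuous (fun v : 'rV[R]_n => v 0 i) by exact: coord_continuous.
have E : (fun v : 'rV[R]_n => dot v^T (Q *m v^T)) =
    (fun v => \sum_i \sum_j v 0 i * (Q i j * v 0 j)).
  apply/funext => v; apply: eq_bigr => i _; rewrite !mxE mulr_sumr.
  by apply: eq_bigr => j _; rewrite mxE.
rewrite E; apply: continuous_bigsum => i; apply: continuous_bigsum => j v.
exact: (cvgM (cc i v) (cvgM (cvg_cst (Q i j)) (cc j v))).
Qed.

(** The unit sphere is compact, so the Rayleigh quotient attains its minimum. *)
Lemma quadratic_min n (Q : 'M[R]_n) : (0 < n)%N -> exists2 v : 'cV[R]_n,
  dot v v = 1 & forall w, dot v (Q *m v) * dot w w <= dot w (Q *m w).
Proof.
move=> n0; pose A : set 'rV[R]_n := [set v | dot v^T v^T = 1].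
have cdot : continuous (fun v : 'rV[R]_n => dot v^T v^T).
  have := @continuous_quadratic n 1%:M.
  by under eq_fun do rewrite mul1mx.
have A0 : A !=set0.
  exists (delta_mx 0 (Ordinal n0)); rewrite /A /= trmx_delta dot_delta !mxE.
  by rewrite !eqxx.
have clA : closed A.
  rewrite (_ : A = (fun v : 'rV[R]_n => dot v^T v^T) @^-1` [set 1])//.
  by apply: preimage_closed => // v _; exact: cdot.
have bA : bounded_set A.
  exists 1; split=> // x x1 v /= vA; apply: (le_trans _ (ltW x1)).
  rewrite /Num.Def.normr/= mx_normrE; apply: bigmax_le => // -[i j] _ /=.
  have := coord_le_enorm v^T j; rewrite mxE !ord1 enormE.
  by rewrite vA sqrtr1.
have cpA := bounded_closed_compact bA clA.
have [v /set_mem vA vmin] := EVT_min_rV A0 cpA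
  (continuous_subspaceT (@continuous_quadratic n Q)).
exists v^T => // w; have [->|w0] := eqVneq w 0; first by rewrite !dot0l mulr0.
have pw : 0 < enorm w by rewrite enorm_gt0.
have := vmin ((enorm w)^-1 *: w)^T.
rewrite trmxK -scalemxAr !dotZl !dotZr.
have -> : ((enorm w)^-1 *: w)^T \in A.
  rewrite inE /A /= trmxK dotZl dotZr -sqr_enorm.
  by field; rewrite gt_eqF.
move=> /(_ isT); rewrite mulrA -invfM -expr2 sqr_enorm => h.
by rewrite -ler_pdivlMr ?(le_trans h)// ?lt_neqAle ?dot_ge0 ?andbT 1?eq_sym ?dot_eq0// mulrC.
Qed.

(** If the residual [w = Q v - mu v] were nonzero, a small step from [v] to [v - t w] would push the
    form below [mu] times the squared norm, to first order in [t]. *)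
Lemma quadratic_min_eigen n (Q : 'M[R]_n) (v : 'cV[R]_n) mu : Q^T = Q ->
  (forall w, mu * dot w w <= dot w (Q *m w)) -> dot v (Q *m v) = mu * dot v v ->
  Q *m v = mu *: v.
Proof.
move=> Qs Qmin Qv; apply/eqP; rewrite -subr_eq0 -dot_eq0 -sqr_enorm sqrf_eq0.
set w := Q *m v - mu *: v; rewrite eq_le enorm_ge0 andbT.
have wE : dot w w = dot w (Q *m v) - mu * dot w v by rewrite {2}/w dotDr dotNr dotZr.
have sym : dot v (Q *m w) = dot w (Q *m v) by rewrite dot_mulmx Qs dotC.
clearbody w.
have key (t : R) : 0 <= t -> 0 <= - 2 * t * dot w w + t ^+ 2 * (dot w (Q *m w) - mu * dot w w).
  move=> t0; have := Qmin (v - t *: w).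
  rewrite mulmxBr -scalemxAr !(dotDl, dotDr, dotNl, dotNr, dotZl, dotZr) sym Qv (dotC v w) wE.
  by rewrite -subr_ge0; congr (0 <= _); ring.
rewrite leNgt; apply/negP => w0.
have d0 : 0 < dot w w by rewrite -sqr_enorm exprn_gt0.
set p := dot w w in key d0 *; set q := dot w (Q *m w) - mu * p in key.
(* With this [t] the second-order term satisfies [t q <= p], which is less than the first-order gain
   [2 p]. *)
pose t := p / (`|q| + 1).
have q1 : 0 < `|q| + 1 by rewrite ltr_wpDl.
have t0 : 0 < t by rewrite divr_gt0.
have := key t (ltW t0).
have -> : - 2 * t * p + t ^+ 2 * q = t * (t * q - 2 * p) by ring.
rewrite pmulr_rge0// subr_ge0 leNgt => /negP; apply.
have : t * q <= t * (`|q| + 1).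
  by rewrite ler_wpM2l ?(ltW t0)// (le_trans (ler_norm q))// lerDl.
have -> : t * (`|q| + 1) = p by rewrite /t divfK ?gt_eqF.
by move=> h; apply: le_lt_trans h _; move: d0; clear; lra.
Qed.

(** The least Rayleigh quotient is an eigenvalue and bounds all eigenvalues from below. For [n = 0]
    the set of eigenvalues would be empty. *)
Lemma lambda_min_spec n (W : 'M[R]_n) : (0 < n)%N -> posdefmx W ->
  0 < lambda_min W /\ forall w, lambda_min W * dot w w <= dot w (W *m w).
Proof.
move=> n0 [Ws Wpos]; have [v v1 vmin] := quadratic_min W n0.
set mu := dot v (W *m v) in vmin.
have v0 : v != 0 by rewrite -dot_eq0 v1 oner_eq0.
have mu0 : 0 < mu by rewrite /mu -dotE mulmxA; exact: Wpos.
have Wv : W *m v = mu *: v by apply: quadratic_min_eigen; rewrite // v1 mulr1.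
have lb a : eigenvalue W a -> mu <= a.
  move=> /eigenvalueP[u uW u0]; have := vmin u^T.
  have -> : W *m u^T = a *: u^T by rewrite -{1}Ws -trmx_mul uW linearZ.
  rewrite dotZr ler_pM2r// lt_neqAle dot_ge0 andbT eq_sym dot_eq0.
  by apply: contra u0 => /eqP u0; rewrite -[u]trmxK u0 trmx0.
have eig : eigenvalue W mu.
  apply/eigenvalueP; exists v^T.
    by rewrite -{1}Ws -trmx_mul Wv linearZ.
  by apply: contra v0 => /eqP v0; rewrite -[v]trmxK v0 trmx0.
have -> : lambda_min W = mu.
  apply/eqP; rewrite eq_le; apply/andP; split.
    by apply: ge_inf => //; exists mu => a; exact: lb.
  by apply: lb_le_inf; [exists mu|move=> a; exact: lb].
by [].
Qed.

Lemma dot_suml q (I : Type) (r : seq I) (F : I -> 'cV[R]_q) v :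
  dot (\sum_(i <- r) F i) v = \sum_(i <- r) dot (F i) v.
Proof. by elim: r => [|i r IH]; rewrite ?big_nil ?dot0l// !big_cons dotDl IH. Qed.

Lemma dot_sumr q (I : Type) (r : seq I) (F : I -> 'cV[R]_q) v :
  dot v (\sum_(i <- r) F i) = \sum_(i <- r) dot v (F i).
Proof. by rewrite dotC dot_suml; apply: eq_bigr => i _; exact: dotC. Qed.

Lemma opnorm_tr n (Q : 'M[R]_n) : opnorm Q^T <= opnorm Q.
Proof.
apply: opnorm_le => [|v]; first exact: opnorm_ge0.
apply: enorm_dual => [|u]; first by rewrite mulr_ge0 ?opnorm_ge0 ?enorm_ge0.
rewrite dot_mulmx trmxK; apply: le_trans (cauchy_schwarz _ _) _.
rewrite mulrAC ler_wpM2r ?enorm_ge0//; exact: opnormP.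
Qed.

Lemma qform_mxblock r p (B : 'I_r -> 'I_r -> 'M[R]_p) (c : 'I_r -> 'cV[R]_p) :
  ((\mxcol_i c i)^T *m (\mxblock_(i, j) B i j) *m (\mxcol_i c i)) 0 0 =
  \sum_i \sum_j dot (c i) (B i j *m c j).
Proof.
rewrite tr_mxcol mul_mxrow_mxblock mul_mxrow_mxcol summxE exchange_big /=.
apply: eq_bigr => j _; rewrite mulmx_suml summxE; apply: eq_bigr => i _.
by rewrite -mulmxA dotE.
Qed.

Lemma mx_entry_dot n (Q : 'M[R]_n) i j : Q i j = dot (delta_mx i 0) (Q *m delta_mx j 0).
Proof. by rewrite dot_delta -colE mxE. Qed.

End Norms.

(** * Matrix-valued functions *)

Section MatrixIntegral.
Variable R : realType.
Implicit Types (a b c C : R).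

Definition lbm2 (F : R * R -> R) := measurable_fun setT F /\
  forall T : R, exists2 C : R, 0 <= C &
    forall s t, `|s| <= T -> `|t| <= T -> `|F (s, t)| <= C.

Lemma eq_lbm2 F F' : F =1 F' -> lbm2 F -> lbm2 F'.
Proof. by move=> /funext ->. Qed.

Lemma lbm2_comp f (phi : R * R -> R) c : lbm f -> measurable_fun setT phi ->
  (forall s t, `|phi (s, t)| <= `|s| + `|t| + c) -> lbm2 (fun z => f (phi z)).
Proof.
case=> mf bf mphi hphi; split; first exact: measurableT_comp.
move=> T; have [C C0 fC] := bf (T + T + c); exists C => // s t sT tT.
by apply: fC; apply: le_trans (hphi s t) _; rewrite lerD2r lerD.
Qed.

Lemma lbm2_fst f : lbm f -> lbm2 (fun z => f z.1).
Proof.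
move=> bf; apply: (@lbm2_comp f fst 0) => // s t /=.
by rewrite addr0 lerDl.
Qed.

Lemma lbm2_snd f : lbm f -> lbm2 (fun z => f z.2).
Proof.
move=> bf; apply: (@lbm2_comp f snd 0) => // s t /=.
by rewrite addr0 lerDr.
Qed.

Lemma lbm2_add f : lbm f -> lbm2 (fun z => f (z.1 + z.2)).
Proof.
move=> bf; apply: (@lbm2_comp f (fun z => z.1 + z.2) 0) => //.
  exact: measurable_funD.
by move=> s t; rewrite addr0 ler_normD.
Qed.

Lemma lbm2_sub f : lbm f -> lbm2 (fun z => f (z.1 - z.2)).
Proof.
move=> bf; apply: (@lbm2_comp f (fun z => z.1 - z.2) 0) => //.
  exact: measurable_funB.
by move=> s t; rewrite addr0 ler_normB.
Qed.

Lemma lbm2D F F' : lbm2 F -> lbm2 F' -> lbm2 (fun z => F z + F' z).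
Proof.
case=> mF bF [mF' bF']; split; first exact: measurable_funD.
move=> T; have [C C0 hC] := bF T; have [D D0 hD] := bF' T.
exists (C + D); first exact: addr_ge0.
by move=> s t sT tT; rewrite (le_trans (ler_normD _ _))// lerD ?hC ?hD.
Qed.

Lemma lbm2M F F' : lbm2 F -> lbm2 F' -> lbm2 (fun z => F z * F' z).
Proof.
case=> mF bF [mF' bF']; split; first exact: measurable_funM.
move=> T; have [C C0 hC] := bF T; have [D D0 hD] := bF' T.
exists (C * D); first exact: mulr_ge0.
by move=> s t sT tT; rewrite normrM ler_pM ?hC ?hD.
Qed.

Lemma lbm2_sum (I : Type) (r : seq I) (F : I -> R * R -> R) :
  (forall i, lbm2 (F i)) -> lbm2 (fun z => \sum_(i <- r) F i z).
Proof.
move=> bF; elim: r => [|i r IH].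
  apply: (eq_lbm2 _ (lbm2_fst (lbm_cst (0 : R)))) => z; by rewrite big_nil.
by apply: (eq_lbm2 _ (lbm2D (bF i) IH)) => z; rewrite big_cons.
Qed.

Lemma Fubini_box F (T : R) : lbm2 F ->
  (forall s t, ~~ ((`|s| <= T) && (`|t| <= T)) -> F (s, t) = 0) ->
  Int (fun s => Int (fun t => F (s, t))) = Int (fun t => Int (fun s => F (s, t))) /\
  L1 (fun s => Int (fun t => F (s, t))).
Proof.
case=> mF bF F0; have [C C0 hC] := bF T.
have lp : L1 (fun s => C * icc (- T) T s) by apply: L1Z; exact: L1_icc.
have lq := L1_icc (- T) T.
have dom s t : `|F (s, t)| <= (C * icc (- T) T s) * icc (- T) T t.
  rewrite /icc -!ler_norml; case: (boolP (`|s| <= T)) => sT; last first.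
    by rewrite F0 ?(negbTE sT)// normr0 mulr0 mul0r.
  case: (boolP (`|t| <= T)) => tT; last first.
    by rewrite F0 ?(negbTE tT) ?andbF// normr0 mulr0.
  by rewrite !mulr1 hC.
have p0 s : 0 <= C * icc (- T) T s by rewrite mulr_ge0 ?icc_ge0.
split; first exact: (Fubini_Int mF lp lq dom p0 (icc_ge0 _ _)).
exact: (Fubini_L1 mF lp lq dom p0 (icc_ge0 _ _)).
Qed.

(** Pointwise limit of the cut-offs. Fubini's theorem yields the measurability of a convolution only
    after such a cut-off. *)
Lemma measurable_cutoff (f : R -> R) : (forall k : nat, measurable_fun setT
   (fun t => icc (- k%:R) k%:R t * f t)) -> measurable_fun setT f.
Proof.
move=> mf; apply: (@measurable_fun_cvg _ _ _ _
  (fun (k : nat) t => icc (- k%:R) k%:R t * f t)) => //.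
move=> t _; apply/cvgrPdist_lt => e e0.
exists (Num.truncn `|t|).+1 => // k /= tk.
have h : `|t| <= k%:R.
  apply: le_trans (ltW (truncnS_gt _)) _; by rewrite ler_nat.
by rewrite /icc -ler_norml h mul1r subrr normr0.
Qed.

Lemma lbm_conv (F : R * R -> R) (T : R) : lbm2 F ->
  (forall s t, ~~ (`|t| <= T) -> F (s, t) = 0) ->
  lbm (fun s => Int (fun t => F (s, t))).
Proof.
move=> bF F0; split.
  apply: measurable_cutoff => k.
  have b2 : lbm2 (fun z => icc (- k%:R) k%:R z.1 * F z).
    by apply: lbm2M => //; apply: lbm2_fst; exact: lbm_icc.
  have [|_ h] := @Fubini_box _ (Num.max T k%:R) b2.
    move=> s t; rewrite negb_and => /orP[] h.
      rewrite /icc -ler_norml (_ : (`|s| <= _) = false) ?mul0r//.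
      by apply: contraNF h => h; rewrite le_max h orbT.
    rewrite F0 ?mulr0//; by apply: contra h => h; rewrite le_max h.
  apply: L1_meas; apply: eq_L1 h => s /=; rewrite IntZ//.
  case: bF => mF bF; have [C C0 hC] := bF (Num.max `|s| T).
  apply: (@L1_bounded _ (- T) T C).
  - by apply: (measurableT_comp mF); exact: measurable_fun_pair.
  - by move=> t; rewrite -ler_norml => tT; apply: hC; rewrite le_max ?lexx ?tT ?orbT.
  - by move=> t; rewrite -ler_norml; exact: F0.
move=> S; case: bF => mF bF; have [C C0 hC] := bF (Num.max S T).
exists (Int (fun t => C * icc (- T) T t)).
  by apply: Int_ge0 => t; rewrite mulr_ge0// icc_ge0.
move=> s sS; have mFs : measurable_fun setT (fun t => F (s, t)).
  by apply: (measurableT_comp mF); exact: measurable_fun_pair.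
have dom t : `|F (s, t)| <= C * icc (- T) T t.
  rewrite /icc -ler_norml; case: (boolP (`|t| <= T)) => tT; last first.
    by rewrite F0 ?normr0 ?mulr0.
  by rewrite mulr1; apply: hC; rewrite le_max ?sS ?tT ?orbT.
have lC : L1 (fun t => C * icc (- T) T t) by apply: L1Z; exact: L1_icc.
by apply: norm_Int_le => //; exact: L1_le dom.
Qed.

Definition mlbm p q (X : R -> 'M[R]_(p, q)) := forall i j, lbm (fun t => X t i j).
Definition mlbm2 p q (X : R * R -> 'M[R]_(p, q)) := forall i j, lbm2 (fun t => X t i j).
Definition mL1 p q (X : R -> 'M[R]_(p, q)) := forall i j, L1 (fun t => X t i j).
Definition MInt p q (X : R -> 'M[R]_(p, q)) : 'M[R]_(p, q) :=
  \matrix_(i, j) Int (fun t => X t i j).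

Section Algebra.
Variables p q r : nat.
Implicit Types (X : R -> 'M[R]_(p, q)) (Y : R -> 'M[R]_(q, r)).

Lemma eq_mlbm X X' : X =1 X' -> mlbm X -> mlbm X'.
Proof. by move=> /funext ->. Qed.

Lemma eq_mL1 X X' : X =1 X' -> mL1 X -> mL1 X'.
Proof. by move=> /funext ->. Qed.

Lemma eq_MInt X X' : X =1 X' -> MInt X = MInt X'.
Proof. by move=> /funext ->. Qed.

Lemma mlbmD X X' : mlbm X -> mlbm X' -> mlbm (fun t => X t + X' t).
Proof. by move=> bX bX' i j; apply: eq_lbm (lbmD (bX i j) (bX' i j)) => t; rewrite mxE. Qed.

Lemma mlbmN X : mlbm X -> mlbm (fun t => - X t).
Proof. by move=> bX i j; apply: eq_lbm (lbmN (bX i j)) => t; rewrite mxE. Qed.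

Lemma mlbmB X X' : mlbm X -> mlbm X' -> mlbm (fun t => X t - X' t).
Proof. by move=> bX bX'; apply: mlbmD => //; exact: mlbmN. Qed.

Lemma mlbm_cst (M : 'M[R]_(p, q)) : mlbm (fun=> M).
Proof. by move=> i j; exact: lbm_cst. Qed.

Lemma mlbmZ f X : lbm f -> mlbm X -> mlbm (fun t => f t *: X t).
Proof. by move=> bf bX i j; apply: eq_lbm (lbmM bf (bX i j)) => t; rewrite mxE. Qed.

Lemma mlbmM X Y : mlbm X -> mlbm Y -> mlbm (fun t => X t *m Y t).
Proof.
move=> bX bY i j.
apply: (@eq_lbm _ (fun t => \sum_k X t i k * Y t k j)) => [t|]; first by rewrite mxE.
by apply: lbm_sum => k; exact: lbmM.
Qed.

Lemma mlbm_sum (I : Type) (s : seq I) (F : I -> R -> 'M[R]_(p, q)) :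
  (forall i, mlbm (F i)) -> mlbm (fun t => \sum_(i <- s) F i t).
Proof.
move=> bF i j; apply: (@eq_lbm _ (fun t => \sum_(k <- s) F k t i j)) => [t|].
  by rewrite summxE.
by apply: lbm_sum => k; exact: bF.
Qed.

Lemma mlbm_shift a X : mlbm X -> mlbm (fun t => X (t + a)).
Proof. by move=> bX i j; exact: (lbm_shift a (bX i j)). Qed.

Lemma mlbm_refl a X : mlbm X -> mlbm (fun t => X (a - t)).
Proof. by move=> bX i j; exact: (lbm_refl a (bX i j)). Qed.

Lemma mlbm_opp X : mlbm X -> mlbm (fun t => X (- t)).
Proof. by move=> bX i j; exact: (lbm_opp (bX i j)). Qed.

Lemma mlbm_tr X : mlbm X -> mlbm (fun t => (X t)^T).
Proof. by move=> bX i j; apply: eq_lbm (bX j i) => t; rewrite mxE. Qed.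

Lemma mlbm_mL1 a b X : mlbm X -> (forall t, ~~ (a <= t <= b) -> X t = 0) -> mL1 X.
Proof.
move=> bX X0 i j; apply: (@lbm_L1 _ a b) => // t tab.
by rewrite X0 // mxE.
Qed.

Lemma mL1D X X' : mL1 X -> mL1 X' -> mL1 (fun t => X t + X' t).
Proof. by move=> bX bX' i j; apply: eq_L1 (L1D (bX i j) (bX' i j)) => t; rewrite mxE. Qed.

Lemma mL1_sum (I : Type) (s : seq I) (F : I -> R -> 'M[R]_(p, q)) :
  (forall i, mL1 (F i)) -> mL1 (fun t => \sum_(i <- s) F i t).
Proof.
move=> bF i j; apply: (@eq_L1 _ (fun t => \sum_(k <- s) F k t i j)) => [t|].
  by rewrite summxE.
by apply: L1_sum => k; exact: bF.
Qed.

Lemma mL1_mr X (M : 'M[R]_(q, r)) : mL1 X -> mL1 (fun t => X t *m M).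
Proof.
move=> lX i j; apply: (@eq_L1 _ (fun t => \sum_k M k j * X t i k)) => [t|].
  by rewrite mxE; apply: eq_bigr => k _; rewrite mulrC.
by apply: L1_sum => k; exact: L1Z.
Qed.

Lemma MIntD X X' : mL1 X -> mL1 X' -> MInt (fun t => X t + X' t) = MInt X + MInt X'.
Proof.
move=> lX lX'; apply/matrixP => i j; rewrite !mxE -IntD//.
by apply: eq_Int => t; rewrite mxE.
Qed.

Lemma MIntN X : mL1 X -> MInt (fun t => - X t) = - MInt X.
Proof.
move=> lX; apply/matrixP => i j; rewrite !mxE -IntN//.
by apply: eq_Int => t; rewrite mxE.
Qed.

Lemma MInt0 : MInt (fun=> 0 : 'M[R]_(p, q)) = 0.
Proof.
apply/matrixP => i j; rewrite [LHS]mxE [RHS]mxE -[RHS](@Int0 R).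
by apply: eq_Int => t; rewrite ?mxE.
Qed.

Lemma MIntZ c X : mL1 X -> MInt (fun t => c *: X t) = c *: MInt X.
Proof.
move=> lX; apply/matrixP => i j; rewrite !mxE -IntZ//.
by apply: eq_Int => t; rewrite mxE.
Qed.

Lemma MInt_sum (I : Type) (s : seq I) (F : I -> R -> 'M[R]_(p, q)) :
  (forall i, mL1 (F i)) ->
  MInt (fun t => \sum_(i <- s) F i t) = \sum_(i <- s) MInt (F i).
Proof.
move=> lF; apply/matrixP => i j; rewrite summxE mxE.
under [RHS]eq_bigr do rewrite mxE.
rewrite -Int_sum; last by move=> k; exact: lF.
by apply: eq_Int => t; rewrite summxE.
Qed.

Lemma MInt_ml (M : 'M[R]_(p, q)) Y : mL1 Y -> MInt (fun t => M *m Y t) = M *m MInt Y.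
Proof.
move=> lY; apply/matrixP => i j; rewrite !mxE.
under [RHS]eq_bigr do rewrite mxE -IntZ//.
rewrite -Int_sum; last by move=> k; exact: L1Z.
by apply: eq_Int => t; rewrite mxE.
Qed.

Lemma MInt_mr X (M : 'M[R]_(q, r)) : mL1 X -> MInt (fun t => X t *m M) = MInt X *m M.
Proof.
move=> lX; apply/matrixP => i j; rewrite !mxE.
under [RHS]eq_bigr do rewrite mxE mulrC -IntZ//.
rewrite -Int_sum; last by move=> k; exact: L1Z.
by apply: eq_Int => t; rewrite mxE; apply: eq_bigr => k _; rewrite mulrC.
Qed.

Lemma MInt_shift a X : mL1 X -> MInt (fun t => X (t + a)) = MInt X.
Proof. by move=> lX; apply/matrixP => i j; rewrite !mxE; exact: (Int_shift a (lX i j)). Qed.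

Lemma MInt_tr X : (MInt X)^T = MInt (fun t => (X t)^T).
Proof. by apply/matrixP => i j; rewrite !mxE; apply: eq_Int => t; rewrite mxE. Qed.

Lemma mlbm2M (X : R * R -> 'M[R]_(p, q)) (Y : R * R -> 'M[R]_(q, r)) :
  mlbm2 X -> mlbm2 Y -> mlbm2 (fun z => X z *m Y z).
Proof.
move=> bX bY i j.
apply: (@eq_lbm2 (fun t => \sum_k X t i k * Y t k j)) => [t|]; first by rewrite mxE.
by apply: lbm2_sum => k; exact: lbm2M.
Qed.

Lemma MInt_itv a b X : mxint a b X = MInt (fun t => icc a b t *: X t).
Proof.
by apply/matrixP => i j; rewrite !mxE Int_itv; apply: eq_Int => t; rewrite mxE.
Qed.

Lemma MInt_Fubini (F : R * R -> 'M[R]_(p, q)) (T : R) : mlbm2 F ->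
  (forall s t, ~~ ((`|s| <= T) && (`|t| <= T)) -> F (s, t) = 0) ->
  MInt (fun s => MInt (fun t => F (s, t))) = MInt (fun t => MInt (fun s => F (s, t))).
Proof.
move=> bF F0; apply/matrixP => i j; rewrite [LHS]mxE [RHS]mxE.
have F0' s t : ~~ ((`|s| <= T) && (`|t| <= T)) -> F (s, t) i j = 0.
  by move=> h; rewrite F0// mxE.
have [h _] := @Fubini_box (fun z => F z i j) T (bF i j) F0'.
have -> : (fun s => MInt (fun t => F (s, t)) i j) =
    (fun s => Int (fun t => F (s, t) i j)) by apply/funext => s; rewrite mxE.
have -> : (fun t => MInt (fun s => F (s, t)) i j) =
    (fun t => Int (fun s => F (s, t) i j)) by apply/funext => s; rewrite mxE.
exact: h.
Qed.

Lemma mlbm_conv (F : R * R -> 'M[R]_(p, q)) (T : R) : mlbm2 F ->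
  (forall s t, ~~ (`|t| <= T) -> F (s, t) = 0) ->
  mlbm (fun s => MInt (fun t => F (s, t))).
Proof.
move=> bF F0 i j; apply: eq_lbm (@lbm_conv _ T (bF i j) _) => [s|s t tT].
  by rewrite mxE.
by rewrite F0// mxE.
Qed.

End Algebra.

Lemma Int_dot n (u : 'cV[R]_n) (x : R -> 'cV[R]_n) : mL1 x ->
  dot u (MInt x) = Int (fun t => dot u (x t)) /\ L1 (fun t => dot u (x t)).
Proof.
move=> lx; split; last by apply: L1_sum => i; exact: L1Z.
rewrite /dot; under eq_bigr do rewrite mxE -IntZ//.
by rewrite -Int_sum// => i; exact: L1Z.
Qed.

Lemma enorm_MInt n (x : R -> 'cV[R]_n) g : mL1 x -> L1 g ->
  (forall t, enorm (x t) <= g t) -> enorm (MInt x) <= Int g.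
Proof.
move=> lx lg xg; have g0 : 0 <= Int g.
  by apply: Int_ge0 => t; apply: le_trans (xg t); exact: enorm_ge0.
apply: enorm_dual => // u; have [-> lu] := Int_dot u lx.
rewrite mulrC -IntZ//; apply: le_Int => //; first exact: L1Z.
move=> t; apply: le_trans (cauchy_schwarz _ _) _.
by rewrite ler_wpM2l ?enorm_ge0.
Qed.

Lemma lbm_dot n (x y : R -> 'cV[R]_n) : mlbm x -> mlbm y -> lbm (fun t => dot (x t) (y t)).
Proof. by move=> bx by_; apply: lbm_sum => i; exact: lbmM. Qed.

Lemma mlbm2_swap p q (F : R * R -> 'M[R]_(p, q)) : mlbm2 F -> mlbm2 (fun z => F (z.2, z.1)).
Proof.
move=> bF i j; have [mF hF] := bF i j; split=> [|T]; last first.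
  by have [C C0 hC] := hF T; exists C => // s t sT tT; apply: hC.
by apply: (measurableT_comp mF); exact: measurable_swap.
Qed.

Lemma mL1_MInt p q (F : R * R -> 'M[R]_(p, q)) (T : R) : mlbm2 F ->
  (forall s t, ~~ ((`|s| <= T) && (`|t| <= T)) -> F (s, t) = 0) ->
  mL1 (fun s => MInt (fun t => F (s, t))).
Proof.
move=> bF F0; apply: (@mlbm_mL1 p q (- T) T).
  by apply: (@mlbm_conv p q F T bF) => s t tT; apply: F0; rewrite (negbTE tT) andbF.
move=> s; rewrite -ler_norml => sT; rewrite -[RHS](@MInt0 p q); apply: eq_MInt => t.
by apply: F0; rewrite (negbTE sT).
Qed.

Lemma mL1_MInt_swap p q (F : R * R -> 'M[R]_(p, q)) (T : R) :
  mlbm2 F ->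
  (forall s t, ~~ ((`|s| <= T) && (`|t| <= T)) -> F (s, t) = 0) ->
  mL1 (fun t => MInt (fun s => F (s, t))).
Proof.
move=> bF F0; apply: (@mL1_MInt _ _ (fun z => F (z.2, z.1)) T (mlbm2_swap bF)) => s t hst.
by apply: F0; rewrite andbC.
Qed.

(** For integrals over all times, where the integrand has no bounded support and [MInt_Fubini] does
    not apply. *)
Lemma Fubini_dom p q (F : R * R -> 'M[R]_(p, q)) f g : mlbm2 F -> L1 f -> L1 g ->
  (forall t, 0 <= f t) -> (forall t, 0 <= g t) ->
  (forall s t i j, `|F (s, t) i j| <= f s * g t) ->
  [/\ MInt (fun s => MInt (fun t => F (s, t))) = MInt (fun t => MInt (fun s => F (s, t))),
      mL1 (fun s => MInt (fun t => F (s, t))) & mL1 (fun t => MInt (fun s => F (s, t)))].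
Proof.
move=> bF lf lg f0 g0 Ffg.
have E1 i j : (fun s => MInt (fun t => F (s, t)) i j) = (fun s => Int (fun t => F (s, t) i j)).
  by apply/funext => s; rewrite mxE.
have E2 i j : (fun t => MInt (fun s => F (s, t)) i j) = (fun t => Int (fun s => F (s, t) i j)).
  by apply/funext => s; rewrite mxE.
have mF i j : measurable_fun setT (fun z => F z i j) by case: (bF i j).
split.
- apply/matrixP => i j; rewrite [LHS]mxE [RHS]mxE E1 E2.
  exact: (Fubini_Int (mF i j) lf lg (fun s t => Ffg s t i j) f0 g0).
- by move=> i j; rewrite E1; exact: (Fubini_L1 (mF i j) lf lg (fun s t => Ffg s t i j) f0 g0).
by move=> i j; rewrite E2; exact: (Fubini_L1' (mF i j) lf lg (fun s t => Ffg s t i j) f0 g0).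
Qed.

End MatrixIntegral.

(** * Piecewise continuous functions are bounded and measurable *)

Section PiecewiseContinuous.
Variable R : realType.
Implicit Types (a b c t x e d C : R).

(** The one-sided limits bound the function near each point, and compactness of the interval makes
    the bound uniform. *)
Lemma one_sided_bounded a b (f : R -> R) :
  (forall t, a <= t < b -> cvg (f x @[x --> t^'+])) ->
  (forall t, a < t <= b -> cvg (f x @[x --> t^'-])) ->
  exists C, forall t, a <= t <= b -> `|f t| <= C.
Proof.
move=> fr fl.
have loc x : a <= x <= b -> exists C d, 0 < d /\
    forall u, `|x - u| < d -> a <= u <= b -> `|f u| <= C.
  move=> /andP[ax xb].
  have [Cr [dr [dr0 hr]]] : exists Cr dr, 0 < dr /\
      forall u, `|x - u| < dr -> a <= u <= b -> x < u -> `|f u| <= Cr.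
    case: (ltP x b) => xb'; last first.
      exists 0, 1; split=> // u _ /andP[_ ub] xu.
      by move: (lt_le_trans xu ub); rewrite ltNge xb'.
    have /cvg_ex[l hl] : cvg (f x0 @[x0 --> x^'+]) by apply: fr; rewrite ax.
    move: hl => /cvgrPdist_lt/(_ 1 ltr01); rewrite near_withinE => -[d /= d0 h].
    exists (`|l| + 1), d; split=> // u ud _ xu.
    rewrite -[f u](subrK l) addrC (le_trans (ler_normD _ _))// lerD2l distrC.
    exact/ltW/h.
  have [Cl [dl [dl0 hl]]] : exists Cr dr, 0 < dr /\
      forall u, `|x - u| < dr -> a <= u <= b -> u < x -> `|f u| <= Cr.
    case: (ltP a x) => ax'; last first.
      exists 0, 1; split=> // u _ /andP[au _] ux.
      by move: (le_lt_trans au ux); rewrite ltNge ax'.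
    have /cvg_ex[l hl] : cvg (f x0 @[x0 --> x^'-]) by apply: fl; rewrite xb andbT.
    move: hl => /cvgrPdist_lt/(_ 1 ltr01); rewrite near_withinE => -[d /= d0 h].
    exists (`|l| + 1), d; split=> // u ud _ xu.
    rewrite -[f u](subrK l) addrC (le_trans (ler_normD _ _))// lerD2l distrC.
    exact/ltW/h.
  exists (Num.max `|f x| (Num.max Cr Cl)), (Num.min dr dl); split.
    by rewrite lt_min dr0.
  move=> u; rewrite lt_min => /andP[ur ul] uab; rewrite !le_max.
  case: (ltgtP x u) => [xu|ux|<-]; rewrite ?lexx//.
    by rewrite hr ?orbT.
  by rewrite hl ?orbT.
have /compact_near_coveringP := @segment_compact R a b.
move=> /(_ R (pinfty_nbhs R) (fun C t => a <= t <= b -> `|f t| <= C) _).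
case.
  move=> x /=; rewrite in_itv/= => xab; have [C [d [d0 h]]] := loc x xab.
  exists (ball x d, [set D | C < D]); first split=> /=.
  - by exists d.
  - by exists C; split; rewrite ?num_real.
  - by move=> [u D] /= [xu CD] uab; exact: le_trans (h u xu uab) (ltW CD).
move=> M [_ h]; exists (M + 1) => t tab.
by apply: h => //=; rewrite ?in_itv ?ltrDl.
Qed.

(** Removing the finitely many points of [s] from the open interval leaves an open set on which [f]
    is continuous, and every function is measurable on a finite set. *)
Lemma measurable_off_seq a b (s : seq R) (f : R -> R) :
  (forall t, a < t < b -> t \notin s -> {for t, continuous f}) ->
  measurable_fun setT (fun t => icc a b t * f t).
Proof.
move=> cf; set g := fun t => icc a b t * f t.
have clS (r : seq R) : closed [set` r].
  apply: (accessible_finite_set_closed.1 (hausdorff_accessible (@norm_hausdorff _ R))).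
  exact: finite_seq.
pose D := [set` `]a, b[] `&` ~` [set` s].
have oD : open D.
  apply: openI; first exact: itv_open.
  by apply: closed_openC; exact: clS.
have mD : measurable D by exact: open_measurable.
have mfD : measurable_fun D f.
  apply: open_continuous_measurable_fun => // t; rewrite inE => -[/= tab ts].
  by apply: cf; [move: tab; rewrite in_itv|apply/negP].
have mgD : measurable_fun D g.
  apply: eq_measurable_fun mfD => t; rewrite inE => -[/= tab _].
  move: tab; rewrite in_itv/= => /andP[at_ tb].
  by rewrite /g /icc !ltW// mul1r.
have mS (r : seq R) : measurable [set` r] /\ measurable_fun [set` r] g.
  elim: r => [|x r [mr mgr]].
    rewrite (_ : [set` [::]] = set0); last by apply/seteqP; split.
    by split; [exact: measurable0|exact: measurable_fun_set0].
  rewrite (_ : [set` x :: r] = [set x] `|` [set` r]); last first.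
    apply/seteqP; split => y /=; rewrite in_cons; first by move/predU1P.
    by move=> h; apply/predU1P.
  split; first exact: measurableU.
  by apply/measurable_funU => //; split=> //; exact: measurable_fun_set1.
have mab : measurable (~` [set` `[a, b]] : set R) by apply: measurableC; exact: measurable_itv.
have mgab : measurable_fun (~` [set` `[a, b]]) g.
  have mc : measurable_fun (~` [set` `[a, b]]) (fun=> 0 : R) by [].
  apply: eq_measurable_fun mc => t; rewrite inE /= in_itv/=.
  by move=> /negP h; rewrite /g /icc (negbTE h) mul0r.
have [mr mgr] := mS (a :: b :: s).
rewrite (_ : setT = (D `|` [set` a :: b :: s]) `|` ~` [set` `[a, b]]).
  by apply/measurable_funU; [exact: measurableU|by []|split=> //; apply/measurable_funU].
apply/seteqP; split=> // t _.
case: (boolP (t \in `[a, b])) => tab; last by right; exact/negP.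
left; case: (boolP (t \in a :: b :: s)) => ts; first by right.
left; move: ts; rewrite !inE !negb_or => /and3P[ta tb ts]; split; last exact/negP.
by move: tab; rewrite /= !in_itv/= => /andP[h1 h2]; rewrite !lt_neqAle eq_sym ta h1 tb.
Qed.

Lemma entry_le_mx_norm p q (M : 'M[R]_(p, q)) i j : `|M i j| <= `|M|.
Proof. by rewrite [in leRHS]/Num.Def.normr/= mx_normrE; exact: (le_bigmax _ _ (i, j)). Qed.

Lemma cvg_entry T p q (X : T -> 'M[R]_(p, q)) (l : 'M[R]_(p, q))
    (F : set_system T) {FF : Filter F} i j :
  X x @[x --> F] --> l -> X x i j @[x --> F] --> l i j.
Proof.
move=> /cvgrPdist_lt h; apply/cvgrPdist_lt => e e0.
apply: filterS (h e e0) => x; apply: le_lt_trans.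
by have := entry_le_mx_norm (l - X x) i j; rewrite !mxE.
Qed.

Lemma cvg_matrix T p q (X : T -> 'M[R]_(p, q)) (l : 'M[R]_(p, q))
    (F : set_system T) {FF : Filter F} :
  (forall i j, X x i j @[x --> F] --> l i j) -> X x @[x --> F] --> l.
Proof.
move=> h; apply/cvgrPdist_lt => e e0.
have : \forall x \near F, forall ij : 'I_p * 'I_q, `|l ij.1 ij.2 - X x ij.1 ij.2| < e.
  by apply: filter_forall => ij; have /cvgrPdist_lt/(_ e e0) := h ij.1 ij.2.
apply: filterS => x hx; rewrite /Num.Def.normr/= mx_normrE.
by apply: bigmax_lt => // -[i j] _; have := hx (i, j); rewrite /= !mxE.
Qed.

Lemma pc_mlbm p q a b (X : R -> 'M[R]_(p, q)) : piecewise_continuous a b X ->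
  mlbm (fun t => icc a b t *: X t).
Proof.
case=> -[s cX] Xr Xl i j.
have [C hC] : exists C, forall t, a <= t <= b -> `|X t i j| <= C.
  apply: one_sided_bounded => t tab; apply/cvg_ex.
    by have /cvg_ex[l hl] := Xr t tab; exists (l i j); exact: cvg_entry.
  by have /cvg_ex[l hl] := Xl t tab; exists (l i j); exact: cvg_entry.
split.
  under eq_fun do rewrite mxE.
  apply: (@measurable_off_seq _ _ s) => t tab ts.
  exact: (cvg_entry (cX t tab ts)).
move=> T; exists `|C| => // t _; rewrite mxE /icc.
case: (boolP (a <= t <= b)) => tab; last by rewrite mul0r normr0.
by rewrite mul1r (le_trans (hC t tab))// ler_norm.
Qed.

Lemma mlbm_bounded p q a b (X : R -> 'M[R]_(p, q)) : mlbm X ->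
  exists2 C, 0 <= C & forall t, a <= t <= b -> forall i j, `|X t i j| <= C.
Proof.
move=> bX.
have /choice [f hf] : forall ij : 'I_p * 'I_q, exists C, 0 <= C /\
    forall t, a <= t <= b -> `|X t ij.1 ij.2| <= C.
  by move=> [i j]; have [C C0 h] := lbm_itv a b (bX i j); exists C.
exists (\sum_ij f ij); first by apply: sumr_ge0 => ij _; case: (hf ij).
move=> t tab i j; rewrite (bigD1 (i, j))//=.
have [f0 h] := hf (i, j); apply: le_trans (h t tab) _; rewrite lerDl.
by apply: sumr_ge0 => ij _; case: (hf ij).
Qed.

Lemma mlbm_enorm_bounded n a b (x : R -> 'cV[R]_n) : mlbm x ->
  exists2 C, 0 <= C & forall t, a <= t <= b -> enorm (x t) <= C.
Proof.
move=> bx; have [C C0 h] := mlbm_bounded a b bx.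
exists (\sum_(i < n) C); first exact: sumr_ge0.
move=> t tab; apply: le_trans (enorm_le_sum _) _; apply: ler_sum => i _.
exact: h.
Qed.

Lemma mlbm_opnorm_bounded n a b (X : R -> 'M[R]_n) : mlbm X ->
  exists2 C, 0 <= C & forall t, a <= t <= b -> opnorm (X t) <= C.
Proof.
move=> bx; have [C C0 h] := mlbm_bounded a b bx.
exists (\sum_(i < n) \sum_(j < n) C); first by do 2 apply: sumr_ge0 => ? _.
move=> t tab; apply: le_trans (opnorm_abs _) _; apply: ler_sum => i _.
by apply: ler_sum => j _; exact: h.
Qed.

End PiecewiseContinuous.

(** * Entrywise derivatives of matrix functions *)

Section VectorDerivative.
Variable R : realType.
Implicit Types (a b c t e d C : R) (s : seq R).

Definition pderm p q s a b (X dX : R -> 'M[R]_(p, q)) :=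
  forall i j, pder s a b (fun t => X t i j) (fun t => dX t i j).

Lemma pderm_sub p q s a b c d (X dX : R -> 'M[R]_(p, q)) : a <= c -> d <= b ->
  pderm s a b X dX -> pderm s c d X dX.
Proof. by move=> ac db h i j; exact: pder_sub (h i j). Qed.

Lemma eq_pderm p q s a b (X dX dY : R -> 'M[R]_(p, q)) :
  (forall t, a < t < b -> dX t = dY t) -> pderm s a b X dX -> pderm s a b X dY.
Proof. by move=> e h i j; apply: eq_pder (h i j) => t tab; rewrite e. Qed.

Lemma pder_congr s a b (f g df dg : R -> R) : f =1 g -> df =1 dg ->
  pder s a b f df -> pder s a b g dg.
Proof. by move=> /funext -> /funext ->. Qed.

Lemma pderm_refl p q s a b c (X dX : R -> 'M[R]_(p, q)) :
  pderm s (c - b) (c - a) X dX ->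
  pderm [seq c - u | u <- s] a b (fun t => X (c - t)) (fun t => - dX (c - t)).
Proof. by move=> h i j; apply: pder_congr (pder_refl (h i j)) => t //; rewrite mxE. Qed.

Lemma pderm_shift p q s a b c (X dX : R -> 'M[R]_(p, q)) :
  pderm s (a + c) (b + c) X dX ->
  pderm [seq u - c | u <- s] a b (fun t => X (t + c)) (fun t => dX (t + c)).
Proof. by move=> h i j; exact: (pder_shift (h i j)). Qed.

Lemma pderm_tr p q s a b (X dX : R -> 'M[R]_(p, q)) : pderm s a b X dX ->
  pderm s a b (fun t => (X t)^T) (fun t => (dX t)^T).
Proof. by move=> h i j; apply: pder_congr (h j i) => t; rewrite mxE. Qed.

Lemma pdermD p q s1 s2 a b (X dX Y dY : R -> 'M[R]_(p, q)) :
  pderm s1 a b X dX -> pderm s2 a b Y dY ->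
  pderm (s1 ++ s2) a b (fun t => X t + Y t) (fun t => dX t + dY t).
Proof.
move=> h1 h2 i j; apply: pder_congr (pderD (h1 i j) (h2 i j)) => t;
  by rewrite mxE.
Qed.

Lemma pdermM p q r s1 s2 a b (X dX : R -> 'M[R]_(p, q)) (Y dY : R -> 'M[R]_(q, r)) :
  pderm s1 a b X dX -> pderm s2 a b Y dY ->
  pderm (s1 ++ s2) a b (fun t => X t *m Y t) (fun t => dX t *m Y t + X t *m dY t).
Proof.
move=> h1 h2 i j.
have := @pder_sum R _ (index_enum 'I_q) (s1 ++ s2) a b
  (fun k t => X t i k * Y t k j) (fun k t => dX t i k * Y t k j + X t i k * dY t k j)
  (fun k => pderM (h1 i k) (h2 k j)).
apply: pder_congr => t; first by rewrite mxE.
by rewrite !mxE -big_split.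
Qed.

Lemma pderm_cst p q s a b (M : 'M[R]_(p, q)) : pderm s a b (fun=> M) (fun=> 0).
Proof.
by move=> i j; apply: pder_congr (pder_cst s a b (M i j)) => t //; rewrite mxE.
Qed.

Lemma pder_dot n s a b (u : 'cV[R]_n) (x dx : R -> 'cV[R]_n) : pderm s a b x dx ->
  pder s a b (fun t => dot u (x t)) (fun t => dot u (dx t)).
Proof. by move=> h; apply: pder_sum => i; apply: pderZ. Qed.

Lemma pderm_norm n s a b C (x dx : R -> 'cV[R]_n) : a <= b -> pderm s a b x dx ->
  (forall t, a < t < b -> t \notin s -> enorm (dx t) <= C) -> 0 <= C ->
  enorm (x b - x a) <= C * (b - a).
Proof.
move=> ab h dxC C0; apply: enorm_dual => [|u]; first by rewrite mulr_ge0 ?subr_ge0.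
have -> : dot u (x b - x a) = dot u (x b) - dot u (x a) by rewrite dotDr dotNr.
apply: le_trans (ler_norm _) _.
have := @pder_norm R s a b (enorm u * C) _ _ ab (pder_dot u h).
rewrite (_ : enorm u * C * (b - a) = C * (b - a) * enorm u); last by ring.
apply => t tab ts.
by apply: le_trans (norm_dot _ _) _; rewrite ler_wpM2l ?enorm_ge0 ?dxC.
Qed.

Lemma pderm_FTC p q s a b (X dX : R -> 'M[R]_(p, q)) : a <= b -> mlbm dX ->
  pderm s a b X dX -> MInt (fun t => ico a b t *: dX t) = X b - X a.
Proof.
move=> ab bdX h; apply/matrixP => i j; rewrite !mxE.
have [C _ hC] := lbm_itv a b (bdX i j).
rewrite -(@pder_FTC R s a b C _ _ ab (lbm_meas (bdX i j)) (h i j)); last first.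
  by move=> t /andP[at_ tb]; apply: hC; rewrite !ltW.
by apply: eq_Int => t; rewrite mxE.
Qed.

Lemma within_dot n a b (x y : R -> 'cV[R]_n) :
  (forall i, {within `[a, b], continuous (fun t => x t i 0)}) ->
  (forall i, {within `[a, b], continuous (fun t => y t i 0)}) ->
  {within `[a, b], continuous (fun t => dot (x t) (y t))}.
Proof.
move=> cx cy; apply: continuous_bigsum => i t.
exact: (cvgM (cx i t) (cy i t)).
Qed.

Lemma within_enorm n a b (x : R -> 'cV[R]_n) :
  (forall i, {within `[a, b], continuous (fun t => x t i 0)}) ->
  {within `[a, b], continuous (fun t => enorm (x t))}.
Proof.
move=> cx.
rewrite (_ : (fun t => enorm (x t)) = (fun t => Num.sqrt (dot (x t) (x t)))); last first.
  by apply/funext => t; rewrite enormE.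
apply/subspace_continuousP => t tab.
have /subspace_continuousP/(_ t tab) h := within_dot cx cx.
exact: (cvg_comp _ _ h (@sqrt_continuous R _)).
Qed.

End VectorDerivative.

(** * Primitives, convolutions and a Volterra inequality *)

Section Primitive.
Variable R : realType.
Implicit Types (a b c t u e d C T : R) (s : seq R).

Lemma pder_eq_on s a b (f g df : R -> R) : (forall t, a <= t <= b -> f t = g t) ->
  pder s a b f df -> pder s a b g df.
Proof.
move=> fg [cf hf]; split.
  apply/within_itvP => t tab e e0.
  have [d d0 hd] := (within_itvP a b f).1 cf t tab e e0.
  by exists d => // u uab utd; rewrite -!fg//; exact: hd.
move=> t tab ts; have dft := hf t tab ts.
have nfg : \forall u \near t, f u = g u.
  exists (Num.min (t - a) (b - t)) => /=.
    by move: tab => /andP[? ?]; rewrite lt_min !subr_gt0; apply/andP.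
  move=> u /=; rewrite lt_min !ltr_norml => utab; apply: fg.
  by move: utab tab; lra.
exact: near_eq_is_derive nfg _.
Qed.

Lemma pderm_eq_on p q s a b (X Y dX : R -> 'M[R]_(p, q)) :
  (forall t, a <= t <= b -> X t = Y t) -> pderm s a b X dX -> pderm s a b Y dX.
Proof. by move=> XY hX i j; apply: pder_eq_on (hX i j) => t tab; rewrite XY. Qed.

Lemma pdermN p q s a b (X dX : R -> 'M[R]_(p, q)) :
  pderm s a b X dX -> pderm s a b (fun t => - X t) (fun t => - dX t).
Proof. by move=> hX i j; apply: pder_congr (pderN (hX i j)) => t; rewrite mxE. Qed.

Lemma pdermB p q s1 s2 a b (X dX Y dY : R -> 'M[R]_(p, q)) :
  pderm s1 a b X dX -> pderm s2 a b Y dY ->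
  pderm (s1 ++ s2) a b (fun t => X t - Y t) (fun t => dX t - dY t).
Proof. by move=> hX hY; apply: pdermD => //; exact: pdermN. Qed.

Lemma lbm_enorm n (x : R -> 'cV[R]_n) : mlbm x -> lbm (fun t => enorm (x t)).
Proof.
move=> bx; split.
  rewrite (_ : (fun t => enorm (x t)) = (Num.sqrt \o (fun t => dot (x t) (x t)))).
    apply: measurableT_comp; last exact: (lbm_meas (lbm_dot bx bx)).
    exact: continuous_measurable_fun (@sqrt_continuous R).
  by apply/funext => t; rewrite /= enormE.
move=> T; have [C C0 hC] := mlbm_enorm_bounded (- T) T bx; exists C => // t tT.
by rewrite ger0_norm ?enorm_ge0// hC// -ler_norml.
Qed.

Lemma Int_ico_le a t C (f : R -> R) : a <= t -> lbm f -> (forall u, a <= u <= t -> `|f u| <= C) ->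
  `|Int (fun u => ico a t u * f u)| <= C * (t - a).
Proof.
move=> at_ bf fC; rewrite -(Int_ico at_) -IntZ; last exact: L1_ico.
apply: norm_Int_le; [exact: L1_ico_lbm|by apply: L1Z; exact: L1_ico|].
move=> u; case: (icoP a t u) => [[[au ut] ->]|->]; last by rewrite mul0r mulr0 normr0.
by rewrite mul1r mulr1 fC// au ltW.
Qed.

Lemma Int_ico_within a b (f : R -> R) : lbm f ->
  {within `[a, b], continuous (fun t => Int (fun u => ico a t u * f u))}.
Proof.
move=> bf; have [C C0 hC] := lbm_itv a b bf.
have lip u v : a <= u -> u <= v -> v <= b ->
    `|Int (fun w => ico a v w * f w) - Int (fun w => ico a u w * f w)| <= C * (v - u).
  move=> au uv vb; rewrite (@Int_ico_split _ a u v)//; last by rewrite au.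
  rewrite addrAC subrr add0r; apply: Int_ico_le => // w /andP[uw wv].
  by apply: hC; rewrite (le_trans au uw) (le_trans wv vb).
apply/within_itvP => t /andP[at_ tb] e e0; exists (e / (C + 1)).
  by rewrite divr_gt0 // ltr_wpDl.
move=> u /andP[au ub] ut; apply: (@le_lt_trans _ _ (C * `|u - t|)).
  case: (leP t u) => tu.
    by rewrite [in leRHS]ger0_norm ?subr_ge0// lip.
  by rewrite distrC [in leRHS]distrC [in leRHS]ger0_norm ?subr_ge0 ?lip// ltW.
apply: (@le_lt_trans _ _ ((C + 1) * `|u - t|)).
  by rewrite ler_wpM2r// lerDl.
by rewrite mulrC -ltr_pdivlMr// ltr_wpDl.
Qed.

Lemma pder_int (s : seq R) a b (f : R -> R) : lbm f ->
  (forall t, a < t < b -> t \notin s -> {for t, continuous f}) ->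
  pder s a b (fun t => Int (fun u => ico a t u * f u)) f.
Proof.
move=> bf cf; split; first exact: Int_ico_within.
move=> t tab ts; have /andP[at_ tb] := tab.
have int_f : lebesgue_measure.-integrable `[a, b] (EFin \o f).
  have := @integrableS _ _ _ (@lebesgue_measure R) setT [set` `[a, b]] _
    measurableT (measurable_itv _) (@subsetT _ _) (L1_icc_lbm a b bf).
  apply: eq_integrable => // u; rewrite inE /= in_itv/= => uab.
  by rewrite /icc uab mul1r.
have [d1 d2] := continuous_FTC1_closed tb int_f at_ (cf t tab ts).
have E : (fun x : R => \int[lebesgue_measure]_(t0 in `[a, x]) f t0) =
   (fun t => Int (fun u => ico a t u * f u)).
  by apply/funext => u; rewrite Int_itv Int_icc_ico.
rewrite E in d1 d2; rewrite derive1E in d2.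
exact: DeriveDef.
Qed.

Lemma volterra C T (f : R -> R) : 0 <= C -> lbm f -> (forall t, 0 <= f t) ->
  (forall t, 0 < t < T -> {for t, continuous f}) ->
  (forall t, 0 <= t <= T -> f t <= C * Int (fun u => ico 0 t u * f u)) ->
  forall t, 0 <= t <= T -> f t = 0.
Proof.
move=> C0 bf f0 cf fC t /andP[t0 tT].
pose E u := Int (fun w => ico 0 u w * f w).
have dE : pder [::] 0 t E f.
  apply: pder_int => // u /andP[u0 ut] _; apply: cf.
  by rewrite u0 (lt_le_trans ut).
have dexp : pder [::] 0 t (fun u => expR (- C * u)) (fun u => - C * expR (- C * u)).
  have dl (u : R) : is_derive u 1 (fun x : R => - C * x) (- C).
    have [_ /(_ u)] := pderZ (- C) (pder_id [::] (u - 1) (u + 1)).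
    by rewrite mulr1; apply=> //; lra.
  have de (u : R) : is_derive u 1 (fun u => expR (- C * u)) (- C * expR (- C * u)).
    have := @is_derive1_comp _ expR (fun u => - C * u) u _ _ (is_derive_expR _) (dl u).
    by rewrite mulrC.
  split; last by move=> u _ _; exact: de.
  apply: continuous_subspaceT => u.
  by apply: differentiable_continuous; apply/derivable1_diffP; case: (de u).
have /= := pder_le t0 (pderM dexp dE).
have -> : E 0 = 0.
  rewrite /E (@eq_Int _ _ (fun=> 0)) ?Int0// => u; rewrite /ico.
  by case: (ltP u 0) => u0; rewrite ?andbF ?mul0r// leNgt u0 mul0r.
rewrite mulr0 => h; apply/eqP; rewrite eq_le f0 andbT.
apply: le_trans (fC t _) _; first by rewrite t0.
rewrite -/(E t) -(mulr0 C) ler_wpM2l// -(pmulr_rle0 _ (expR_gt0 (- C * t))).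
apply: h => u /andP[u0 ut] _.
rewrite (_ : _ + _ = expR (- C * u) * (f u - C * E u)); last by ring.
rewrite pmulr_rle0 ?expR_gt0// subr_le0; apply: fC.
by rewrite (ltW u0) (le_trans (ltW ut)).
Qed.

Lemma cvg_bigsum (T I : Type) (r : seq I) (F : I -> T -> R) (l : I -> R)
    (FF : set_system T) {HF : Filter FF} :
  (forall i, F i x @[x --> FF] --> l i) ->
  \sum_(i <- r) F i x @[x --> FF] --> \sum_(i <- r) l i.
Proof.
move=> cF; elim: r => [|i r IH].
  rewrite big_nil (_ : (fun x => _) = fun=> 0); first exact: cvg_cst.
  by apply/funext => x; rewrite big_nil.
rewrite big_cons (_ : (fun x => _) = fun x => F i x + \sum_(j <- r) F j x).
  by apply: cvgD.
by apply/funext => x; rewrite big_cons.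
Qed.

(** Dominated convergence: the integrand converges except where [t + u] meets the finite list
    [s]. *)
Lemma conv_continuous a b s (g f : R -> R) : lbm g -> lbm f ->
  (forall u, ~~ (a <= u <= b) -> g u = 0) ->
  (forall u, u \notin s -> {for u, continuous f}) ->
  continuous (fun t => Int (fun u => g u * f (t + u))).
Proof.
move=> bg bf g0 cf t; apply/(@cvg_nbhsP _ R^o) => w wt.
move/cvgrPdist_lt : (wt) => /(_ 1 ltr01)[N _ hN].
(* From index [N] on the sequence stays within distance 1 of [t], which gives one bound of [f] for
   all its members. *)
rewrite -(cvg_shiftn N).
have [Cg Cg0 hCg] := lbm_itv a b bg.
have [Cf Cf0 hCf] := lbm_itv (t - 1 + a) (t + 1 + b) bf.
have mff r : measurable_fun setT (fun u => g u * f (r + u)).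
  apply: measurable_funM; first exact: lbm_meas.
  apply: (@eq_measurable_fun _ _ _ _ _ (fun u => f (u + r))) => [u _|].
    by rewrite addrC.
  exact: lbm_meas (lbm_shift r bf).
have fw (u : R) : u \notin [seq u - t | u <- s] ->
    f (w (k + N)%N + u) @[k --> \oo] --> f (t + u).
  move=> us; have cu : {for t + u, continuous f}.
    apply: cf; apply: contra us => us; apply/mapP; exists (t + u) => //.
    by rewrite addrC addKr.
  have hu : w (k + N)%N + u @[k --> \oo] --> t + u.
    by apply: cvgD; [rewrite (cvg_shiftn N)|exact: cvg_cst].
  exact: (cvg_comp _ _ hu cu).
apply: (@DCT _ (fun k u => g u * f (w (k + N)%N + u)) (fun u => g u * f (t + u))
  (fun u => Cg * Cf * icc a b u)) => //.
- by apply: L1Z; exact: L1_icc.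
- have [Z [mZ Z0 sZ]] := negligible_seq [seq u - t | u <- s].
  exists Z; split=> // u nu; apply: sZ => /=; apply: contrapT => /negP us.
  by apply: nu => /=; apply: cvgM; [exact: cvg_cst|exact: fw].
- move=> k u; rewrite /icc normrM; case: (boolP (a <= u <= b)) => uab; last first.
    by rewrite g0// normr0 mul0r mulr0.
  rewrite mulr1 ler_pM ?hCg// hCf//.
  have := hN (k + N)%N (leq_addl _ _); rewrite /= ltr_norml.
  by move: uab; lra.
Qed.

Lemma continuous_max0 (f : R -> R) : (forall T, {within `[0, T], continuous f}) ->
  continuous (fun t => f (Num.max 0 t)).
Proof.
move=> cf t; apply/cvgrPdist_lt => e e0.
have t1 : 0 <= Num.max 0 t <= Num.max 0 t + 1.
  by rewrite le_max lexx lerDl ler01.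
have [d d0 hd] := (within_itvP _ _ _).1 (cf (Num.max 0 t + 1)) _ t1 e e0.
exists (Num.min d 1) => /=; first by rewrite lt_min d0 ltr01.
move=> u /=; rewrite lt_min => /andP[ud u1]; rewrite distrC; apply: hd.
  rewrite le_max lexx /=; move: u1; rewrite ltr_norml.
  by case: (leP 0 u); case: (leP 0 t); lra.
apply: le_lt_trans ud; rewrite distrC.
by case: (leP 0 u) => u0; case: (leP 0 t) => t0; rewrite ?subrr ?normr0//;
  rewrite ?subr0 ?sub0r ?normrN ler_norml; have := ler_norm (t - u);
  have := ler_norm (- (t - u)); rewrite normrN; move: u0 t0; lra.
Qed.

(** The jump at 0 is carried by the indicator of nonnegative times; the other factor, frozen at its
    value at 0 on negative times, is continuous. *)
Lemma causal_mlbm p q (X : R -> 'M[R]_(p, q)) :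
  (forall T i j, {within `[0, T], continuous (fun t => X t i j)}) ->
  (forall t, t < 0 -> X t = 0) -> mlbm X.
Proof.
move=> cX X0 i j.
have bX := lbmM (lbm_ge (0 : R)) (lbm_continuous (continuous_max0 (fun T => cX T i j))).
apply: eq_lbm bX => t; case: (leP 0 t) => t0; rewrite ?mul1r ?max_r//.
by rewrite mul0r X0// mxE.
Qed.

Lemma is_derive_entry p q (X : R -> 'M[R]_(p, q)) t (D : 'M[R]_(p, q)) i j :
  is_derive t 1 X D -> is_derive t 1 (fun u => X u i j) (D i j).
Proof.
move=> [dX <-]; apply: DeriveDef; first exact: ((derivable_mxP _ _ _).1 dX).
by rewrite derive_mx// mxE.
Qed.

Lemma is_derive_matrix p q (X : R -> 'M[R]_(p, q)) t (D : 'M[R]_(p, q)) :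
  (forall i j, is_derive t 1 (fun u => X u i j) (D i j)) -> is_derive t 1 X D.
Proof.
move=> hX; have dX : derivable X t 1 by apply/derivable_mxP => i j; case: (hX i j).
apply: DeriveDef => //; rewrite derive_mx//; apply/matrixP => i j; rewrite mxE.
by case: (hX i j).
Qed.

Lemma within_entry p q (S : set R) (X : R -> 'M[R]_(p, q)) i j :
  {within S, continuous X} -> {within S, continuous (fun t => X t i j)}.
Proof.
move=> /subspace_continuousP cX; apply/subspace_continuousP => t St.
exact: (cvg_entry (cX t St)).
Qed.

Lemma within_matrix p q (S : set R) (X : R -> 'M[R]_(p, q)) :
  (forall i j, {within S, continuous (fun t => X t i j)}) -> {within S, continuous X}.
Proof.
move=> cX; apply/subspace_continuousP => t St; apply: cvg_matrix => i j.
by have /subspace_continuousP/(_ t St) := cX i j.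
Qed.

Lemma pderm_FTC_icc p q s a b (X dX : R -> 'M[R]_(p, q)) : a <= b -> mlbm dX ->
  pderm s a b X dX -> MInt (fun t => icc a b t *: dX t) = X b - X a.
Proof.
move=> ab bdX hX; rewrite -(pderm_FTC ab bdX hX); apply/matrixP => i j; rewrite !mxE.
rewrite (@eq_Int _ _ (fun t => icc a b t * dX t i j)); last by move=> t; rewrite mxE.
by rewrite Int_icc_ico//; apply: eq_Int => t; rewrite mxE.
Qed.

Lemma mL1_icc p q a b (X : R -> 'M[R]_(p, q)) : mlbm X -> mL1 (fun t => icc a b t *: X t).
Proof.
move=> bX; apply: (@mlbm_mL1 _ _ _ a b); first exact: mlbmZ (lbm_icc a b) bX.
by move=> t tab; rewrite /icc (negbTE tab) scale0r.
Qed.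

Lemma mL1_ico p q a b (X : R -> 'M[R]_(p, q)) : mlbm X -> mL1 (fun t => ico a b t *: X t).
Proof.
move=> bX; apply: (@mlbm_mL1 _ _ _ a b); first exact: mlbmZ (lbm_ico a b) bX.
move=> t tab; rewrite /ico (_ : (a <= t < b) = false) ?scale0r//.
by apply: contraNF tab => /andP[-> /ltW].
Qed.

Lemma conv_by_parts p q r sX sy a b tau (X dX : R -> 'M[R]_(p, q)) (y dy : R -> 'M[R]_(q, r)) :
  a <= b -> mlbm X -> mlbm dX -> mlbm y -> mlbm dy ->
  pderm sX (tau - b) (tau - a) X dX -> pderm sy a b y dy ->
  MInt (fun u => icc a b u *: (X (tau - u) *m dy u)) =
  X (tau - b) *m y b - X (tau - a) *m y a + MInt (fun u => icc a b u *: (dX (tau - u) *m y u)).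
Proof.
move=> ab bX bdX by_ bdy hX hy.
have bX' := mlbm_refl tau bX; have bdX' := mlbm_refl tau bdX.
have bI : mlbm (fun u => - dX (tau - u) *m y u + X (tau - u) *m dy u).
  by apply: mlbmD; apply: mlbmM => //; exact: mlbmN.
have <- := pderm_FTC_icc ab bI (pdermM (pderm_refl hX) hy).
rewrite -MIntD; [|by apply: mL1_icc|by apply: mL1_icc; exact: mlbmM].
apply: eq_MInt => u; rewrite -scalerDr; congr (_ *: _).
by rewrite mulNmx addrAC addNr add0r.
Qed.

Lemma eq_MInt_off p q s (X Y : R -> 'M[R]_(p, q)) : mlbm X -> mlbm Y ->
  (forall t, t \notin s -> X t = Y t) -> MInt X = MInt Y.
Proof.
move=> bX bY XY; apply/matrixP => i j; rewrite !mxE.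
by apply: (@eq_Int_off _ s); [exact: lbm_meas|exact: lbm_meas|move=> t ts; rewrite XY].
Qed.

Lemma pder_derive a b (f df : R -> R) : (forall t, is_derive t 1 f (df t)) -> pder [::] a b f df.
Proof.
move=> hf; split=> [|t _ _]; last exact: hf.
apply: continuous_subspaceT => t; apply: differentiable_continuous.
by apply/derivable1_diffP; case: (hf t).
Qed.

Lemma Int_linear c : 0 <= c -> Int (fun t => ico 0 c t * (c - t)) = c ^+ 2 / 2.
Proof.
move=> c0; have hd (t : R) : is_derive t 1 (fun t : R => c * t - t ^+ 2 / 2) (c - t).
  by apply: is_derive_eq; rewrite /GRing.scale /=; field.
have hm : measurable_fun setT (fun t : R => c - t).
  by apply: lbm_meas; apply: lbmB; [exact: lbm_cst|apply: lbm_continuous => t; exact: cvg_id].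
rewrite (@pder_FTC _ [::] 0 c c _ _ c0 hm (pder_derive 0 c hd)); first by field.
by move=> t /andP[t0 tc]; rewrite ger0_norm; lra.
Qed.

(** The squared ramp has integral [q^2 l / 3]. When [l] is the value [q] divided by a Lipschitz
    constant of [x], the hypothesis holds for any [x] of norm at least [q] at time [t]: a large
    value costs energy in the past. *)
Lemma sq_ramp_lower n (x : R -> 'cV[R]_n) (q l t : R) :
  mlbm x -> 0 <= q -> 0 < l ->
  (forall s : R, t - l <= s <= t -> q * (1 - (t - s) / l) <= enorm (x s)) ->
  q ^+ 2 * l / 3 <= Int (fun s : R => ico (t - l) t s * dot (x s) (x s)).
Proof.
move=> bx q0 l0 hx; have l0' : l != 0 by rewrite gt_eqF.
have tl : t - l <= t by rewrite gerBl ltW.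
have hd (s : R) : is_derive s 1 (fun s : R => q ^+ 2 * l / 3 * (1 - (t - s) / l) ^+ 3)
    ((q * (1 - (t - s) / l)) ^+ 2).
  by apply: is_derive_eq; rewrite /GRing.scale /=; field.
have bid : lbm (fun s : R => s) by apply: lbm_continuous => u; exact: cvg_id.
have bm : lbm (fun s : R => q * (1 - (t - s) / l)).
  apply: lbmZ; apply: lbmB; first exact: lbm_cst.
  by apply: lbmM; [apply: lbmB => //; exact: lbm_cst|exact: lbm_cst].
have bm2 : lbm (fun s : R => (q * (1 - (t - s) / l)) ^+ 2) by exact: (lbmM bm bm).
have ramp (s : R) : t - l <= s <= t -> 0 <= 1 - (t - s) / l <= 1.
  move=> /andP[s1 s2]; rewrite subr_ge0 gerBl ler_pdivrMr// mul1r divr_ge0 ?subr_ge0 ?(ltW l0)// andbT.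
  by rewrite lerBlDr -lerBlDl.
have sq (s : R) : t - l <= s <= t -> (q * (1 - (t - s) / l)) ^+ 2 <= q ^+ 2.
  move=> /ramp /andP[r0 r1]; rewrite lerXn2r ?nnegrE ?mulr_ge0//.
  by rewrite -[leRHS]mulr1 ler_wpM2l.
have FTC := @pder_FTC _ [::] (t - l) t (q ^+ 2) _ _ tl (lbm_meas bm2) (pder_derive (t - l) t hd).
have -> : q ^+ 2 * l / 3 = q ^+ 2 * l / 3 * (1 - (t - t) / l) ^+ 3 -
    q ^+ 2 * l / 3 * (1 - (t - (t - l)) / l) ^+ 3 by field.
rewrite -FTC; last first.
  by move=> s /andP[s1 s2]; rewrite ger0_norm ?sqr_ge0// sq// !ltW.
apply: le_Int; [exact: L1_ico_lbm|by apply: L1_ico_lbm; exact: lbm_dot|].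
move=> s; case: (icoP (t - l) t s) => [[[s1 s2] ->]|->]; last by rewrite !mul0r.
rewrite !mul1r -sqr_enorm; have sI : t - l <= s <= t by rewrite s1 ltW.
by have /andP[r0 _] := ramp s sI; rewrite lerXn2r ?nnegrE ?mulr_ge0 ?enorm_ge0 ?hx.
Qed.

End Primitive.

(** * Delay operators and the fundamental matrix *)

Section DelayOperators.
Variables (R : realType) (n m : nat).
Variables (A : 'I_m.+1 -> 'M[R]_n) (h : 'I_m.+1 -> R) (H : R) (G : R -> 'M[R]_n).
Hypotheses (H_gt0 : 0 < H) (h_itv : forall j, 0 <= h j <= H).
Hypothesis G_pc : piecewise_continuous (- H) 0 G.
Implicit Types (a b c t e d C : R) (x y : R -> 'cV[R]_n) (X Y : R -> 'M[R]_n).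

(** [G] is constrained on [[- H, 0]] only; the cut-off is bounded and measurable on the line and
    absorbs the bounds of the integrals. *)
Let Gt th := icc (- H) 0 th *: G th.

Let bGt : mlbm Gt. Proof. exact: pc_mlbm. Qed.

Let Gt_out th : ~~ (- H <= th <= 0) -> Gt th = 0.
Proof. by rewrite /Gt /icc => /negbTE ->; rewrite scale0r. Qed.

Let Gt_in th : - H <= th <= 0 -> Gt th = G th.
Proof. by rewrite /Gt /icc => ->; rewrite scale1r. Qed.

Notation bg := (bG H G).
Notation M := (M1 A H G).
Notation lop := (sys_rhs A h H G).
Notation rop := (mx_rhs A h H G).

Lemma bG_ub th : - H <= th <= 0 -> opnorm (G th) <= bg.
Proof.
move=> thH; apply: ub_le_sup; last by exists th => //=; rewrite in_itv.
have [C _ hC] := mlbm_opnorm_bounded (- H) 0 bGt.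
exists C => _ [u /= + <-]; rewrite in_itv/= => uH; rewrite -Gt_in//.
exact: hC.
Qed.

Lemma bG_ge0 : 0 <= bg.
Proof.
apply: le_trans (@bG_ub 0 _); first exact: opnorm_ge0.
by rewrite lexx oppr_le0 ltW.
Qed.

Lemma M1_ge0 : 0 <= M.
Proof.
by rewrite /M1 addr_ge0 ?mulr_ge0 ?bG_ge0 ?(ltW H_gt0)// sumr_ge0// => j _; exact: opnorm_ge0.
Qed.

Lemma lopE x t : lop x t = \sum_j A j *m x (t - h j) + MInt (fun th => Gt th *m x (t + th)).
Proof.
rewrite /sys_rhs MInt_itv; congr (_ + _); apply: eq_MInt => th.
by rewrite scalemxAl.
Qed.

Lemma ropE X t : rop X t = \sum_j X (t - h j) *m A j + MInt (fun th => X (t + th) *m Gt th).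
Proof.
rewrite /mx_rhs MInt_itv; congr (_ + _); apply: eq_MInt => th.
by rewrite scalemxAr.
Qed.

Lemma mL1_lop x t : mlbm x -> mL1 (fun th => Gt th *m x (t + th)).
Proof.
move=> bx; apply: (@mlbm_mL1 _ _ _ (- H) 0).
  apply: mlbmM => //; apply: eq_mlbm (mlbm_shift t bx) => u.
  by rewrite addrC.
by move=> th thH; rewrite Gt_out// mul0mx.
Qed.

Lemma mL1_rop X t : mlbm X -> mL1 (fun th => X (t + th) *m Gt th).
Proof.
move=> bx; apply: (@mlbm_mL1 _ _ _ (- H) 0).
  apply: mlbmM => //; apply: eq_mlbm (mlbm_shift t bx) => u.
  by rewrite addrC.
by move=> th thH; rewrite Gt_out// mulmx0.
Qed.

Lemma Gt_norm_out th : ~~ (`|th| <= H) -> Gt th = 0.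
Proof.
move=> thH; apply: Gt_out; apply: contra thH => /andP[h1 h2].
by rewrite ler_norml h1 (le_trans h2)// ltW.
Qed.

Lemma mlbm_lop x : mlbm x -> mlbm (lop x).
Proof.
move=> bx; apply: (@eq_mlbm _ _ _ (fun t => \sum_j A j *m x (t - h j) +
   MInt (fun th => Gt th *m x (t + th)))) => [t|]; first by rewrite lopE.
apply: mlbmD.
  apply: mlbm_sum => j; apply: mlbmM; first exact: mlbm_cst.
  exact: mlbm_shift.
apply: (@mlbm_conv _ _ _ (fun z => Gt z.2 *m x (z.1 + z.2)) H).
  by apply: mlbm2M => i j; [apply: (lbm2_snd (bGt i j))|apply: (lbm2_add (bx i j))].
by move=> s t tH; rewrite /= Gt_norm_out// mul0mx.
Qed.

Lemma mlbm_rop X : mlbm X -> mlbm (rop X).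
Proof.
move=> bX; apply: (@eq_mlbm _ _ _ (fun t => \sum_j X (t - h j) *m A j +
   MInt (fun th => X (t + th) *m Gt th))) => [t|]; first by rewrite ropE.
apply: mlbmD.
  apply: mlbm_sum => j; apply: mlbmM; last exact: mlbm_cst.
  exact: mlbm_shift.
apply: (@mlbm_conv _ _ _ (fun z => X (z.1 + z.2) *m Gt z.2) H).
  by apply: mlbm2M => i j; [apply: (lbm2_add (bX i j))|apply: (lbm2_snd (bGt i j))].
by move=> s t tH; rewrite /= Gt_norm_out// mulmx0.
Qed.

Lemma eq_lop x y t : (forall u, t - H <= u <= t -> x u = y u) -> lop x t = lop y t.
Proof.
move=> xy; rewrite !lopE; congr (_ + _).
  apply: eq_bigr => j _; congr (_ *m _); apply: xy.
  by have := h_itv j; lra.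
apply: eq_MInt => th; case: (boolP (- H <= th <= 0)) => thH; last by rewrite Gt_out// !mul0mx.
by rewrite xy//; move: thH; lra.
Qed.

Lemma lop0 t : lop (fun=> 0) t = 0.
Proof.
rewrite lopE big1 ?add0r; last by move=> j _; rewrite mulmx0.
rewrite -[RHS](@MInt0 R n 1); apply: eq_MInt => th; by rewrite mulmx0.
Qed.

Lemma lopD x y t : mlbm x -> mlbm y -> lop (fun u => x u + y u) t = lop x t + lop y t.
Proof.
move=> bx by_; rewrite !lopE.
rewrite addrACA -MIntD; [|exact: mL1_lop|exact: mL1_lop].
rewrite -big_split; congr (_ + _); first by apply: eq_bigr => j _; rewrite mulmxDr.
by apply: eq_MInt => th; rewrite mulmxDr.
Qed.

Lemma lopZ c x t : mlbm x -> lop (fun u => c *: x u) t = c *: lop x t.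
Proof.
move=> bx; rewrite !lopE scalerDr scaler_sumr.
rewrite -MIntZ; last exact: mL1_lop.
congr (_ + _); first by apply: eq_bigr => j _; rewrite scalemxAr.
by apply: eq_MInt => th; rewrite scalemxAr.
Qed.

Lemma lop_shift x a t : lop (fun u => x (u + a)) t = lop x (t + a).
Proof.
rewrite !lopE; congr (_ + _); first by apply: eq_bigr => j _; rewrite addrAC.
by apply: eq_MInt => th; rewrite addrAC.
Qed.

Lemma lop_norm x t C : 0 <= C -> mlbm x ->
  (forall u, t - H <= u <= t -> enorm (x u) <= C) -> enorm (lop x t) <= M * C.
Proof.
move=> C0 bx xC; rewrite lopE; apply: le_trans (enormD _ _) _.
rewrite /M1 mulrDl lerD//.
  apply: le_trans (enorm_sum _ _) _; rewrite mulr_suml; apply: ler_sum => j _.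
  apply: le_trans (opnormP _ _) _; rewrite ler_wpM2l ?opnorm_ge0// xC//.
  by have := h_itv j; lra.
have -> : bg * H * C = Int (fun th => bg * C * icc (- H) 0 th).
  rewrite IntZ; last exact: L1_icc.
  have -> : Int (icc (- H) 0) = H.
    rewrite (@eq_Int _ _ (fun t => icc (- H) 0 t * 1)); last by move=> u; rewrite mulr1.
    rewrite Int_icc_ico; last exact: lbm_cst.
    rewrite (@eq_Int _ _ (ico (- H) 0)); last by move=> u; rewrite mulr1.
    by rewrite Int_ico ?sub0r ?opprK// oppr_le0 ltW.
  by rewrite mulrAC.
apply: enorm_MInt; [exact: mL1_lop|by apply: L1Z; exact: L1_icc|].
move=> th; rewrite /icc; case: (boolP (- H <= th <= 0)) => thH; last first.
  by rewrite Gt_out// mul0mx enorm0 mulr0.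
rewrite mulr1 Gt_in//; apply: le_trans (opnormP _ _) _.
by rewrite ler_pM ?opnorm_ge0 ?enorm_ge0 ?bG_ub// xC//; move: thH; lra.
Qed.

(* Associativity of convolution: X * (mu * y) = (X * mu) * y. *)
Lemma conv_assoc X y a b tau : mlbm X -> mlbm y -> (forall t, ~~ (a <= t <= b) -> y t = 0) ->
  MInt (fun s => X (tau - s) *m lop y s) = MInt (fun s => rop X (tau - s) *m y s).
Proof.
move=> bX by_ y0.
have yL1 j : mL1 (fun s => X (tau - s) *m (A j *m y (s - h j))).
  apply: (@mlbm_mL1 _ _ _ (a + h j) (b + h j)).
    apply: mlbmM; first exact: mlbm_refl.
    by apply: mlbmM; [exact: mlbm_cst|exact: mlbm_shift].
  by move=> t tab; rewrite y0 ?mulmx0//; apply: contra tab; lra.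
have yL1' j : mL1 (fun s => X (tau - s - h j) *m A j *m y s).
  apply: (@mlbm_mL1 _ _ _ a b).
    apply: mlbmM => //; apply: mlbmM; last exact: mlbm_cst.
    apply: eq_mlbm (mlbm_refl (tau - h j) bX) => t; by rewrite addrAC.
  by move=> t tab; rewrite y0 ?mulmx0.
pose F (z : R * R) := X (tau - z.1) *m (Gt z.2 *m y (z.1 + z.2)).
have bF : mlbm2 F.
  apply: mlbm2M; first by move=> i j; apply: (lbm2_fst (lbm_refl tau (bX i j))).
  by apply: mlbm2M => i j; [apply: (lbm2_snd (bGt i j))|apply: (lbm2_add (by_ i j))].
(* [Gt] confines the delay variable to [[- H, 0]], and [y] confines its own argument to [[a, b]], so
   both integrands vanish outside this box. *)
pose T := `|a| + `|b| + H.
have F0 s t : ~~ ((`|s| <= T) && (`|t| <= T)) -> F (s, t) = 0.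
  move=> hst; rewrite /F /=; case: (boolP (- H <= t <= 0)) => tH; last first.
    by rewrite Gt_out// mul0mx mulmx0.
  rewrite y0 ?mulmx0//; apply: contra hst => stab.
  have := ler_norm a; have := ler_norm (- a); have := ler_norm b; have := ler_norm (- b).
  by rewrite !normrN !ler_norml /T; move: tH stab; lra.
have lG := mL1_MInt bF F0.
pose F' (z : R * R) := X (tau - z.1 + z.2) *m Gt z.2 *m y z.1.
have bF' : mlbm2 F'.
  apply: mlbm2M; last by move=> i j; apply: (lbm2_fst (by_ i j)).
  apply: mlbm2M => i j; last by apply: (lbm2_snd (bGt i j)).
  apply: eq_lbm2 (lbm2_sub (lbm_refl tau (bX i j))) => z.
  by rewrite (_ : tau - (z.1 - z.2) = tau - z.1 + z.2)//; ring.
have F'0 s t : ~~ ((`|s| <= T) && (`|t| <= T)) -> F' (s, t) = 0.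
  move=> hst; rewrite /F' /=; case: (boolP (- H <= t <= 0)) => tH; last first.
    by rewrite Gt_out// mulmx0 mul0mx.
  rewrite y0 ?mulmx0//; apply: contra hst => stab.
  have := ler_norm a; have := ler_norm (- a); have := ler_norm b; have := ler_norm (- b).
  by rewrite !normrN !ler_norml /T; move: tH stab; lra.
have lG' := mL1_MInt bF' F'0.
transitivity (MInt (fun s => \sum_j X (tau - s) *m (A j *m y (s - h j)) +
    MInt (fun t => F (s, t)))).
  apply: eq_MInt => s; rewrite lopE mulmxDr mulmx_sumr; congr (_ + _).
  by rewrite -MInt_ml//; exact: mL1_lop.
transitivity (MInt (fun s => \sum_j X (tau - s - h j) *m A j *m y s +
    MInt (fun t => F' (s, t)))); last first.
  apply: eq_MInt => s; rewrite ropE mulmxDl mulmx_suml; congr (_ + _).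
  by rewrite -MInt_mr//; exact: mL1_rop.
etransitivity; first exact: (MIntD (mL1_sum _ yL1) lG).
symmetry; etransitivity; first exact: (MIntD (mL1_sum _ yL1') lG').
refine (esym (f_equal2 +%R _ _)).
  rewrite !MInt_sum//; apply: eq_bigr => j _.
  rewrite -(MInt_shift (h j) (yL1 j)); apply: eq_MInt => s.
  by rewrite addrK mulmxA opprD addrA.
(* Once the delay [t] is the outer variable, the substitution of [s - t] for [s] carries [F] into
   [F']. *)
rewrite (MInt_Fubini bF F0) (MInt_Fubini bF' F'0); apply: eq_MInt => t.
have lF : mL1 (fun s => F (s, t)).
  apply: (@mlbm_mL1 _ _ _ (- T) T).
    rewrite /F /=; apply: mlbmM; first exact: mlbm_refl.
    by apply: mlbmM; [exact: mlbm_cst|exact: mlbm_shift].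
  by move=> s; rewrite -ler_norml => sT; apply: F0; rewrite (negbTE sT).
rewrite -(MInt_shift (- t) lF); apply: eq_MInt => s.
by rewrite /F /F' /= opprB subrK mulmxA addrA (addrAC tau t).
Qed.

(** Unlike in [is_solution], the past is part of the function, which is controlled on the whole
    line, so that shifts and convolutions apply. One list of exceptional times serves all [T]. *)
Definition traj t0 x := mlbm x /\ exists s, forall T, pderm s t0 T x (lop x).

Lemma traj_sub t0 t1 x : t0 <= t1 -> traj t0 x -> traj t1 x.
Proof.
move=> t01 [bx [s hs]]; split=> //; exists s => T.
exact: (pderm_sub t01 (lexx T) (hs T)).
Qed.

Lemma traj_within t0 x T : traj t0 x ->
  forall i, {within `[t0, T], continuous (fun t => x t i 0)}.
Proof. by move=> [_ [s hs]] i; case: (hs T i 0). Qed.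

Lemma traj_lip t0 x N a b : traj t0 x -> t0 <= a -> a <= b -> 0 <= N ->
  (forall u, a - H <= u <= b -> enorm (x u) <= N) ->
  enorm (x b - x a) <= M * N * (b - a).
Proof.
move=> [bx [s hs]] ta ab N0 xN.
apply: (pderm_norm ab (pderm_sub ta (lexx b) (hs b))); last by rewrite mulr_ge0 ?M1_ge0.
move=> t /andP[at_ tb] _; apply: lop_norm => // u /andP[tu ut]; apply: xN.
by move: tu ut at_ tb; lra.
Qed.

Lemma traj_shift t0 c x : traj (t0 + c) x -> traj t0 (fun t => x (t + c)).
Proof.
move=> [bx [s hs]]; split; first exact: mlbm_shift.
exists [seq u - c | u <- s] => T.
apply: eq_pderm (pderm_shift (hs (T + c))) => t _.
by rewrite lop_shift.
Qed.

(* At a maximum [c] of [|x t| exp (- M1 (t - t0))] whose value [w] exceeded [C],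
   the derivative bound [|x'| <= M1 w exp (M1 (t - t0))] would force
   [|x c| < w exp (M1 (c - t0))]. *)
Lemma gronwall t0 x C : traj t0 x -> 0 <= C ->
  (forall u, t0 - H <= u <= t0 -> enorm (x u) <= C) ->
  forall t, t0 <= t -> enorm (x t) <= C * expR (M * (t - t0)).
Proof.
move=> tx C0 xC t t0t; have [bx [s hs]] := tx.
pose g u := enorm (x u) * expR (- (M * (u - t0))).
have cexp : continuous (fun u => expR (- (M * (u - t0)))).
  move=> u; apply: continuous_comp; last exact: continuous_expR.
  apply: continuousN; apply: cvgM; first exact: cvg_cst.
  by apply: cvgB; [exact: cvg_id|exact: cvg_cst].
have cg : {within `[t0, t], continuous g}.
  have h1 := within_enorm (traj_within (T := t) tx).
  have h2 : {within `[t0, t], continuous (fun u => expR (- (M * (u - t0))))}.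
    exact: continuous_subspaceT.
  by move=> u; exact: (cvgM (h1 u) (h2 u)).
have [c c_itv gc] := EVT_max t0t cg.
have gE u : enorm (x u) = g u * expR (M * (u - t0)).
  by rewrite /g -mulrA -expRD addNr expR0 mulr1.
have M0 := M1_ge0.
suff gcC : g c <= C.
  rewrite gE ler_wpM2r ?expR_ge0//; apply: le_trans gcC; apply: gc.
  by rewrite in_itv/= t0t lexx.
rewrite leNgt; apply/negP => Cw; set w := g c in gc Cw.
move: c_itv; rewrite in_itv/= => /andP[t0c ct].
have w0 : 0 < w by exact: le_lt_trans Cw.
have e1 u : t0 <= u -> 1 <= expR (M * (u - t0)).
  by move=> t0u; rewrite -[1]expR0 ler_expR mulr_ge0// subr_ge0.
have bnd u : t0 < u < c -> enorm (lop x u) <= M * (w * expR (M * (u - t0))).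
  move=> /andP[t0u uc]; apply: lop_norm => //; first by rewrite mulr_ge0 ?expR_ge0// ltW.
  move=> r /andP[ur ru]; case: (leP r t0) => rt0.
    apply: (@le_trans _ _ C); first by apply: xC; rewrite rt0 andbT; move: ur t0u; lra.
    apply: le_trans (ltW Cw) _; rewrite ler_peMr ?(ltW w0)//; apply: e1; exact: ltW.
  rewrite gE; apply: ler_pM; [by rewrite mulr_ge0 ?enorm_ge0 ?expR_ge0|exact: expR_ge0| |].
    by apply: gc; rewrite in_itv/= (ltW rt0) (le_trans ru)// (le_trans (ltW uc)).
  by rewrite ler_expR ler_wpM2l// lerB.
have dexp : pder [::] t0 c (fun u => expR (M * (u - t0))) (fun u => M * expR (M * (u - t0))).
  have de (u : R) : is_derive u 1 (fun u => expR (M * (u - t0))) (M * expR (M * (u - t0))).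
    have dl : is_derive u 1 (fun v : R => M * (v - t0)) M.
      have d0 : pder [::] (u - 1) (u + 1) (fun v => M * (v - t0)) (fun=> M * (1 + 0)).
        exact: pderZ (pderD (pder_id [::] _ _) (pder_cst [::] _ _ (- t0))).
      have [_ /(_ u)] := d0; rewrite addr0 mulr1; apply=> //; lra.
    have := @is_derive1_comp _ expR (fun v => M * (v - t0)) u _ _ (is_derive_expR _) dl.
    by rewrite mulrC.
  split; last by move=> u _ _; exact: de.
  apply: continuous_subspaceT => u.
  by apply: differentiable_continuous; apply/derivable1_diffP; case: (de u).
(* Pairing with the fixed vector [x c] avoids differentiating the norm:
   [dot v (x u) - w |v| exp (M (u - t0))] would be nonincreasing in [u], yet it is negative at [t0]
   and zero at [c]. *)
set v := x c.
have xc0 : 0 < enorm v by rewrite /v gE mulr_gt0 ?expR_gt0.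
have dF := pderD (pder_dot v (pderm_sub (lexx t0) (lexx c) (hs c)))
  (pderZ (- (w * enorm v)) dexp).
have /= := pder_le t0c dF.
rewrite subrr mulr0 expR0 mulr1.
have -> : dot v (x c) = enorm v * (w * expR (M * (c - t0))).
  by rewrite -[x c]/v -sqr_enorm expr2 {2}/v gE.
have -> : enorm v * (w * expR (M * (c - t0))) + - (w * enorm v) * expR (M * (c - t0)) = 0.
  by ring.
suff nle : ~ (0 <= dot v (x t0) + - (w * enorm v)).
  move=> nle'; apply: nle; apply: nle' => u uc; rewrite mem_cat orbF => us.
  have := bnd u uc => hb.
  rewrite mulNr subr_le0; apply: le_trans (cauchy_schwarz _ _) _.
  rewrite (_ : w * _ * _ = enorm v * (M * (w * expR (M * (u - t0))))); last by ring.
  by rewrite ler_wpM2l ?enorm_ge0.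
apply/negP; rewrite -ltNge subr_lt0; apply: le_lt_trans (cauchy_schwarz _ _) _.
rewrite mulrC ltr_pM2r//; apply: le_lt_trans Cw; apply: xC.
by rewrite lexx andbT gerBl ltW.
Qed.

(** A jump of [x] at [u] makes the right-hand side of the system jump at every [u + h j]. *)
Definition sing (s : seq R) := [seq p.1 + h p.2 | p <- [seq (u, j) | u <- s, j <- enum 'I_m.+1]].

Lemma singP s u j : u \in s -> u + h j \in sing s.
Proof.
move=> us; apply/mapP; exists (u, j) => //.
by apply/allpairsP; exists (u, j); rewrite mem_enum.
Qed.

(** The distributed delay smooths jumps by [conv_continuous]; only the discrete delays propagate
    them. *)
Lemma lop_continuous x s : mlbm x ->
  (forall t, t \notin s -> forall i, {for t, continuous (fun u => x u i 0)}) ->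
  forall t, t \notin sing s -> forall i, {for t, continuous (fun u => lop x u i 0)}.
Proof.
move=> bx cx t ts i.
have E u : lop x u i 0 = \sum_j \sum_k A j i k * x (u - h j) k 0 +
    \sum_k Int (fun th => Gt th i k * x (u + th) k 0).
  rewrite lopE mxE summxE; congr (_ + _).
    by apply: eq_bigr => j _; rewrite mxE.
  rewrite mxE -Int_sum; last first.
    move=> k; apply: (@lbm_L1 _ (- H) 0).
      apply: lbmM => //; apply: eq_lbm (lbm_shift u (bx k 0)) => th.
      by rewrite addrC.
    by move=> th thH; rewrite Gt_out// mxE mul0r.
  by apply: eq_Int => th; rewrite mxE.
rewrite /prop_for /continuous_at E (funext E).
apply: cvgD; last first.
  apply: cvg_bigsum => k.
  have g0 th : ~~ (- H <= th <= 0) -> Gt th i k = 0 by move=> thH; rewrite Gt_out// mxE.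
  exact: (@conv_continuous _ (- H) 0 s (fun th => Gt th i k) (fun u => x u k 0)
    (bGt i k) (bx k 0) g0 (fun u us => cx u us k) t).
apply: cvg_bigsum => j; apply: cvg_bigsum => k; apply: cvgM; first exact: cvg_cst.
have tj : t - h j \notin s by apply: contra ts => /(singP j); rewrite subrK.
have hu : u - h j @[u --> t] --> t - h j by apply: cvgB; [exact: cvg_id|exact: cvg_cst].
exact: (cvg_comp _ _ hu (cx _ tj k)).
Qed.

Lemma rop_continuous X : mlbm X -> (forall i j, continuous (fun u => X u i j)) ->
  forall i j, continuous (fun u => rop X u i j).
Proof.
move=> bX cX i j t.
have E u : rop X u i j = \sum_l \sum_k X (u - h l) i k * A l k j +
    \sum_k Int (fun th => Gt th k j * X (u + th) i k).
  rewrite ropE mxE summxE; congr (_ + _).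
    by apply: eq_bigr => l _; rewrite mxE.
  rewrite mxE -Int_sum; last first.
    move=> k; apply: (@lbm_L1 _ (- H) 0).
      apply: lbmM => //; apply: eq_lbm (lbm_shift u (bX i k)) => th.
      by rewrite addrC.
    by move=> th thH; rewrite Gt_out// mxE mul0r.
  by apply: eq_Int => th; rewrite mxE; apply: eq_bigr => k _; rewrite mulrC.
rewrite /continuous_at E (funext E).
apply: cvgD; last first.
  apply: cvg_bigsum => k.
  have g0 th : ~~ (- H <= th <= 0) -> Gt th k j = 0 by move=> thH; rewrite Gt_out// mxE.
  exact: (@conv_continuous _ (- H) 0 [::] (fun th => Gt th k j) (fun u => X u i k)
    (bGt k j) (bX i k) g0 (fun u _ => cX i k u) t).
apply: cvg_bigsum => l; apply: cvg_bigsum => k; apply: cvgM; last exact: cvg_cst.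
have hu : u - h l @[u --> t] --> t - h l by apply: cvgB; [exact: cvg_id|exact: cvg_cst].
exact: (cvg_comp _ _ hu (cX i k _)).
Qed.

Lemma mlbm_primitive x : mlbm x -> mlbm (fun t => MInt (fun u => ico 0 t u *: x u)).
Proof.
move=> bx; apply: causal_mlbm => [T i j|t t0].
  rewrite (_ : (fun t => _) = (fun t => Int (fun u => ico 0 t u * x u i j))).
    exact: Int_ico_within.
  by apply/funext => t; rewrite mxE; apply: eq_Int => u; rewrite mxE.
apply/matrixP => i j; rewrite mxE [RHS]mxE -[RHS](@Int0 R); apply: eq_Int => u.
rewrite mxE /ico; case: (leP 0 u) => u0; rewrite ?mul0r//.
by rewrite ltNge (le_trans (ltW t0) u0) mul0r.
Qed.

(** * The fundamental matrix and the variation of constants *)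

Variable K : R -> 'M[R]_n.
Hypothesis K_fund : is_fundamental_matrix A h H G K.

Lemma K_neg t : t < 0 -> K t = 0.
Proof. by case: K_fund => + _ _ _; apply. Qed.

Lemma K_0 : K 0 = 1%:M.
Proof. by case: K_fund. Qed.

Lemma K_within T i j : {within `[0, T], continuous (fun t => K t i j)}.
Proof.
case: K_fund => _ _ /within_entry cK _; apply: continuous_subspaceW (cK i j).
by move=> t /=; rewrite !in_itv/= andbT => /andP[].
Qed.

Lemma mlbm_K : mlbm K.
Proof. by apply: causal_mlbm => [T i j|t]; [exact: K_within|exact: K_neg]. Qed.

Lemma K_pderm : exists s, forall T, pderm s 0 T K (rop K).
Proof.
case: K_fund => _ _ _ [s hs]; exists s => T i j; split; first exact: K_within.
by move=> t /andP[t0 _] ts; apply: is_derive_entry; exact: hs.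
Qed.

(* The kernel [K] vanishes on negative times, so only [0, t] contributes. *)
Lemma K_conv x t : mlbm x -> (forall u, u < 0 -> x u = 0) -> 0 <= t ->
  MInt (fun s => icc 0 t s *: (K (t - s) *m lop x s)) =
  MInt (fun s => icc 0 t s *: (rop K (t - s) *m x s)).
Proof.
move=> bx x0 t0; pose y s := icc 0 t s *: x s.
have by_ : mlbm y by exact: mlbmZ (lbm_icc 0 t) bx.
have yout u : ~~ (0 <= u <= t) -> y u = 0.
  by rewrite /y /icc => /negbTE ->; rewrite scale0r.
have := conv_assoc t mlbm_K by_ yout.
rewrite (_ : MInt (fun s => rop K (t - s) *m y s) =
  MInt (fun s => icc 0 t s *: (rop K (t - s) *m x s))) => [<-|]; last first.
  by apply: eq_MInt => s; rewrite -scalemxAr.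
apply: eq_MInt => s; rewrite /icc; case: (leP 0 s) => s0; last first.
  rewrite scale0r (@eq_lop y (fun=> 0)) ?lop0 ?mulmx0// => u /andP[_ us].
  by apply: yout; rewrite leNgt (le_lt_trans us s0).
case: (leP s t) => st; last by rewrite scale0r K_neg ?mul0mx// subr_lt0.
rewrite scale1r (@eq_lop y x)// => u /andP[_ us].
rewrite /y /icc (le_trans us st) andbT; case: (leP 0 u) => u0; first by rewrite scale1r.
by rewrite scale0r x0.
Qed.

(* [K] solves the equation with the [A j] on the right. Its defect [D] in the equation
   with the [A j] on the left satisfies a homogeneous Volterra equation. *)
Lemma K_left v : traj 0 (fun t => K t *m v).
Proof.
have [s hs] := K_pderm.
pose x t := K t *m v; have bx : mlbm x by apply: mlbmM mlbm_K _; exact: mlbm_cst.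
have x0 u : u < 0 -> x u = 0 by move=> u0; rewrite /x K_neg// mul0mx.
have bL := mlbm_lop bx; have bR := mlbm_rop mlbm_K.
pose J t := MInt (fun u => ico 0 t u *: lop x u).
have bJ : mlbm J by exact: mlbm_primitive.
(* The defect in integrated form. It is continuous on nonnegative times and starts at 0, as the
   Volterra argument requires. *)
pose D t := (0 <= t)%R%:R *: (x t - v - J t).
have bD : mlbm D.
  apply: mlbmZ; first exact: lbm_ge.
  by do 2 apply: mlbmB => //; exact: mlbm_cst.
have dx T : pderm s 0 T x (fun t => rop K t *m v).
  have := pdermM (hs T) (@pderm_cst R n 1 [::] 0 T v); rewrite cats0.
  by apply: eq_pderm => t _; rewrite mulmx0 addr0.
have cx t : t \notin [:: 0] -> forall i, {for t, continuous (fun u => x u i 0)}.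
  rewrite inE => t0 i; case: (ltgtP t 0) t0 => // t0 _.
    have nx : \forall u \near t, (0 : 'cV[R]_n) i 0 = x u i 0.
      exists (- t) => /=; first by rewrite oppr_gt0.
      move=> u /= ut; rewrite x0//; move: ut; rewrite ltr_norml; lra.
    rewrite /prop_for /continuous_at [in X in _ --> X]x0//.
    by apply: cvg_trans (near_eq_cvg nx) _; exact: cvg_cst.
  by apply: (@within_open _ 0 (t + 1)); [case: (dx (t + 1) i 0)|rewrite t0 ltrDl ltr01].
have cL := lop_continuous bx cx.
have dJ T : pderm (sing [:: 0]) 0 T J (lop x).
  move=> i j; rewrite ord1.
  apply: pder_congr (@pder_int _ (sing [:: 0]) 0 T _ (bL i 0) _) => t //.
    by rewrite [RHS]mxE; apply: eq_Int => u; rewrite [RHS]mxE.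
  by move=> _ ts; exact: cL.
have J0 : J 0 = 0.
  rewrite -[RHS](@MInt0 R n 1); apply: eq_MInt => u; rewrite /ico.
  by case: (ltP u 0) => u0; rewrite ?andbF ?scale0r// leNgt u0 scale0r.
have DE t : 0 <= t -> D t = x t - v - J t by rewrite /D => ->; rewrite scale1r.
have D0 : D 0 = 0 by rewrite DE// J0 subr0 /x K_0 mul1mx subrr.
pose s' := s ++ sing [:: 0].
have dD T : pderm s' 0 T D (fun t => rop K t *m v - lop x t).
  apply: (@pderm_eq_on _ _ _ _ _ _ (fun t => x t - v - J t)).
    by move=> t /andP[t0 _]; rewrite DE.
  have := pdermB (pdermB (dx T) (@pderm_cst R n 1 [::] 0 T v)) (dJ T).
  by rewrite cats0; apply: eq_pderm => t _; rewrite subr0.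
have bDd : mlbm (fun t => rop K t *m v - lop x t).
  by apply: mlbmB => //; apply: mlbmM => //; exact: mlbm_cst.
(* The convolution of [K] with the derivative of [D] vanishes: by [E1] and [K_conv] both parts of
   that derivative have the same convolution with [K]. Integration by parts in [E3] turns this into
   an equation for [D] itself. *)
have Deq t : 0 <= t -> D t = - MInt (fun u => icc 0 t u *: (rop K (t - u) *m D u)).
  move=> t0; have bKt := mlbm_refl t mlbm_K; have bRt := mlbm_refl t bR.
  have bRv : mlbm (fun u => rop K u *m v) by apply: mlbmM => //; exact: mlbm_cst.
  have dK' : pderm s (t - t) (t - 0) K (rop K) by rewrite subrr subr0.
  have E1 := conv_by_parts t0 mlbm_K bR bx bRv dK' (dx t).
  rewrite subrr subr0 K_0 mul1mx {2}/x K_0 mul1mx subrr add0r in E1.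
  have E3 := conv_by_parts t0 mlbm_K bR bD bDd dK' (dD t).
  rewrite (subrr t) (subr0 t) K_0 mul1mx D0 mulmx0 (subr0 (D t)) in E3.
  apply/eqP; rewrite -addr_eq0 -E3.
  have -> : (fun u => icc 0 t u *: (K (t - u) *m (rop K u *m v - lop x u))) =
    (fun u => icc 0 t u *: (K (t - u) *m (rop K u *m v)) + - (icc 0 t u *: (K (t - u) *m lop x u))).
    by apply/funext => u; rewrite mulmxBr scalerBr.
  rewrite MIntD ?MIntN; [|by apply: mL1_icc; exact: mlbmM|by apply: mL1_icc; exact: mlbmM|].
    by rewrite (K_conv bx x0 t0) E1 subrr.
  by move=> i j; apply: eq_L1 (L1N (mL1_icc 0 t (mlbmM bKt bL) i j)) => u; rewrite [RHS]mxE.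
have Dz t : 0 <= t -> enorm (D t) = 0.
  move=> t0; have [C C0 hC] := mlbm_opnorm_bounded 0 t bR.
  apply: (@volterra _ C t (fun t => enorm (D t))) => //; last by rewrite t0 lexx.
  - exact: lbm_enorm.
  - by move=> u; exact: enorm_ge0.
  - move=> u ut; apply: within_open ut; apply: within_enorm => i.
    by case: (dD t i 0).
  move=> u /andP[u0 ut]; rewrite Deq// enormN -IntZ; last first.
    by apply: L1_ico_lbm; exact: lbm_enorm.
  rewrite (@eq_Int _ _ (fun w => ico 0 u w * (C * enorm (D w)))); last by move=> w; ring.
  have bCD : lbm (fun w => C * enorm (D w)) by apply: lbmZ; exact: lbm_enorm.
  rewrite -Int_icc_ico//; apply: enorm_MInt.
  - exact: mL1_icc (mlbmM (mlbm_refl u bR) bD).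
  - exact: L1_icc_lbm.
  move=> w; rewrite /icc; case: (boolP (0 <= w <= u)) => wu; last first.
    by rewrite scale0r enorm0 mul0r.
  rewrite scale1r mul1r; apply: le_trans (opnormP _ _) _.
  by rewrite ler_wpM2r ?enorm_ge0// hC//; move: wu ut; lra.
split=> //; exists (sing [:: 0]) => T.
apply: (@pderm_eq_on _ _ _ _ _ _ (fun t => v + J t)).
  move=> t /andP[t0 _]; have /eqP := Dz t t0; rewrite enorm_eq0 DE// subr_eq0.
  by move=> /eqP <-; rewrite addrC subrK.
have := pdermD (@pderm_cst R n 1 [::] 0 T v) (dJ T).
by apply: eq_pderm => t _; rewrite add0r.
Qed.

(* The part of the right-hand side at time [u] that stems from [x] before time 0. *)
Definition rho x u := lop (fun s => (s < 0)%R%:R *: x s) u.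

Lemma mlbm_past x : mlbm x -> mlbm (fun s => (s < 0)%R%:R *: x s).
Proof. by move=> bx; apply: mlbmZ => //; exact: lbm_lt. Qed.

Lemma mlbm_rho x : mlbm x -> mlbm (rho x).
Proof. by move=> bx; apply: mlbm_lop; exact: mlbm_past. Qed.

Lemma rho_out x u : H <= u -> rho x u = 0.
Proof.
move=> Hu; rewrite /rho -[RHS](lop0 u); apply: eq_lop => s /andP[us _].
by rewrite ltNge (_ : 0 <= s) ?scale0r//; apply: le_trans us; rewrite subr_ge0.
Qed.

Lemma rho_neg x u : u < 0 -> rho x u = lop x u.
Proof.
move=> u0; apply: eq_lop => s /andP[_ su].
by rewrite (le_lt_trans su u0) scale1r.
Qed.

Lemma rhoD x y u : mlbm x -> mlbm y -> rho (fun s => x s + y s) u = rho x u + rho y u.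
Proof.
move=> bx by_; rewrite /rho -lopD; [|exact: mlbm_past|exact: mlbm_past].
by congr (lop _ u); apply/funext => s; rewrite scalerDr.
Qed.

(** Variation of constants. The right-hand side splits into [rho x], a forcing term that acts on
    [[0, H]], and the contribution of nonnegative times, which [K_conv] cancels against the
    derivative of [K]. *)
Lemma cauchy x t : traj 0 x -> 0 <= t ->
  x t = K t *m x 0 + MInt (fun u => icc 0 H u *: (K (t - u) *m rho x u)).
Proof.
move=> [bx [s hs]] t0; have [sK hK] := K_pderm.
have bR := mlbm_rop mlbm_K.
have bKt := mlbm_refl t mlbm_K.
have hK' : pderm sK (t - t) (t - 0) K (rop K) by rewrite subrr subr0.
have := conv_by_parts t0 mlbm_K bR bx (mlbm_lop bx) hK' (hs t).
rewrite subrr subr0 K_0 mul1mx => E.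
pose y u := (0 <= u)%R%:R *: x u.
have by_ : mlbm y by apply: mlbmZ => //; exact: lbm_ge.
have y0 u : u < 0 -> y u = 0 by rewrite /y ltNge => /negbTE ->; rewrite scale0r.
have Ey := K_conv by_ y0 t0.
have E1 : MInt (fun u => icc 0 t u *: (rop K (t - u) *m y u)) =
    MInt (fun u => icc 0 t u *: (rop K (t - u) *m x u)).
  apply: eq_MInt => u; rewrite /icc /y; case: (leP 0 u) => u0; last by rewrite !scale0r.
  by rewrite scale1r.
have Ex u : lop x u = rho x u + lop y u.
  rewrite /rho -(lopD u (mlbm_past bx) by_).
  congr (lop _ u); apply/funext => r; rewrite /y -scalerDl.
  by case: (ltP r 0) => r0; rewrite ?addr0 ?add0r scale1r.
have E2 : MInt (fun u => icc 0 t u *: (K (t - u) *m rho x u)) = x t - K t *m x 0.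
  have -> : x t - K t *m x 0 = MInt (fun u => icc 0 t u *: (K (t - u) *m lop x u)) -
      MInt (fun u => icc 0 t u *: (K (t - u) *m lop y u)).
    by rewrite E Ey E1 addrK.
  have -> : (fun u => icc 0 t u *: (K (t - u) *m lop x u)) =
     (fun u => icc 0 t u *: (K (t - u) *m rho x u) + icc 0 t u *: (K (t - u) *m lop y u)).
    by apply/funext => u; rewrite Ex mulmxDr scalerDr.
  rewrite MIntD; [|exact: mL1_icc (mlbmM bKt (mlbm_rho bx))|exact: mL1_icc (mlbmM bKt (mlbm_lop by_))].
  by rewrite (addrK (MInt (fun u => icc 0 t u *: (K (t - u) *m lop y u)))).
rewrite addrC -[LHS](subrK (K t *m x 0)) -E2; congr (_ + _).
apply: eq_MInt => u; rewrite /icc; case: (leP 0 u) => u0; last by rewrite !scale0r.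
case: (leP u t) => ut; case: (leP u H) => uH //.
  by rewrite rho_out ?(ltW uH)// mulmx0 !scaler0.
by rewrite K_neg ?subr_lt0// mul0mx !scaler0.
Qed.

(* Integrate the derivative of [X (tau - u) *m x u] over [- b, 0], and move the delays
   from [x] to [X] with [conv_assoc]. *)
Lemma dual_formula X dX x sX s b tau : 0 <= b -> mlbm X -> mlbm dX -> mlbm x ->
  pderm sX tau (tau + b) X dX -> pderm s (- b) 0 x (lop x) ->
  (forall u, u < - b -> x u = 0) ->
  X (tau + b) *m x (- b) = X tau *m x 0
    + MInt (fun u => icc 0 H u *: (X (tau - u) *m rho x u))
    + MInt (fun u => icc (- b) 0 u *: ((dX (tau - u) - rop X (tau - u)) *m x u)).
Proof.
move=> b0 bX bdX bx hX hx x0.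
have bXt := mlbm_refl tau bX; have bdXt := mlbm_refl tau bdX.
have bRt := mlbm_refl tau (mlbm_rop bX).
have nb0 : - b <= 0 by rewrite oppr_le0.
have hX' : pderm sX (tau - 0) (tau - - b) X dX by rewrite subr0 opprK.
have E := conv_by_parts nb0 bX bdX bx (mlbm_lop bx) hX' hx.
rewrite subr0 opprK in E.
pose y u := (u < 0)%R%:R *: x u.
have by_ : mlbm y by exact: mlbm_past.
have yout u : ~~ (- b <= u <= 0) -> y u = 0.
  rewrite /y; case: (ltP u 0) => u0; last by rewrite scale0r.
  rewrite (ltW u0) andbT -ltNge => ub; by rewrite scale1r x0.
have Ec := conv_assoc tau bX by_ yout.
have E1 : MInt (fun u => rop X (tau - u) *m y u) =
    MInt (fun u => icc (- b) 0 u *: (rop X (tau - u) *m x u)).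
  apply: (@eq_MInt_off _ _ _ [:: 0]); first exact: mlbmM.
    by apply: mlbmZ; [exact: lbm_icc|exact: mlbmM].
  move=> u; rewrite inE => u0; case: (boolP (- b <= u <= 0)) => ub; last first.
    by rewrite yout// /icc (negbTE ub) mulmx0 scale0r.
  move: (ub) => /andP[_]; rewrite le_eqVlt (negbTE u0) /= => u0'.
  by rewrite /y u0' /icc ub !scale1r.
have bl : mlbm (fun u => icc (- b) 0 u *: (X (tau - u) *m lop x u)).
  by apply: mlbmZ; [exact: lbm_icc|apply: mlbmM => //; exact: mlbm_lop].
have br : mlbm (fun u => icc 0 H u *: (X (tau - u) *m rho x u)).
  by apply: mlbmZ; [exact: lbm_icc|apply: mlbmM => //; exact: mlbm_rho].
have E2 : MInt (fun u => X (tau - u) *m lop y u) =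
    MInt (fun u => icc (- b) 0 u *: (X (tau - u) *m lop x u)) +
    MInt (fun u => icc 0 H u *: (X (tau - u) *m rho x u)).
  rewrite -MIntD; [|apply: mL1_icc; apply: mlbmM => //; exact: mlbm_lop|
    apply: mL1_icc; apply: mlbmM => //; exact: mlbm_rho].
  apply: (@eq_MInt_off _ _ _ [:: 0]); first by apply: mlbmM => //; exact: mlbm_lop.
    exact: mlbmD.
  move=> u; rewrite inE => u0; rewrite -/(rho x u) /icc.
  case: (ltgtP u 0) u0 => // u0 _; rewrite ?andbF ?andbT /=.
    rewrite scale0r addr0 rho_neg//; case: (leP (- b) u) => ub; first by rewrite scale1r.
    rewrite scale0r -(rho_neg x u0) /rho (@eq_lop y (fun=> 0)) ?lop0 ?mulmx0// => r /andP[_ ru].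
    by apply: yout; rewrite leNgt (le_lt_trans ru ub).
  rewrite scale0r add0r; case: (leP u H) => uH; first by rewrite scale1r.
  by rewrite rho_out ?(ltW uH)// mulmx0 scaler0.
have -> : (fun u => icc (- b) 0 u *: ((dX (tau - u) - rop X (tau - u)) *m x u)) =
   (fun u => icc (- b) 0 u *: (dX (tau - u) *m x u) + - (icc (- b) 0 u *: (rop X (tau - u) *m x u))).
  by apply/funext => u; rewrite mulmxBl scalerBr.
rewrite MIntD; [|by apply: mL1_icc; exact: mlbmM|]; last first.
  by move=> i j; apply: eq_L1 (L1N (mL1_icc (- b) 0 (mlbmM bRt bx) i j)) => u; rewrite [RHS]mxE.
rewrite MIntN; last by apply: mL1_icc; exact: mlbmM.
rewrite -E1 -Ec E2 E.
have alg (p1 p2 p3 p4 : 'cV[R]_n) : p1 = p2 + p3 + (p4 - (p2 - p1 + p4 + p3)).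
  by apply/matrixP => i j; rewrite !mxE; ring.
exact: alg.
Qed.

(** Turns the algebraic property of a Lyapunov matrix into a statement about its right derivative at
    0. *)
Lemma rop0_addtr X : mlbm X -> rop X 0 + (rop X 0)^T =
  \sum_j ((A j)^T *m (X (- h j))^T + X (- h j) *m A j)
  + mxint (- H) 0 (fun th => (G th)^T *m (X th)^T + X th *m G th).
Proof.
move=> bX; have lX := mL1_rop 0 bX.
have lXt : mL1 (fun th => (X (0 + th) *m Gt th)^T).
  by move=> i j; apply: eq_L1 (lX j i) => th; rewrite [RHS]mxE.
rewrite ropE linearD /= linear_sum /= MInt_tr addrACA -big_split /= -(MIntD lX lXt) MInt_itv.
congr (_ + _); first by apply: eq_bigr => j _; rewrite trmx_mul sub0r addrC.
apply: eq_MInt => th; rewrite add0r trmx_mul addrC /Gt scalerDr linearZ /=.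
by rewrite -scalemxAl -scalemxAr.
Qed.

(** * The functional defined by a Lyapunov matrix *)

Section Functional.
Variable W : 'M[R]_n.
Hypothesis W_sym : W^T = W.
Variable U : R -> 'M[R]_n.
Hypothesis U_lyap : is_delay_lyapunov_matrix A h H G W U.

Notation V := (rop U).

Lemma U_continuous i j : continuous (fun t => U t i j).
Proof. by case: U_lyap => cU _ _ _ t; exact: (cvg_entry (cU t)). Qed.

Lemma mlbm_U : mlbm U.
Proof. by move=> i j; apply: lbm_continuous; exact: U_continuous. Qed.

Lemma U_sym t : U (- t) = (U t)^T.
Proof.
case: U_lyap => _ _ sU _; case: (leP 0 t) => t0; first by rewrite [in RHS]sU// trmxK.
by rewrite sU ?oppr_ge0 ?(ltW t0)// opprK.
Qed.

(* The derivative of [U] off its corner at 0. *)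
Definition dU t := (0 <= t)%R%:R *: V t - (t < 0)%R%:R *: (V (- t))^T.

Lemma dU_ge0 t : 0 <= t -> dU t = V t.
Proof. by move=> t0; rewrite /dU t0 ltNge t0 scale1r scale0r subr0. Qed.

Lemma dU_lt0 t : t < 0 -> dU t = - (V (- t))^T.
Proof. by move=> t0; rewrite /dU t0 leNgt t0 scale1r scale0r sub0r. Qed.

Lemma mlbm_dU : mlbm dU.
Proof.
have bV := mlbm_rop mlbm_U.
apply: mlbmB; apply: mlbmZ => //; first exact: lbm_ge.
  exact: lbm_lt.
exact: (mlbm_tr (mlbm_opp bV)).
Qed.

Lemma U_pderm a b : pderm [:: 0] a b U dU.
Proof.
move=> i j; split; first by apply: continuous_subspaceT; exact: U_continuous.
move=> t _; rewrite inE => t0; case: U_lyap => _ [dU_pos _] _ _.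
case: (ltgtP t 0) t0 => // t0 _; last first.
  by rewrite dU_ge0 ?(ltW t0)//; apply: is_derive_entry; exact: dU_pos.
rewrite dU_lt0//.
have h1 : is_derive (- t) 1 (fun u => U u j i) (V (- t) j i).
  by apply: is_derive_entry; apply: dU_pos; rewrite oppr_gt0.
have h2 : is_derive t 1 (fun u : R => - u) (-1) by exact: is_deriveN.
have := @is_derive1_comp _ (fun u => U u j i) (fun u => - u) t _ _ h1 h2.
rewrite mulrN1 [in X in is_derive _ _ _ X -> _](_ : - V (- t) j i = (- (V (- t))^T) i j).
  by rewrite (_ : (_ \o _) = (fun u => U u i j))//; apply/funext => u /=; rewrite U_sym mxE.
by rewrite [RHS]mxE; congr (- _); rewrite [RHS]mxE.
Qed.

(* The state at time [b] of the solution [K v]. *)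
Definition tail (v : 'cV[R]_n) b u := K (u + b) *m v.

Lemma tail_traj v b : traj (- b) (tail v b).
Proof. by apply: (@traj_shift (- b) b (fun t => K t *m v)); rewrite addNr; exact: K_left. Qed.

Lemma tail_mlbm v b : mlbm (tail v b).
Proof. by case: (tail_traj v b). Qed.

Lemma tail_neg v b u : u < - b -> tail v b u = 0.
Proof. by move=> ub; rewrite /tail K_neg ?mul0mx//; move: ub; lra. Qed.

Lemma tail_start v b : tail v b (- b) = v.
Proof. by rewrite /tail addNr K_0 mul1mx. Qed.

(** The right-hand side of the variation of constants formula, with [U] in place of [K]. *)
Definition residual x tau := U tau *m x 0 + MInt (fun u => icc 0 H u *: (U (tau - u) *m rho x u)).

(** For [tau >= 0] the derivative of [U] is only taken on [[tau, tau + b]], where it is [V], so the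
    last integral of [dual_formula] vanishes. *)
Lemma U_add_pos v b tau : 0 <= b -> 0 <= tau -> U (tau + b) *m v = residual (tail v b) tau.
Proof.
move=> b0 tau0; have [bx [s hs]] := tail_traj v b.
have bV := mlbm_rop mlbm_U.
have hU : pderm [:: 0] tau (tau + b) U V.
  apply: eq_pderm (U_pderm tau (tau + b)) => t /andP[taut _].
  by rewrite dU_ge0// (le_trans tau0 (ltW taut)).
have := dual_formula b0 mlbm_U bV bx hU (hs 0) (fun u => @tail_neg v b u).
rewrite tail_start => ->.
have -> : (fun u => icc (- b) 0 u *: ((V (tau - u) - V (tau - u)) *m tail v b u)) = fun=> 0.
  by apply/funext => u; rewrite subrr mul0mx scaler0.
by rewrite MInt0 addr0.
Qed.

Lemma mL1_residual x tau : mlbm x -> mL1 (fun u => icc 0 H u *: (U (tau - u) *m rho x u)).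
Proof.
move=> bx; apply: mL1_icc; apply: mlbmM; first exact: (mlbm_refl tau mlbm_U).
exact: mlbm_rho.
Qed.

(** Only positive increments are used, since at the corner [b = 0] only the right derivative is
    given. *)
Lemma U_diff_quot_pos b : 0 <= b -> forall i j,
  k.+1%:R * (U (b + k.+1%:R^-1) i j - U b i j) @[k --> \oo] --> V b i j.
Proof.
move=> b0 i j; case: U_lyap => _ [dU_pos dU0] _ _.
move: b0; rewrite le_eqVlt => /predU1P[<-|b0]; last first.
  have hd := is_derive_entry i j (dU_pos b b0).
  exact (is_derive_seq hd).
have hs : (fun k : nat => k.+1%:R^-1) @ \oo --> (0 : R)^'+.
  move=> P /= [d /= d0 hP]; have /cvgrPdist_lt/(_ d d0) := @cvg_harmonic R.
  by apply: filterS => k kd; apply: hP => //=; rewrite invr_gt0.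
have hc := cvg_comp _ _ hs (@cvg_entry R R n n (fun t => t^-1 *: (U t - U 0)) _ _ _ i j dU0).
apply: cvg_trans _ (hc _); apply: near_eq_cvg; apply: nearW => k /=.
by rewrite !mxE invrK add0r.
Qed.

(** The right derivative of [U_add_pos] at [tau = 0]. Under the integral [U] is differentiated at
    the negative time [- u], where its derivative is [- (V u)^T]. *)
Lemma V_pos v b : 0 <= b ->
  V b *m v = V 0 *m (K b *m v) - MInt (fun u => icc 0 H u *: ((V u)^T *m rho (tail v b) u)).
Proof.
move=> b0; have bx := tail_mlbm v b; have br := mlbm_rho bx.
have bV := mlbm_rop mlbm_U.
set x := tail v b in bx br *.
have x0E : x 0 = K b *m v by rewrite /x /tail add0r.
have E (k : nat) : k.+1%:R *: ((U (b + k.+1%:R^-1) - U b) *m v) =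
    k.+1%:R *: ((U (0 + k.+1%:R^-1) - U 0) *m x 0) +
    MInt (fun u => icc 0 H u *: (k.+1%:R *: (U (k.+1%:R^-1 - u) - U (- u)) *m rho x u)).
  set d := k.+1%:R^-1; have d0 : 0 <= d by rewrite invr_ge0.
  have := U_add_pos v b0 d0; have := U_add_pos v b0 (lexx 0).
  rewrite -/x /residual add0r => E0 Ed.
  rewrite mulmxBl (addrC b) Ed E0 add0r mulmxBl opprD addrACA scalerDr; congr (_ + _).
  have l1 := mL1_residual d bx; have l0 := mL1_residual 0 bx.
  rewrite -MIntN// -MIntD//; last first.
    by move=> p q; apply: eq_L1 (L1N (l0 p q)) => u; rewrite [RHS]mxE.
  rewrite -MIntZ; last first.
    apply: mL1D => // p q; apply: eq_L1 (L1N (l0 p q)) => u; by rewrite [RHS]mxE.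
  by apply: eq_MInt => u; rewrite sub0r -scalemxAl mulmxBl -scalerBr !scalerA mulrC.
have lim1 b' (w : 'cV_n) i : 0 <= b' -> (k.+1%:R *: ((U (b' + k.+1%:R^-1) - U b') *m w)) i 0 @[k --> \oo]
    --> (V b' *m w) i 0.
  move=> b'0; rewrite mxE.
  rewrite (_ : (fun k : nat => _) = (fun k : nat =>
      \sum_j (k.+1%:R * (U (b' + k.+1%:R^-1) i j - U b' i j)) * w j 0)).
    apply: cvg_bigsum => j; apply: cvgM; last exact: cvg_cst.
    exact: U_diff_quot_pos.
  apply/funext => k; rewrite !mxE mulr_sumr; apply: eq_bigr => j _.
  by rewrite !mxE mulrA.
have lim2 i : MInt (fun u => icc 0 H u *: (k.+1%:R *: (U (k.+1%:R^-1 - u) - U (- u)) *m rho x u)) i 0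
    @[k --> \oo] --> MInt (fun u => icc 0 H u *: (- (V u)^T *m rho x u)) i 0.
  (* The increments are at most 1, so the difference quotients of [U] only see its derivative on
     [[- H, 1]]. *)
  have [C C0 hC] := mlbm_bounded (- H) 1 mlbm_dU.
  have [Cr Cr0 hCr] := mlbm_bounded 0 H br.
  rewrite mxE (_ : (fun k : nat => _) = (fun k : nat =>
    Int (fun u => (icc 0 H u *: (k.+1%:R *: (U (k.+1%:R^-1 - u) - U (- u)) *m rho x u)) i 0)));
    last first.
    by apply/funext => k; rewrite mxE.
  have mU k : mlbm (fun u => icc 0 H u *: (k.+1%:R *: (U (k.+1%:R^-1 - u) - U (- u)) *m rho x u)).
    apply: mlbmZ; first exact: lbm_icc.
    apply: mlbmM => //; apply: mlbmZ; first exact: lbm_cst.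
    by apply: mlbmB; [exact: mlbm_refl mlbm_U|exact: mlbm_opp mlbm_U].
  apply: (@DCT _ _ _ (fun u => (\sum_(l < n) C * Cr) * icc 0 H u)).
  - by move=> k; case: (mU k i 0).
  - have bb : mlbm (fun u => icc 0 H u *: (- (V u)^T *m rho x u)).
      apply: mlbmZ; first exact: lbm_icc.
      by apply: mlbmM => //; apply: mlbmN; exact: mlbm_tr.
    by case: (bb i 0).
  - by apply: L1Z; exact: L1_icc.
  - have key (u : R) : u != 0 ->
        (icc 0 H u *: (k.+1%:R *: (U (k.+1%:R^-1 - u) - U (- u)) *m rho x u)) i 0
      @[k --> \oo] --> (icc 0 H u *: (- (V u)^T *m rho x u)) i 0.
      move=> u0; case: (boolP (0 <= u <= H)) => uH; last first.
        rewrite /icc (negbTE uH) (_ : (fun k : nat => _) = fun=> 0); last first.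
          by apply/funext => k; rewrite scale0r mxE.
        by rewrite scale0r mxE; exact: cvg_cst.
      rewrite /icc uH scale1r mxE.
      rewrite (_ : (fun k : nat => _) = (fun k : nat =>
        \sum_j (k.+1%:R * (U (- u + k.+1%:R^-1) i j - U (- u) i j)) * rho x u j 0)).
        apply: cvg_bigsum => j; apply: cvgM; last exact: cvg_cst.
        have [_ hU] := U_pderm (- u - 1) (- u + 1) i j.
        have u0' : - u < 0 by rewrite oppr_lt0 lt_neqAle eq_sym u0; case/andP: uH.
        have := hU (- u); rewrite dU_lt0// opprK => hU'.
        apply: (@is_derive_seq _ (fun u => U u i j)); apply: hU'; first by lra.
        by rewrite inE oppr_eq0.
      apply/funext => k; rewrite scale1r mxE; apply: eq_bigr => j _.
      by rewrite !mxE (addrC _ (- u)).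
    have [Z [mZ Z0 sZ]] := negligible_seq [:: 0 : R].
    exists Z; split=> // u nu; apply: sZ => /=; apply: contrapT => /negP; rewrite inE => us.
    by apply: nu; exact: key.
  - move=> k u; rewrite mxE /icc; case: (boolP (0 <= u <= H)) => uH; last first.
      by rewrite mul0r mulr0 normr0.
    rewrite mul1r mulr1 mxE; apply: le_trans (ler_norm_sum _ _ _) _; apply: ler_sum => j _.
    rewrite normrM ler_pM ?hCr// !mxE.
    set d := k.+1%:R^-1 : R.
    have d0 : 0 < d by rewrite invr_gt0.
    have d1 : d <= 1 by rewrite invf_le1 ?ler1n.
    have ud : - u <= d - u by lra.
    have bd : `|U (d - u) i j - U (- u) i j| <= C * (d - u - - u).
      apply: pder_norm ud (U_pderm (- u) (d - u) i j) _ => t tu _; apply: hC.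
      by case/andP: uH => uH0 uH1; case/andP: tu => tu0 tu1; apply/andP; split; lra.
    rewrite (_ : d - u - - u = d) in bd; last by ring.
    by rewrite normrM ger0_norm// mulrC -ler_pdivlMr ?ltr0n.
apply/colP => i; rewrite [RHS]mxE.
have L := lim1 b v i b0; have L0 := lim1 0 (x 0) i (lexx 0).
rewrite x0E in L0.
have -> : (V b *m v) i 0 = (V 0 *m (K b *m v)) i 0 +
    MInt (fun u => icc 0 H u *: (- (V u)^T *m rho x u)) i 0.
  rewrite -(cvg_lim _ L)//; apply: cvg_lim => //.
  rewrite (_ : (fun k : nat => _) = (fun k : nat =>
      (k.+1%:R *: ((U (0 + k.+1%:R^-1) - U 0) *m (K b *m v))) i 0 +
     MInt (fun u => icc 0 H u *: (k.+1%:R *: (U (k.+1%:R^-1 - u) - U (- u)) *m rho x u)) i 0)).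
    by apply: cvgD; [exact: L0|exact: lim2].
  by apply/funext => k; rewrite E mxE x0E.
congr (_ + _).
rewrite [RHS]mxE [LHS]mxE [in RHS]mxE -IntN.
  by apply: eq_Int => u; rewrite mulNmx scalerN [LHS]mxE.
by apply: (mL1_icc 0 H (mlbmM (mlbm_tr bV) br)).
Qed.

Lemma V_tr t : (V t)^T =
  \sum_j (A j)^T *m U (h j - t) + MInt (fun th => (Gt th)^T *m U (- th - t)).
Proof.
rewrite ropE linearD /= linear_sum /= MInt_tr; congr (_ + _).
  by apply: eq_bigr => j _; rewrite trmx_mul -U_sym opprB.
by apply: eq_MInt => th; rewrite trmx_mul -U_sym opprD addrC.
Qed.

(** By [V_tr] the left side involves [U] at [h j + b] and [- th + b] only. [U_add_pos] applies to
    each of these, and Fubini's theorem reassembles the resulting integrals into [V u]. *)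
Lemma V_neg v b : 0 <= b -> (V (- b))^T *m v = (V 0)^T *m (K b *m v) +
  MInt (fun u => icc 0 H u *: ((V u)^T *m rho (tail v b) u)).
Proof.
move=> b0; have bx := tail_mlbm v b; have br := mlbm_rho bx.
have x0E : K b *m v = tail v b 0 by rewrite /tail add0r.
have HU tau := @U_add_pos v b tau b0.
move: bx br x0E HU; set x := tail v b => bx br x0E HU.
pose F (z : R * R) := icc 0 H z.1 *: ((Gt z.2)^T *m U (- z.2 - z.1) *m rho x z.1).
have bU' : mlbm (fun t => U (- t)) by exact: mlbm_opp mlbm_U.
have bF : mlbm2 F.
  move=> i j; apply: (@eq_lbm2 _ (fun z => icc 0 H z.1 *
      ((Gt z.2)^T *m U (- (z.2 + z.1)) *m rho x z.1) i j)).
    by move=> z; rewrite opprD [RHS]mxE.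
  apply: lbm2M; first exact: (lbm2_fst (lbm_icc 0 H)).
  apply: (mlbm2M (X := fun z => (Gt z.2)^T *m U (- (z.2 + z.1)))).
    apply: mlbm2M => k l; first exact: (lbm2_snd (mlbm_tr bGt k l)).
    by apply: eq_lbm2 (lbm2_add (bU' k l)) => z; rewrite addrC.
  by move=> k l; apply: (lbm2_fst (br k l)).
have F0 s t : ~~ ((`|s| <= H) && (`|t| <= H)) -> F (s, t) = 0.
  rewrite negb_and /F /=; case: (boolP (0 <= s <= H)) => [/andP[s0 sH]|sH]; last first.
    by rewrite /icc (negbTE sH) scale0r.
  rewrite ger0_norm// sH /= => tH; rewrite Gt_out ?trmx0 ?mul0mx ?scaler0//.
  apply: contra tH => /andP[t1 t2]; rewrite ler0_norm//; lra.
have lA j t : mL1 (fun u => icc 0 H u *: ((A j)^T *m U (t - u) *m rho x u)).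
  apply: mL1_icc; apply: mlbmM => //; apply: mlbmM; first exact: mlbm_cst.
  exact: (mlbm_refl t mlbm_U).
have lF := mL1_MInt bF F0.
have lG w t : mL1 (fun th => (Gt th)^T *m U (- th - t) *m w).
  apply: (@mlbm_mL1 _ _ _ (- H) 0).
    apply: mlbmM; last exact: mlbm_cst.
    by apply: mlbmM; [exact: mlbm_tr|apply: eq_mlbm (mlbm_shift t bU') => u; rewrite opprD].
  by move=> th thH; rewrite Gt_out// trmx0 !mul0mx.
have lG' t : mL1 (fun th => (Gt th)^T *m U (- th - t)).
  apply: (@mlbm_mL1 _ _ _ (- H) 0).
    by apply: mlbmM; [exact: mlbm_tr|apply: eq_mlbm (mlbm_shift t bU') => u; rewrite opprD].
  by move=> th thH; rewrite Gt_out// trmx0 !mul0mx.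
have E1 : MInt (fun u => icc 0 H u *: ((V u)^T *m rho x u)) =
   \sum_j (A j)^T *m MInt (fun u => icc 0 H u *: (U (h j - u) *m rho x u)) +
   MInt (fun th => MInt (fun u => F (u, th))).
  rewrite -(MInt_Fubini bF F0).
  transitivity (MInt (fun u => \sum_j icc 0 H u *: ((A j)^T *m U (h j - u) *m rho x u) +
      MInt (fun th => F (u, th)))).
    apply: eq_MInt => u; rewrite V_tr mulmxDl scalerDr mulmx_suml scaler_sumr; congr (_ + _).
    rewrite -(MInt_mr _ (lG' u)) -MIntZ; first exact: eq_MInt.
    exact: lG.
  etransitivity; first exact: (MIntD (mL1_sum _ (fun j => lA j (h j))) lF).
  refine (f_equal2 +%R _ _) => //; rewrite (MInt_sum _ (fun j => lA j (h j))).
  apply: eq_bigr => j _; rewrite -MInt_ml; last first.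
    apply: mL1_icc; apply: mlbmM => //; exact: (mlbm_refl (h j) mlbm_U).
  by apply: eq_MInt => u; rewrite -scalemxAr mulmxA.
have E2 : (V (- b))^T *m v =
   \sum_j (A j)^T *m (U (h j) *m x 0 + MInt (fun u => icc 0 H u *: (U (h j - u) *m rho x u))) +
   MInt (fun th => (Gt th)^T *m U (- th - 0) *m x 0 + MInt (fun u => F (u, th))).
  rewrite V_tr mulmxDl mulmx_suml; refine (f_equal2 +%R _ _).
    apply: eq_bigr => j _; rewrite -mulmxA opprK HU//.
    by case/andP: (h_itv j).
  rewrite -(MInt_mr _ (lG' (- b))); apply: eq_MInt => th.
  case: (boolP (- H <= th <= 0)) => thH; last first.
    rewrite Gt_out// trmx0 !mul0mx add0r -[LHS](@MInt0 R n 1); apply: eq_MInt => u.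
    by rewrite /F /= Gt_out// trmx0 !mul0mx scaler0.
  rewrite -mulmxA opprK HU; last by case/andP: thH; rewrite oppr_ge0.
  rewrite /residual mulmxDr mulmxA subr0 -MInt_ml; last first.
    apply: mL1_icc; apply: mlbmM => //; exact: (mlbm_refl (- th) mlbm_U).
  by congr (_ + _); apply: eq_MInt => u; rewrite /F /= -scalemxAr mulmxA.
have lF' := mL1_MInt_swap bF F0.
clear bF F0 lF lA bx br HU bU'.
rewrite E1 E2 x0E V_tr mulmxDl mulmx_suml; clear E1 E2.
rewrite (MIntD (lG _ (x 0) 0) lF') (MInt_mr _ (lG' 0)).
rewrite (eq_bigr (fun j => (A j)^T *m U (h j - 0) *m x 0 +
  (A j)^T *m MInt (fun u => icc 0 H u *: (U (h j - u) *m rho x u)))); last first.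
  by move=> j _; rewrite mulmxDr mulmxA subr0.
by rewrite big_split /= addrACA.
Qed.

Lemma V0_sym : V 0 + (V 0)^T = - W.
Proof. by case: U_lyap => _ _ _ ->; rewrite (rop0_addtr mlbm_U). Qed.

(** The integrals in [V_pos] and [V_neg] cancel. What remains is [(V 0 + (V 0)^T) K b], and the
    algebraic property evaluates the bracket. *)
Lemma V_reflect b : 0 <= b -> V b + (V (- b))^T = - (W *m K b).
Proof.
move=> b0; apply: mulmx_ext => v; rewrite mulmxDl V_pos// V_neg//.
by rewrite addrACA addNr addr0 -mulmxDl V0_sym !mulNmx mulmxA.
Qed.

Lemma dU_neq0 t : t != 0 -> dU t = V t + (K (- t))^T *m W.
Proof.
move=> t0; case: (ltgtP t 0) t0 => // t0 _; last first.
  by rewrite dU_ge0 ?ltW// K_neg ?oppr_lt0// trmx0 mul0mx addr0.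
have b0 : 0 <= - t by rewrite oppr_ge0 ltW.
rewrite dU_lt0//; have := congr1 trmx (V_reflect b0).
rewrite opprK linearD /= trmxK linearN /= trmx_mul W_sym => /eqP.
by rewrite addrC -subr_eq0 opprK => /eqP e; apply/eqP; rewrite eq_sym -subr_eq0 opprK addrAC e.
Qed.

(* The second integral is due to [dU] and [V] being different on negative times. *)
Lemma U_add v b tau : 0 <= b -> U (tau + b) *m v = residual (tail v b) tau +
  MInt (fun u => icc (- b) 0 u *: ((K (u - tau))^T *m W *m tail v b u)).
Proof.
move=> b0; have [bx [s hs]] := tail_traj v b.
have := dual_formula b0 mlbm_U mlbm_dU bx (U_pderm tau (tau + b)) (hs 0) (fun u => @tail_neg v b u).
rewrite tail_start /residual => ->; congr (_ + _).
have bV := mlbm_rop mlbm_U.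
apply: (@eq_MInt_off _ _ _ [:: tau]).
- apply: mlbmZ; first exact: lbm_icc.
  exact: mlbmM (mlbmB (mlbm_refl tau mlbm_dU) (mlbm_refl tau bV)) bx.
- apply: mlbmZ; first exact: lbm_icc.
  apply: mlbmM => //; apply: mlbmM; last exact: mlbm_cst.
  exact: (mlbm_tr (mlbm_shift (- tau) mlbm_K)).
move=> u; rewrite inE => ut; rewrite dU_neq0 ?subr_eq0 1?eq_sym//.
by rewrite opprB addrAC subrr add0r.
Qed.

Lemma mlbm_residual y : mlbm y -> mlbm (residual y).
Proof.
move=> by_; apply: mlbmD; first by apply: mlbmM; [exact: mlbm_U|exact: mlbm_cst].
apply: (@mlbm_conv _ _ _ (fun z : R * R => icc 0 H z.2 *: (U (z.1 - z.2) *m rho y z.2)) H).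
  move=> i j; apply: (@eq_lbm2 _ (fun z => icc 0 H z.2 * (U (z.1 - z.2) *m rho y z.2) i j)).
    by move=> z; rewrite [RHS]mxE.
  apply: lbm2M; first exact: (lbm2_snd (lbm_icc 0 H)).
  apply: (mlbm2M (X := fun z => U (z.1 - z.2))) => k l.
    exact: (lbm2_sub (mlbm_U k l)).
  exact: (lbm2_snd (mlbm_rho by_ k l)).
move=> s t tH /=; rewrite /icc; case: (boolP (0 <= t <= H)) => [/andP[t0 tH']|_].
  by move: tH; rewrite ger0_norm// tH'.
by rewrite scale0r.
Qed.

Lemma residualD x y tau : mlbm x -> mlbm y ->
  residual (fun s => x s + y s) tau = residual x tau + residual y tau.
Proof.
move=> bx by_; rewrite /residual mulmxDr [RHS]addrACA.
rewrite -(MIntD (mL1_residual tau bx) (mL1_residual tau by_)); congr (_ + _).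
by apply: eq_MInt => u; rewrite rhoD// mulmxDr scalerDr.
Qed.

(* [v1] is the polar form of the Lyapunov-Krasovskii functional whose derivative along a
   solution is [- x(t - H)^T W x(t - H)]. *)
Definition v0 x y := dot (x 0) (residual y 0) + Int (fun t => icc 0 H t * dot (rho x t) (residual y t)).

Definition vW x y := Int (fun s => icc (- H) 0 s * dot (x s) (W *m y s)).

Definition v1 x y := v0 x y + vW x y.

Lemma lbm_dotW x y : mlbm x -> mlbm y -> lbm (fun s => dot (x s) (W *m y s)).
Proof. by move=> bx by_; apply: lbm_dot => //; apply: mlbmM => //; exact: mlbm_cst. Qed.

Lemma v1Dl x x' y : mlbm x -> mlbm x' -> mlbm y ->
  v1 (fun s => x s + x' s) y = v1 x y + v1 x' y.
Proof.
move=> bx bx' by_; have br := mlbm_rho bx; have br' := mlbm_rho bx'.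
have bs := mlbm_residual by_.
rewrite /v1 /v0 /vW [RHS]addrACA [X in X + _ = _](_ : _ =
   (dot (x 0) (residual y 0) + Int (fun t => icc 0 H t * dot (rho x t) (residual y t)) +
   (dot (x' 0) (residual y 0) + Int (fun t => icc 0 H t * dot (rho x' t) (residual y t))))).
  congr (_ + _).
  rewrite -(IntD (L1_icc_lbm (- H) 0 (lbm_dotW bx by_)) (L1_icc_lbm (- H) 0 (lbm_dotW bx' by_))).
  by apply: eq_Int => s; rewrite dotDl mulrDr.
rewrite dotDl [RHS]addrACA; congr (_ + _).
rewrite -(IntD (L1_icc_lbm 0 H (lbm_dot br bs)) (L1_icc_lbm 0 H (lbm_dot br' bs))).
by apply: eq_Int => s; rewrite rhoD// dotDl mulrDr.
Qed.

Lemma v1Dr x y y' : mlbm x -> mlbm y -> mlbm y' ->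
  v1 x (fun s => y s + y' s) = v1 x y + v1 x y'.
Proof.
move=> bx by_ by'; have br := mlbm_rho bx.
have bs := mlbm_residual by_; have bs' := mlbm_residual by'.
rewrite /v1 /v0 /vW [RHS]addrACA [X in X + _ = _](_ : _ =
   (dot (x 0) (residual y 0) + Int (fun t => icc 0 H t * dot (rho x t) (residual y t)) +
   (dot (x 0) (residual y' 0) + Int (fun t => icc 0 H t * dot (rho x t) (residual y' t))))).
  congr (_ + _).
  rewrite -(IntD (L1_icc_lbm (- H) 0 (lbm_dotW bx by_)) (L1_icc_lbm (- H) 0 (lbm_dotW bx by'))).
  by apply: eq_Int => s; rewrite mulmxDr dotDr mulrDr.
rewrite residualD// dotDr [RHS]addrACA; congr (_ + _).
rewrite -(IntD (L1_icc_lbm 0 H (lbm_dot br bs)) (L1_icc_lbm 0 H (lbm_dot br bs'))).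
by apply: eq_Int => s; rewrite residualD// dotDr mulrDr.
Qed.

Lemma dot_U_sym t (u v : 'cV[R]_n) : dot u (U t *m v) = dot v (U (- t) *m u).
Proof. by rewrite U_sym dot_mulmx dotC. Qed.

(** [U_add_pos] replaces the residuals of the second state by [U (t + b) g']. After transposition
    the sum is the residual of the first state at [- b], which [U_add] evaluates. *)
Lemma v0_tail g g' a b : 0 <= a -> 0 <= b -> v0 (tail g a) (tail g' b) =
  dot g' (U (a - b) *m g) - Int (fun s => icc (- a) 0 s * dot (tail g a s) (W *m tail g' b s)).
Proof.
move=> a0 b0; have bx := tail_mlbm g a; have by_ := tail_mlbm g' b; have br := mlbm_rho bx.
have -> : v0 (tail g a) (tail g' b) = dot g' (residual (tail g a) (- b)).
  have [e l] := Int_dot g' (mL1_residual (- b) bx).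
  rewrite /residual dotDr e /v0; congr (_ + _).
    by rewrite -(U_add_pos g' b0 (lexx 0)) add0r dot_U_sym.
  apply: eq_Int => t; rewrite dotZr /icc; case: (boolP (0 <= t <= H)) => [/andP[t0 _]|_];
    last by rewrite !mul0r.
  by rewrite -(U_add_pos g' b0 t0) dot_U_sym opprD addrC.
rewrite (addrC a) (U_add g (- b) a0) (dotDr _ (residual (tail g a) (- b))).
have bI : mlbm (fun u => (K (u - - b))^T *m W *m tail g a u).
  apply: mlbmM => //; apply: mlbmM; last exact: mlbm_cst.
  exact: (mlbm_tr (mlbm_shift _ mlbm_K)).
have [-> _] := Int_dot g' (mL1_icc (- a) 0 bI).
rewrite (@eq_Int _ _ (fun s => icc (- a) 0 s * dot (tail g a s) (W *m tail g' b s))) ?addrK// => s.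
rewrite dotZr; congr (_ * _).
by rewrite opprK -mulmxA dot_mulmx trmxK dot_mulmx W_sym dotC.
Qed.

Lemma tail_icc_cut g a c (y : R -> 'cV[R]_n) s : a <= c ->
  icc (- c) 0 s * dot (tail g a s) (y s) = icc (- a) 0 s * dot (tail g a s) (y s).
Proof.
move=> ac; rewrite /icc; case: (leP (- a) s) => sa; last by rewrite tail_neg// dot0l !mulr0.
by rewrite (le_trans _ sa)// lerN2.
Qed.

(** For [a <= H] the first state vanishes on [[- H, - a[], so [vW] restores exactly the integral
    subtracted in [v0_tail]. *)
Lemma v1_tail g g' a b : 0 <= a <= H -> 0 <= b ->
  v1 (tail g a) (tail g' b) = dot g' (U (a - b) *m g).
Proof.
move=> /andP[a0 aH] b0; rewrite /v1 v0_tail// /vW.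
rewrite [X in _ + X](eq_Int (fun s => tail_icc_cut g (fun s => W *m tail g' b s) s aH)).
by rewrite subrK.
Qed.

(** The energy identity: for [t >= H] the term [vW] restores only the last [H] units of time of the
    integral in [v0_tail]. *)
Lemma v1_state g t : H <= t -> v1 (tail g t) (tail g t) =
  dot g (U 0 *m g) - Int (fun s => ico 0 (t - H) s * dot (K s *m g) (W *m (K s *m g))).
Proof.
move=> Ht; have t0 : 0 <= t by apply: le_trans Ht; exact: ltW.
have bx := tail_mlbm g t; have bW := lbm_dotW bx bx.
rewrite /v1 v0_tail// subrr /vW -addrA; congr (_ + _).
rewrite (Int_icc_ico _ _ bW) (Int_icc_ico _ _ bW).
have tH0 : - t <= - H <= 0 by rewrite lerN2 Ht oppr_le0 ltW.
rewrite (Int_ico_split tH0 bW) opprD -addrA addNr addr0; congr (- _).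
rewrite -[RHS](Int_shift t); last first.
  have bK : mlbm (fun s => K s *m g) by case: (K_left g).
  by apply: L1_ico_lbm; exact: lbm_dotW.
apply: eq_Int => s; congr (_ * _); rewrite /ico; congr (_%:R).
by congr andb; lra.
Qed.

Lemma nu_ub t : - H <= t <= H -> opnorm (U t) <= nu H U.
Proof.
have pos u : 0 <= u <= H -> opnorm (U u) <= nu H U.
  move=> uH; apply: ub_le_sup; last by exists u => //=; rewrite in_itv.
  have [C _ hC] := mlbm_opnorm_bounded 0 H mlbm_U.
  by exists C => _ [w /= + <-]; rewrite in_itv/= => wH; exact: hC.
move=> /andP[t1 t2]; case: (leP 0 t) => t0; first by apply: pos; rewrite t0.
have := U_sym (- t); rewrite opprK => ->; apply: le_trans (opnorm_tr _) _; apply: pos.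
by rewrite oppr_ge0 (ltW t0) lerNl.
Qed.

Lemma nu_ge0 : 0 <= nu H U.
Proof.
apply: le_trans (@nu_ub 0 _); first exact: opnorm_ge0.
by rewrite oppr_le0 (ltW H_gt0).
Qed.

(* Mass of the delays that reach back from time [t] to before 0. *)
Definition rmass t := \sum_j opnorm (A j) * ico 0 (h j) t + bg * (ico 0 H t * (H - t)).

Lemma rmass_ge0 t : 0 <= rmass t.
Proof.
rewrite addr_ge0//; first by apply: sumr_ge0 => j _; rewrite mulr_ge0 ?opnorm_ge0 ?ico_ge0.
rewrite mulr_ge0 ?bG_ge0//; case: (icoP 0 H t) => [[[_ tH] ->]|->]; last by rewrite mul0r.
by rewrite mul1r subr_ge0 ltW.
Qed.

Hypothesis h_0 : h ord0 = 0.

Lemma L1_rmass : L1 rmass.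
Proof.
apply: L1D; first by apply: L1_sum => j; apply: L1Z; exact: L1_ico.
apply: L1Z; apply: L1_ico_lbm.
by apply: lbmB; [exact: lbm_cst|apply: lbm_continuous => t; exact: cvg_id].
Qed.

(** Explains [alpha2], which equals [nu (1 + Int rmass)^2 + H |W|] when expanded. The delay [h ord0]
    is zero, so its absence from [N1] agrees with the sum over all delays. *)
Lemma Int_rmass : Int rmass = N1 A h + bg * H ^+ 2 / 2.
Proof.
rewrite IntD; last 2 first.
- by apply: L1_sum => j; apply: L1Z; exact: L1_ico.
- apply: L1Z; apply: L1_ico_lbm.
  by apply: lbmB; [exact: lbm_cst|apply: lbm_continuous => t; exact: cvg_id].
rewrite IntZ; last first.
  apply: L1_ico_lbm.
  by apply: lbmB; [exact: lbm_cst|apply: lbm_continuous => t; exact: cvg_id].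
rewrite (Int_linear (ltW H_gt0)) mulrA; congr (_ + _).
rewrite Int_sum; last by move=> j; apply: L1Z; exact: L1_ico.
rewrite /N1 [RHS]big_mkcond /=; apply: eq_bigr => j _.
rewrite IntZ; last exact: L1_ico.
have /andP[h0 _] := h_itv j; rewrite (Int_ico h0) subr0.
case: (posnP j) => // j0; rewrite (_ : j = ord0) ?h_0 ?mulr0//.
exact: val_inj.
Qed.

Lemma rho_norm x N t : mlbm x -> 0 <= N -> (forall s, - H <= s <= 0 -> enorm (x s) <= N) ->
  0 <= t <= H -> enorm (rho x t) <= N * rmass t.
Proof.
move=> bx N0 xN /andP[t0 tH]; rewrite /rho lopE mulrDr mulr_sumr.
apply: le_trans (enormD _ _) _; apply: lerD.
  apply: le_trans (enorm_sum _ _) _; apply: ler_sum => j _.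
  apply: le_trans (opnormP _ _) _; rewrite mulrCA ler_wpM2l ?opnorm_ge0//.
  rewrite /ico t0 subr_lt0 /=; case: (ltP t (h j)) => thj; last first.
    by rewrite scale0r enorm0 mulr0.
  rewrite scale1r mulr1 xN//; have := h_itv j; lra.
have gE : bg * (ico 0 H t * (H - t)) = bg * (H - t).
  congr (_ * _); rewrite /ico t0 /=; move: tH; rewrite le_eqVlt => /predU1P[->|->].
    by rewrite ltxx subrr mul0r.
  by rewrite mul1r.
have tH' : - H <= - t by rewrite lerN2.
have := Int_ico tH'; rewrite opprK addrC => e.
rewrite gE mulrA -e -IntZ; last exact: L1_ico.
have bp := mlbm_past bx.
apply: (enorm_MInt (mL1_lop t bp)); first by apply: L1Z; exact: L1_ico.
move=> th; case: (boolP (- H <= th <= 0)) => [thH|/negP thH]; last first.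
  rewrite Gt_out ?mul0mx ?enorm0; last exact/negP.
  by rewrite mulr_ge0 ?ico_ge0 ?mulr_ge0 ?bG_ge0.
rewrite Gt_in//; apply: le_trans (opnormP _ _) _.
case/andP: thH => th1 th2.
rewrite /ico th1 /= (_ : (th < - t) = (t + th < 0)); last by apply/idP/idP; lra.
case: (ltP (t + th) 0) => tth; last by rewrite scale0r enorm0 !mulr0.
rewrite scale1r mulr1 mulrC ler_pM ?enorm_ge0 ?opnorm_ge0 ?bG_ub ?th1//.
by apply: xN; lra.
Qed.

Notation mass := (1 + (N1 A h + bg * H ^+ 2 / 2)).

Lemma mass_ge0 : 0 <= mass.
Proof. by rewrite -Int_rmass addr_ge0 ?ler01//; apply: Int_ge0 => t; exact: rmass_ge0. Qed.

Lemma residual_norm y N t : mlbm y -> 0 <= N -> (forall s, - H <= s <= 0 -> enorm (y s) <= N) ->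
  0 <= t <= H -> enorm (residual y t) <= nu H U * mass * N.
Proof.
move=> by_ N0 yN /andP[t0 tH]; rewrite mulrDr mulr1 mulrDl.
apply: le_trans (enormD _ _) _; apply: lerD.
  apply: le_trans (opnormP _ _) _; rewrite ler_pM ?enorm_ge0 ?opnorm_ge0//.
    by apply: nu_ub; rewrite tH andbT; apply: le_trans t0; rewrite oppr_le0 ltW.
  by apply: yN; rewrite lexx oppr_le0 ltW.
rewrite -Int_rmass mulrAC -IntZ; last exact: L1_rmass.
apply: enorm_MInt; first exact: mL1_residual.
  by apply: L1Z; exact: L1_rmass.
move=> u; rewrite /icc; case: (boolP (0 <= u <= H)) => [|_]; last first.
  by rewrite scale0r enorm0 mulr_ge0 ?rmass_ge0// mulr_ge0 ?nu_ge0.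
move=> uH; rewrite scale1r -mulrA; apply: le_trans (opnormP _ _) _.
rewrite ler_pM ?enorm_ge0 ?opnorm_ge0//; last exact: rho_norm.
by apply: nu_ub; lra.
Qed.

Lemma v1_bound x y N N' : mlbm x -> mlbm y -> 0 <= N -> 0 <= N' ->
  (forall s, - H <= s <= 0 -> enorm (x s) <= N) ->
  (forall s, - H <= s <= 0 -> enorm (y s) <= N') ->
  `|v1 x y| <= alpha2 A h H G W U * N * N'.
Proof.
move=> bx by_ N0 N'0 xN yN'.
have br := mlbm_rho bx; have bs := mlbm_residual by_.
have z0 : - H <= 0 <= (0 : R) by rewrite oppr_le0 (ltW H_gt0) /=.
have -> : alpha2 A h H G W U * N * N' =
    N * (nu H U * mass * N') + (N * (nu H U * mass * N')) * (N1 A h + bg * H ^+ 2 / 2)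
    + opnorm W * N * N' * H by rewrite /alpha2; field.
set P := nu H U * mass * N'.
have P0 : 0 <= P by rewrite !mulr_ge0 ?nu_ge0 ?mass_ge0.
apply: le_trans (ler_normD _ _) _; apply: lerD.
  apply: le_trans (ler_normD _ _) _; apply: lerD.
    apply: le_trans (norm_dot _ _) _; rewrite ler_pM ?enorm_ge0//; first exact: xN.
    by apply: residual_norm => //; rewrite lexx ltW.
  rewrite -Int_rmass -IntZ; last exact: L1_rmass.
  apply: norm_Int_le; first exact: L1_icc_lbm (lbm_dot br bs).
    by apply: L1Z; exact: L1_rmass.
  move=> t; rewrite /icc; case: (boolP (0 <= t <= H)) => tH; last first.
    by rewrite mul0r normr0 (mulr_ge0 (mulr_ge0 N0 P0) (rmass_ge0 t)).
  rewrite mul1r mulrAC; apply: le_trans (norm_dot _ _) _; rewrite ler_pM ?enorm_ge0//.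
    exact: rho_norm.
  exact: residual_norm.
have e : H = Int (ico (- H) 0) by rewrite Int_ico ?oppr_le0 ?ltW// sub0r opprK.
rewrite [X in _ <= _ * X]e -IntZ; last exact: L1_ico.
rewrite /vW (Int_icc_ico _ _ (lbm_dotW bx by_)).
apply: norm_Int_le; first exact: L1_ico_lbm (lbm_dotW bx by_).
  by apply: L1Z; exact: L1_ico.
move=> s; case: (icoP (- H) 0 s) => [[[s1 s2] ->]|->]; last by rewrite mul0r mulr0 normr0.
rewrite mul1r mulr1; apply: le_trans (norm_dot_opnorm _ _ _) _.
have sH : - H <= s <= 0 by rewrite s1 ltW.
by rewrite ler_pM ?enorm_ge0 ?mulr_ge0 ?opnorm_ge0 ?enorm_ge0 ?ler_wpM2l ?opnorm_ge0 ?xN ?yN'.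
Qed.

(** * Interpolation of states by shifts of the fundamental matrix *)

Variable L : R.
Hypothesis L_gt0 : 0 < L.
Hypothesis K_lip : forall s t v, 0 <= s -> s <= t -> t <= H ->
  enorm (K t *m v - K s *m v) <= L * (t - s) * enorm v.

Section Interpolation.
Variables (phi : R -> 'cV[R]_n) (N : R) (p : nat).
Hypotheses (N_ge0 : 0 <= N) (p_gt0 : (0 < p)%N).
Hypothesis phi_le : forall s, - H <= s <= 0 -> enorm (phi s) <= N.
Hypothesis phi_lip : forall s t, - H <= s -> s <= t -> t <= 0 ->
  enorm (phi t - phi s) <= M * N * (t - s).

Let dl := H / p%:R.
Let th k := - H + k%:R * dl.

Let dl_gt0 : 0 < dl. Proof. by rewrite divr_gt0// ltr0n. Qed.

Let Ldl_ge0 : 0 <= L * dl. Proof. exact: mulr_ge0 (ltW L_gt0) (ltW dl_gt0). Qed.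

Let th_p : th p = 0.
Proof. by rewrite /th /dl mulrC divfK ?pnatr_eq0 -?lt0n// addNr. Qed.

Let th_S k : th k.+1 = th k + dl.
Proof. by rewrite /th -addn1 natrD mulrDl mul1r addrA. Qed.

Let th_le k l : (k <= l)%N -> th k <= th l.
Proof. by move=> kl; rewrite lerD2l ler_wpM2r ?(ltW dl_gt0)// ler_nat. Qed.

Let th_ge k : - H <= th k.
Proof. by rewrite lerDl mulr_ge0// ltW. Qed.

Let interp (d : nat -> 'cV[R]_n) k s := \sum_(l < k) K (s - th l) *m d l.

(* The coefficients [d k] make the interpolant agree with [phi] at the nodes [th k], and
   their partial sums satisfy [S k.+1 <= (1 + L dl) S k + M N dl]. *)
Lemma interp_bound : exists d : nat -> 'cV[R]_n, forall s, - H <= s <= 0 ->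
  enorm (phi s - \sum_(l < p.+1) tail (d l) (H - l%:R * dl) s) <=
  dl * ((1 + L * dl) ^+ p.-1 * (L + M) * N).
Proof.
(* [K] vanishes on negative times and [K 0] is the identity, so the interpolation conditions are
   triangular: the coefficient at a node is the error that the earlier shifts leave there. *)
pose F k (d : nat -> 'cV[R]_n) : 'cV[R]_n := phi (th k) - interp d k (th k).
have hF k (f g : nat -> 'cV[R]_n) : (forall l, (l < k)%N -> f l = g l) -> F k f = F k g.
  by move=> fg; congr (_ - _); apply: eq_bigr => l _; rewrite fg.
have [d hd] := causal_recursion 0 hF.
exists d.
have node k : phi (th k) = interp d k.+1 (th k).
  by rewrite /interp big_ord_recr /= subrr K_0 mul1mx hd addrC subrK.
pose S k := \sum_(l < k.+1) enorm (d l).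
have S_ge0 k : 0 <= S k by apply: sumr_ge0 => l _; exact: enorm_ge0.
(* Between two nodes [phi] moves by at most [M N dl], and each shift already present by at most
   [L dl] times the norm of its coefficient. *)
have err k s : (k < p)%N -> th k <= s <= th k.+1 ->
    enorm (phi s - interp d k.+1 s) <= dl * (M * N + L * S k).
  move=> kp /andP[ks sk].
  have s0 : s <= 0 by rewrite -th_p; apply: le_trans sk (th_le kp).
  have -> : phi s - interp d k.+1 s = (phi s - phi (th k)) + - (interp d k.+1 s - interp d k.+1 (th k)).
    by rewrite opprB -node addrA subrK.
  apply: le_trans (enormD _ _) _; rewrite mulrDr enormN.
  have sd : s - th k <= dl by move: sk; rewrite th_S; lra.
  apply: lerD.
    apply: le_trans (phi_lip (th_ge k) ks s0) _.
    by rewrite [leRHS]mulrC ler_wpM2l// mulr_ge0// M1_ge0.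
  rewrite /interp -sumrB; apply: le_trans (enorm_sum _ _) _.
  rewrite /S !mulr_sumr; apply: ler_sum => l _.
  have lk : th l <= th k by apply: th_le; rewrite -ltnS.
  apply: le_trans (K_lip _ _ _ _) _; [by lra|by lra|by have := th_ge l; lra|].
  rewrite mulrA ler_wpM2r ?enorm_ge0// mulrC ler_wpM2r ?(ltW L_gt0)//.
  by move: sd; lra.
have grow k : (k <= p)%N -> L * S k + M * N <= (1 + L * dl) ^+ k * (L + M) * N.
  elim: k => [_|k IH kp].
    rewrite expr0 mul1r (mulrDl L M N) lerD2r ler_wpM2l ?(ltW L_gt0)//.
    rewrite /S big_ord1 hd /F /interp big_ord0 subr0 phi_le// th_ge -th_p.
    exact: th_le.
  have {}IH := IH (ltnW kp).
  have hk : th k <= th k.+1 <= th k.+1 by rewrite lexx andbT th_le.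
  have := err k (th k.+1) kp hk; rewrite -[phi _ - _]/(F _ _) -hd => dk.
  have -> : S k.+1 = S k + enorm (d k.+1) by rewrite /S big_ord_recr.
  apply: (@le_trans _ _ ((1 + L * dl) * (L * S k + M * N))); last first.
    by rewrite exprS -!mulrA ler_wpM2l ?addr_ge0 ?ler01 ?Ldl_ge0// mulrA.
  have := ler_wpM2l (ltW L_gt0) dk; move: (enorm _) (S k) (M * N) => e Sk Q.
  by lra.
(* The last subinterval starts at node [p - 1], whence the exponent. *)
have cst k : (k < p)%N -> dl * (M * N + L * S k) <= dl * ((1 + L * dl) ^+ p.-1 * (L + M) * N).
  move=> kp; rewrite ler_wpM2l ?(ltW dl_gt0)// addrC; apply: le_trans (grow k (ltnW kp)) _.
  rewrite -!mulrA (ler_wpM2r (mulr_ge0 (addr_ge0 (ltW L_gt0) M1_ge0) N_ge0))//.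
  rewrite ler_weXn2l ?lerDl ?Ldl_ge0//.
  by rewrite -ltnS prednK.
have tailE s l : tail (d l) (H - l%:R * dl) s = K (s - th l) *m d l.
  by rewrite /tail /th; congr (K _ *m _); ring.
move=> s /andP[s1 s0]; under eq_bigr do rewrite tailE.
(* At [s = 0], the last node, the interpolant is exact. Any other [s] lies in a half-open
   subinterval of index [k < p]. *)
move: s0; rewrite le_eqVlt => /predU1P[->|s0].
  have e := node p; rewrite th_p /interp in e.
  rewrite -e subrr enorm0; apply: le_trans (cst 0%N p_gt0).
  by rewrite mulr_ge0 ?(ltW dl_gt0) ?addr_ge0 ?mulr_ge0 ?M1_ge0 ?(ltW L_gt0).
have q0 : 0 <= (s + H) / dl by rewrite divr_ge0 ?(ltW dl_gt0)// -lerBlDr sub0r.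
have /andP[k1 k2] := truncn_itv q0; set k := Num.truncn _ in k1 k2.
have ks : th k <= s by move: k1; rewrite ler_pdivlMr// /th; lra.
have sk : s < th k.+1 by move: k2; rewrite ltr_pdivrMr// /th; lra.
have kp : (k < p)%N.
  by rewrite ltnNge; apply/negP => pk; have := th_le pk; rewrite th_p; lra.
suff -> : \sum_(l < p.+1) K (s - th l) *m d l = interp d k.+1 s.
  by apply: le_trans (err k s kp _) (cst k kp); rewrite ks ltW.
apply: (@big_ord_trunc _ (fun l => K (s - th l) *m d l)) => [|l kl]; first exact: ltnW.
by rewrite K_neg ?mul0mx// subr_lt0; apply: lt_le_trans sk (th_le kl).
Qed.

(** Since [p + L H = p (1 + L dl)] and [p dl = H], the left side is [(1 + L dl)^p H], and
    [1 + x <= exp x]. The summand [L H] is the origin of the subtracted [L H] in [rhat]. *)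
Lemma interp_error_le : dl * (1 + L * dl) ^+ p.-1 * (p%:R + L * H) <= expR (L * H) * H.
Proof.
have p0 : (0 : R) < p%:R by rewrite ltr0n.
have -> : dl * (1 + L * dl) ^+ p.-1 * (p%:R + L * H) = (1 + L * dl) ^+ p * H.
  rewrite -(prednK p_gt0) exprS prednK// /dl; field.
  by rewrite gt_eqF.
rewrite ler_wpM2r ?(ltW H_gt0)//.
have -> : L * H = p%:R * (L * dl) by rewrite /dl; field; rewrite gt_eqF.
rewrite expRM_natl lerXn2r ?nnegrE ?expR_ge0 ?expR_ge1Dx//.
by rewrite addr_ge0 ?ler01 ?Ldl_ge0.
Qed.

End Interpolation.

Lemma v1_0l y : mlbm y -> v1 (fun=> 0) y = 0.
Proof.
move=> by_; have b0 := mlbm_cst (0 : 'cV[R]_n).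
have := v1Dl b0 b0 by_; rewrite [in X in v1 X _](_ : (fun s : R => (0 : 'cV[R]_n) + 0) = fun=> 0).
  by lra.
by apply/funext => s; rewrite addr0.
Qed.

Lemma v1_0r x : mlbm x -> v1 x (fun=> 0) = 0.
Proof.
move=> bx; have b0 := mlbm_cst (0 : 'cV[R]_n).
have := v1Dr bx b0 b0; rewrite [in X in v1 _ X](_ : (fun s : R => (0 : 'cV[R]_n) + 0) = fun=> 0).
  by lra.
by apply/funext => s; rewrite addr0.
Qed.

Lemma v1_suml (I : Type) (r : seq I) (F : I -> R -> 'cV[R]_n) y : (forall i, mlbm (F i)) ->
  mlbm y -> v1 (fun s => \sum_(i <- r) F i s) y = \sum_(i <- r) v1 (F i) y.
Proof.
move=> bF by_; elim: r => [|i r IH].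
  rewrite big_nil -[RHS](v1_0l by_); congr (v1 _ _).
  by apply/funext => s; rewrite big_nil.
rewrite big_cons -IH -v1Dl//; last exact: mlbm_sum.
by congr (v1 _ _); apply/funext => s; rewrite big_cons.
Qed.

Lemma v1_sumr (I : Type) (r : seq I) (F : I -> R -> 'cV[R]_n) x : (forall i, mlbm (F i)) ->
  mlbm x -> v1 x (fun s => \sum_(i <- r) F i s) = \sum_(i <- r) v1 x (F i).
Proof.
move=> bF bx; elim: r => [|i r IH].
  rewrite big_nil -[RHS](v1_0r bx); congr (v1 _ _).
  by apply/funext => s; rewrite big_nil.
rewrite big_cons -IH -v1Dr//; last exact: mlbm_sum.
by congr (v1 _ _); apply/funext => s; rewrite big_cons.
Qed.

Lemma v1_tails r (c : 'I_r -> 'cV[R]_n) (a : 'I_r -> R) : (forall i, 0 <= a i <= H) ->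
  v1 (fun s => \sum_i tail (c i) (a i) s) (fun s => \sum_i tail (c i) (a i) s) =
  \sum_i \sum_j dot (c i) (U (a j - a i) *m c j).
Proof.
move=> aH; have bt i : mlbm (tail (c i) (a i)) by exact: tail_mlbm.
rewrite v1_sumr//; last exact: mlbm_sum.
apply: eq_bigr => i _; rewrite v1_suml//; apply: eq_bigr => j _.
by rewrite v1_tail//; case/andP: (aH i).
Qed.

Lemma v1_tails_ge0 p (c : 'I_p.+1 -> 'cV[R]_n) : posdefmx (lyap_block_mx H U p.+1) ->
  0 <= v1 (fun s => \sum_(i < p.+1) tail (c i) (i%:R * (H / p%:R)) s)
          (fun s => \sum_(i < p.+1) tail (c i) (i%:R * (H / p%:R)) s).
Proof.
move=> [_ Kpos]; rewrite v1_tails => [|i]; last first.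
  have d0 : 0 <= H / p%:R by rewrite divr_ge0 ?ler0n// ltW.
  rewrite mulr_ge0//=; case: (posnP p) => [p0|p0].
    have -> : p%:R = 0 :> R by rewrite p0.
    by rewrite invr0 !mulr0 ltW.
  have p0' : (0 : R) < p%:R by rewrite ltr0n.
  by rewrite mulrCA ger_pMr// ler_pdivrMr// mul1r ler_nat -ltnS.
have -> : \sum_(i < p.+1) \sum_(j < p.+1) dot (c i) (U (j%:R * (H / p%:R) - i%:R * (H / p%:R)) *m c j) =
   ((\mxcol_i c i)^T *m lyap_block_mx H U p.+1 *m (\mxcol_i c i)) 0 0.
  rewrite /lyap_block_mx qform_mxblock; apply: eq_bigr => i _; apply: eq_bigr => j _.
  by rewrite -mulrBl -natr1 addrK mulrA mulrAC.
case: (eqVneq (\mxcol_i c i) 0) => [->|/Kpos/ltW//].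
by rewrite mulmx0 mxE.
Qed.

(** * From positivity of the block matrix to stability *)

Variable b1 : R.
Hypotheses (n_gt0 : (0 < n)%N) (M_gt0 : 0 < M) (W_pos : posdefmx W).
Hypothesis b1_itv : 0 < b1 < pi / 2.

Notation lmin := (lambda_min W).
Notation a1 := (alpha1 A H G W b1).
Notation a2 := (alpha2 A h H G W U).

Lemma lambda_min_gt0 : 0 < lmin. Proof. by case: (lambda_min_spec n_gt0 W_pos). Qed.

Lemma lambda_min_le w : lmin * dot w w <= dot w (W *m w).
Proof. by case: (lambda_min_spec n_gt0 W_pos) => _; exact. Qed.

Lemma alpha1_gt0 : 0 < a1.
Proof.
rewrite /alpha1; apply: mulr_gt0; last first.
  apply: exprn_gt0; apply: cos_gt0_pihalf; case/andP: b1_itv => b10 ->; rewrite andbT.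
  by apply: lt_trans b10; rewrite oppr_lt0 divr_gt0 ?pi_gt0.
by rewrite mulr_gt0 ?expR_gt0// divr_gt0 ?lambda_min_gt0// mulr_gt0.
Qed.

(** The form in which [alpha1] meets the energy: over a time [H] a solution grows by a factor of at
    most [exp (M H)], which is squared in the quadratic bound. *)
Lemma alpha1_le : a1 * expR (2 * (M * H)) <= lmin / (4 * M).
Proof.
have q0 : 0 <= lmin / (4 * M) by rewrite divr_ge0 ?mulr_ge0 ?(ltW lambda_min_gt0) ?(ltW M_gt0).
have c1 : cos b1 ^+ 2 <= 1 by rewrite -(cos2Dsin2 b1) lerDl sqr_ge0.
rewrite /alpha1 mulrAC -(mulrA (lmin / _)) -expRD.
rewrite (_ : - 2 * M * H + 2 * (M * H) = 0); last by ring.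
by rewrite expR0 mulr1 ler_piMr.
Qed.

Lemma alpha2_ge0 : 0 <= a2.
Proof.
have N0 : 0 <= N1 A h.
  by apply: sumr_ge0 => j _; rewrite mulr_ge0 ?opnorm_ge0//; case/andP: (h_itv j).
have H0 := ltW H_gt0.
rewrite /alpha2 addr_ge0 ?mulr_ge0 ?opnorm_ge0//.
rewrite addr_ge0// ?mulr_ge0 ?exprn_ge0 ?invr_ge0 ?bG_ge0 ?nu_ge0//.
by rewrite addr_ge0// ?mulr_ge0 ?exprn_ge0 ?invr_ge0 ?bG_ge0 ?nu_ge0 ?addr_ge0.
Qed.

(* [1 / (a + sqrt (a (a + 1)))] is the positive root of [a (2 e + e^2) = 1]. *)
Lemma error_quadratic (a e : R) : 0 <= a -> 0 <= e -> e * (a + Num.sqrt (a * (a + 1))) <= 1 ->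
  a * (2 * e + e ^+ 2) <= 1.
Proof.
move=> a0 e0 h1; have q0 : 0 <= a * (a + 1) by rewrite mulr_ge0 ?addr_ge0.
have s0 := sqrtr_ge0 (a * (a + 1)); have s2 := sqr_sqrtr q0.
move: (Num.sqrt _) s0 s2 h1 => q qq0 q2 h1.
have l : e * q <= 1 - e * a by lra.
have := lerXn2r 2 (mulr_ge0 e0 qq0) (le_trans (mulr_ge0 e0 qq0) l) l.
rewrite exprMn q2; lra.
Qed.

Lemma v1_lower phi N p : mlbm phi -> 0 <= N ->
  (forall s, - H <= s <= 0 -> enorm (phi s) <= N) ->
  (forall s t, - H <= s -> s <= t -> t <= 0 -> enorm (phi t - phi s) <= M * N * (t - s)) ->
  posdefmx (lyap_block_mx H U p.+1) ->
  expR (L * H) * H * (M + L) * (a2 / a1 + Num.sqrt (a2 / a1 * (a2 / a1 + 1))) - L * H <= p%:R ->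
  - (a1 * N ^+ 2) <= v1 phi phi.
Proof.
move=> bphi N0 phiN phiL Kpos hp.
set kap := _ + Num.sqrt _ in hp.
have r0 : 0 <= a2 / a1 by rewrite divr_ge0 ?alpha2_ge0 ?(ltW alpha1_gt0).
have kap0 : 0 <= kap by rewrite addr_ge0// sqrtr_ge0.
have LH0 : 0 < L * H by rewrite mulr_gt0.
have ML := addr_gt0 M_gt0 L_gt0; have LM := addr_gt0 L_gt0 M_gt0.
have [e [c [e0 ek he]]] : exists e : R, exists c : 'I_p.+1 -> 'cV[R]_n,
    [/\ 0 <= e, e * kap <= 1 & forall s, - H <= s <= 0 ->
      enorm (phi s - \sum_(i < p.+1) tail (c i) (i%:R * (H / p%:R)) s) <= e * N].
  (* For [p = 0] the single shift equals [phi 0] at 0 and vanishes before, so the relative error is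
     1. This suffices, because the bound on [p] then forces [kap <= 1]. *)
  case: p Kpos hp => [_ hp|p _ hp].
    exists 1; exists (fun=> phi 0); split=> //.
      rewrite mul1r -(ler_pM2l LH0) mulr1.
      apply: le_trans (_ : expR (L * H) * H * (M + L) * kap <= _); last first.
        by move: hp; rewrite subr_le0.
      rewrite ler_wpM2r//.
      have e1 : 1 <= expR (L * H) by rewrite -expR0 ler_expR ltW.
      have l : L * H <= (M + L) * H by rewrite ler_wpM2r ?(ltW H_gt0)// lerDr ltW.
      apply: le_trans l _; rewrite -mulrA (mulrC H) ler_peMl//.
      exact: mulr_ge0 (ltW ML) (ltW H_gt0).
    move=> s /andP[s1 s0]; rewrite big_ord1 mul0r mul1r; move: s0; rewrite le_eqVlt => /predU1P[->|s0].
      by rewrite /tail addr0 K_0 mul1mx subrr enorm0.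
    rewrite (_ : tail (phi 0) 0 s = 0); last by apply: tail_neg; rewrite oppr0.
    by rewrite subr0 phiN// s1 ltW.
  have p0 : (0 < p.+1)%N by [].
  have [d hd] := interp_bound N0 p0 phiN phiL.
  (* The indices are reversed: nodes are counted from [- H], shifts from 0. *)
  exists (H / p.+1%:R * (1 + L * (H / p.+1%:R)) ^+ p * (L + M)), (fun i => d (p.+1 - i)%N).
  have dl0 : 0 <= H / p.+1%:R by rewrite divr_ge0 ?ler0n// ltW.
  have q0 : 0 <= H / p.+1%:R * (1 + L * (H / p.+1%:R)) ^+ p.
    by rewrite mulr_ge0// exprn_ge0// addr_ge0// mulr_ge0// ltW.
  split; first exact: mulr_ge0 q0 (ltW LM).
    have D0 : 0 < expR (L * H) * H * (M + L) by rewrite mulr_gt0// mulr_gt0 ?expR_gt0.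
    rewrite -(ler_pM2l D0) mulr1.
    have := interp_error_le p0; rewrite -pred_Sn => he.
    apply: le_trans (_ : H / p.+1%:R * (1 + L * (H / p.+1%:R)) ^+ p * (L + M) * (p.+1%:R + L * H) <= _).
      rewrite mulrCA ler_wpM2l ?(mulr_ge0 q0 (ltW LM))//.
      by move: hp; rewrite lerBlDr.
    by rewrite mulrAC (addrC L) ler_wpM2r ?(ltW ML).
  move=> s sH; have := hd s sH; rewrite -!mulrA; set S := \sum_(l < _) _; set S' := \sum_(l < _) _.
  suff -> : S' = S by [].
  rewrite /S' /S (reindex_inj rev_ord_inj) /=; apply: eq_bigr => i _.
  rewrite subSS; have ip : (i <= p.+1)%N by rewrite -ltnS.
  rewrite subKn//; congr (tail _ _ _).
  have pn : (p.+1%:R : R) != 0 by rewrite pnatr_eq0.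
  by rewrite natrB//; move: (p.+1%:R) pn => P P0; field.
set psi := (fun s => \sum_(i < p.+1) tail (c i) (i%:R * (H / p%:R)) s) in he.
have bpsi : mlbm psi by apply: mlbm_sum => i; exact: tail_mlbm.
pose er s := phi s - psi s; have ber : mlbm er by exact: mlbmB.
have phiE : (fun s => psi s + er s) = phi by apply/funext => s; rewrite addrC subrK.
(* The corrections involve [phi] and [er] only, which are bounded by [N] and [e N]; together they
   are at most [alpha2 (2 e + e^2) N^2]. *)
have E : v1 phi phi = v1 psi psi + v1 phi er - v1 er er + v1 er phi.
  have E1 := v1Dl bpsi ber bphi; have E2 := v1Dr bpsi bpsi ber; have E3 := v1Dl bpsi ber ber.
  by rewrite phiE in E1 E2 E3; rewrite E1 E2 E3; ring.
have eN0 : 0 <= e * N by rewrite mulr_ge0.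
have := v1_bound bphi ber N0 eN0 phiN he; have := v1_bound ber ber eN0 eN0 he he.
have := v1_bound ber bphi eN0 N0 he phiN; rewrite !ler_norml.
move=> /andP[h1 _] /andP[_ h2] /andP[h3 _].
have h4 := v1_tails_ge0 c Kpos; rewrite -/psi in h4.
have h5 : a2 * (2 * e + e ^+ 2) <= a1.
  have := error_quadratic r0 e0 ek.
  by rewrite -mulrA mulrCA mulrC ler_pdivrMr ?alpha1_gt0// mul1r mulrC.
have h6 : a2 * (2 * e + e ^+ 2) * N ^+ 2 <= a1 * N ^+ 2 by rewrite ler_wpM2r ?sqr_ge0.
by rewrite E; move: h1 h2 h3 h4 h6; lra.
Qed.

Variable p : nat.
Hypothesis K_pos : posdefmx (lyap_block_mx H U p.+1).
Hypothesis p_ge : expR (L * H) * H * (M + L) *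
  (a2 / a1 + Num.sqrt (a2 / a1 * (a2 / a1 + 1))) - L * H <= p%:R.

Let K_out (g : 'cV[R]_n) u : u < 0 -> K u *m g = 0. Proof. by move=> u0; rewrite K_neg ?mul0mx. Qed.

(** [v1_lower] is applied to the state at time [t + H]. That state consists of values at times from
    [t >= 0] on, where the equation provides its Lipschitz constant, and its energy integral extends
    over [[0, t]]. *)
Lemma state_energy g t N : 0 <= t -> 0 <= N ->
  (forall u, u <= t + H -> enorm (K u *m g) <= N) ->
  Int (fun s => ico 0 t s * dot (K s *m g) (W *m (K s *m g))) <=
  dot g (U 0 *m g) + a1 * N ^+ 2.
Proof.
move=> t0 N0 xN; have Ht : H <= t + H by rewrite lerDr.
have := v1_lower (tail_mlbm g (t + H)) N0 _ _ K_pos p_ge.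
rewrite (v1_state g Ht) addrK => h1.
suff : - (a1 * N ^+ 2) <= dot g (U 0 *m g) -
  Int (fun s => ico 0 t s * dot (K s *m g) (W *m (K s *m g))) by lra.
apply: h1 => [s /andP[s1 s0]|s s' s1 ss' s0]; first by apply: xN; lra.
have t1 : 0 <= s + (t + H) by lra.
have t2 : s + (t + H) <= s' + (t + H) by lra.
have := traj_lip (K_left g) t1 t2 N0; rewrite opprD addrACA subrr addr0; apply.
by move=> u /andP[_ us]; apply: xN; lra.
Qed.

Let bK (g : 'cV[R]_n) : mlbm (fun s => K s *m g). Proof. by case: (K_left g). Qed.

Lemma energy_ge g t : lmin * Int (fun s => ico 0 t s * dot (K s *m g) (K s *m g)) <=
  Int (fun s => ico 0 t s * dot (K s *m g) (W *m (K s *m g))).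
Proof.
have b1' := lbm_dot (bK g) (bK g); have b2' := lbm_dotW (bK g) (bK g).
rewrite -IntZ; last exact: L1_ico_lbm.
apply: le_Int; [by apply: L1Z; exact: L1_ico_lbm|exact: L1_ico_lbm|move=> s].
by rewrite mulrCA ler_wpM2l ?ico_ge0 ?lambda_min_le.
Qed.

(* Where [|x|] attains its maximum [a] on [0, t], the energy is at least
   [lmin a^2 / (3 M)], whereas [alpha1] is such that the bound of [state_energy] grows by
   at most [lmin a^2 / (4 M)]. *)
Lemma K_bounded g : exists2 B : R, 0 <= B & forall t, enorm (K t *m g) <= B.
Proof.
set c := dot g (U 0 *m g).
have B0 : 0 <= expR 1 * enorm g + Num.sqrt (12 * M * `|c| / lmin).
  by rewrite addr_ge0 ?sqrtr_ge0 ?mulr_ge0 ?expR_ge0 ?enorm_ge0.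
exists (expR 1 * enorm g + Num.sqrt (12 * M * `|c| / lmin)) => // t.
case: (ltP t 0) => t0; first by rewrite K_out// enorm0.
have tK := K_left g.
have [t' t't hmax] : exists2 t', t' \in `[0, t] & forall s, s \in `[0, t] ->
    enorm (K s *m g) <= enorm (K t' *m g).
  apply: EVT_max => //; apply: within_enorm => i; exact: (traj_within tK).
move: t't; rewrite in_itv /= => /andP[t'0 t't]; set a := enorm (K t' *m g).
have a_max u : u <= t -> enorm (K u *m g) <= a.
  move=> ut; case: (ltP u 0) => u0; first by rewrite K_out// enorm0 enorm_ge0.
  by apply: hmax; rewrite in_itv /= u0.
apply: le_trans (a_max t (lexx t)) _.
have a0 : 0 <= a by exact: enorm_ge0.
(* A maximum before time [1 / M] leaves no room for a ramp of that length, but there the growth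
   estimate gives the factor [exp 1]. *)
case: (ltP t' M^-1) => t'M.
  apply: ler_wpDr; first exact: sqrtr_ge0.
  have g0 u : 0 - H <= u <= 0 -> enorm (K u *m g) <= enorm g.
    move=> /andP[_]; rewrite le_eqVlt => /predU1P[->|u0]; first by rewrite K_0 mul1mx.
    by rewrite K_out// enorm0 enorm_ge0.
  apply: le_trans (gronwall tK (enorm_ge0 g) g0 t'0) _; rewrite mulrC ler_wpM2r ?enorm_ge0//.
  rewrite ler_expR subr0; apply: le_trans (ler_wpM2l (ltW M_gt0) (ltW t'M)) _.
  by rewrite divff// gt_eqF.
apply: ler_wpDl; first by rewrite mulr_ge0 ?expR_ge0 ?enorm_ge0.
(* The state at [t + H] reaches past [t], where the maximum is [a]; the growth over a time [H]
   bounds it there. *)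
pose N := a * expR (M * H).
have N0 : 0 <= N by rewrite mulr_ge0 ?expR_ge0.
have aN : a <= N.
  by rewrite -[leLHS]mulr1 ler_wpM2l// -expR0 ler_expR mulr_ge0 ?(ltW M_gt0) ?(ltW H_gt0).
have xN u : u <= t + H -> enorm (K u *m g) <= N.
  move=> uH; case: (leP u t) => ut; first exact: le_trans (a_max u ut) aN.
  have tK' := traj_sub t0 tK.
  apply: le_trans (gronwall tK' a0 _ (ltW ut)) _; first by move=> w /andP[_ wt]; exact: a_max.
  rewrite ler_wpM2l// ler_expR ler_wpM2l ?(ltW M_gt0)//; lra.
have h1 := state_energy t0 N0 xN; have h2 := energy_ge g t; rewrite -/c in h1.
have Mi0 : 0 < M^-1 by rewrite invr_gt0.
have h3 : a ^+ 2 * M^-1 / 3 <= Int (fun s => ico (t' - M^-1) t' s * dot (K s *m g) (K s *m g)).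
  apply: (sq_ramp_lower (bK g) a0 Mi0) => s /andP[s1 s2].
  have s0 : 0 <= s by move: s1 t'M; lra.
  rewrite invrK; have hl : enorm (K t' *m g - K s *m g) <= M * a * (t' - s).
    by apply: (traj_lip tK s0 s2 a0) => u /andP[_ ut']; apply: a_max; apply: le_trans ut' t't.
  have tri : a <= enorm (K t' *m g - K s *m g) + enorm (K s *m g).
    by rewrite /a -{1}(subrK (K s *m g) (K t' *m g)); exact: enormD.
  by move: hl tri; lra.
have t'M0 : 0 <= t' - M^-1 by rewrite subr_ge0.
have h4 := Int_ico_sub (lbm_dot (bK g) (bK g)) (fun s => dot_ge0 (K s *m g)) t'M0 t't.
have h5 : lmin * (a ^+ 2 * M^-1 / 3) <= c + a1 * N ^+ 2.
  apply: le_trans h1; apply: le_trans h2; rewrite ler_wpM2l ?(ltW lambda_min_gt0)//.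
  exact: le_trans h3 h4.
have h6 : a1 * N ^+ 2 <= lmin / (4 * M) * a ^+ 2.
  rewrite /N exprMn -expRM_natl mulrCA mulrC ler_wpM2r ?sqr_ge0//; exact: alpha1_le.
(* The gap [1/3 - 1/4 = 1/12] between the two energy bounds. *)
have h7 : a ^+ 2 <= 12 * M * `|c| / lmin.
  rewrite ler_pdivlMr ?lambda_min_gt0//.
  have h8 : lmin * (a ^+ 2 * M^-1 / 3) <= c + lmin / (4 * M) * a ^+ 2 by lra.
  have h9 := ler_wpM2l (ltW M_gt0) h8.
  have e1 : M * (lmin * (a ^+ 2 * M^-1 / 3)) = lmin * a ^+ 2 / 3 by field; rewrite gt_eqF.
  have e2 : M * (c + lmin / (4 * M) * a ^+ 2) = M * c + lmin * a ^+ 2 / 4 by field; rewrite gt_eqF.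
  rewrite e1 e2 in h9.
  have h10 := ler_wpM2l (ltW M_gt0) (ler_norm c).
  by move: h9 h10; rewrite -mulrA; lra.
by rewrite -(ger0_norm a0) -sqrtr_sqr ler_wsqrtr.
Qed.

(** Boundedness of [K] makes the energy integral converge, so it grows by less than [e^2 l / 3]
    after some [T0]. A norm above [e] at a time after [T0 + l] would cost at least that much on the
    preceding interval of length [l]. *)
Lemma K_decay_col g (e : R) : 0 < e -> exists T, forall t, T <= t -> enorm (K t *m g) <= e.
Proof.
move=> e0; have [B0 B00 hB0] := K_bounded g.
pose B := B0 + 1; have Bp : 0 < B by rewrite ltr_wpDl.
have hB t : enorm (K t *m g) <= B by apply: le_trans (hB0 t) _; rewrite lerDl.
pose F t := Int (fun s => ico 0 t s * dot (K s *m g) (K s *m g)).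
have bf := lbm_dot (bK g) (bK g).
have f0 s : 0 <= dot (K s *m g) (K s *m g) by exact: dot_ge0.
have hF t : 0 <= t -> F t <= (dot g (U 0 *m g) + a1 * B ^+ 2) / lmin.
  move=> t0; rewrite ler_pdivlMr ?lambda_min_gt0// mulrC; apply: le_trans (energy_ge g t) _.
  exact: state_energy t0 (ltW Bp) (fun u _ => hB u).
pose S := [set F t | t in [set t | 0 <= t]].
have hs : has_sup S.
  split; first by exists (F 0), 0 => //=.
  by exists ((dot g (U 0 *m g) + a1 * B ^+ 2) / lmin) => _ [t t0 <-]; exact: hF.
pose l := e / (M * B); have l0 : 0 < l by rewrite divr_gt0 ?mulr_gt0.
have d0 : 0 < e ^+ 2 * l / 3 by rewrite divr_gt0// mulr_gt0// exprn_gt0.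
have [_ [T0 /= T00 <-] hT0] := sup_adherent d0 hs.
exists (T0 + l) => t Tt; rewrite leNgt; apply/negP => et.
have t0 : 0 <= t by move: T00 l0 Tt; lra.
have h1 : F t <= sup S by apply: ub_le_sup; [case: hs|exists t].
have h2 : e ^+ 2 * l / 3 <= Int (fun s => ico (t - l) t s * dot (K s *m g) (K s *m g)).
  apply: (sq_ramp_lower (bK g) (ltW e0) l0) => s /andP[s1 s2].
  have s0 : 0 <= s by move: s1 Tt T00; lra.
  have hl := traj_lip (K_left g) s0 s2 (ltW Bp) (fun u _ => hB u).
  have tri : enorm (K t *m g) <= enorm (K t *m g - K s *m g) + enorm (K s *m g).
    by rewrite -{1}(subrK (K s *m g) (K t *m g)); exact: enormD.
  have -> : e * (1 - (t - s) / l) = e - M * B * (t - s).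
    rewrite /l; field; by rewrite !gt_eqF.
  by move: hl tri et; lra.
have h3 : Int (fun s => ico (t - l) t s * dot (K s *m g) (K s *m g)) <=
    Int (fun s => ico T0 t s * dot (K s *m g) (K s *m g)).
  by apply: Int_ico_sub => //; move: Tt; lra.
have T0t : 0 <= T0 <= t by rewrite T00; move: Tt l0; lra.
have := Int_ico_split T0t bf; rewrite -/(F t) -/(F T0) => h4.
by move: h1 h2 h3 h4 hT0; lra.
Qed.

Lemma K_decay (e : R) : 0 < e -> exists T, forall t, T <= t -> forall v, enorm (K t *m v) <= e * enorm v.
Proof.
move=> e0; have n0 : (0 : R) < n%:R by rewrite ltr0n.
have en : 0 < e / n%:R by rewrite divr_gt0.
have /choice[T hT] : forall i : 'I_n, exists T, forall t, T <= t ->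
  enorm (K t *m delta_mx i 0) <= e / n%:R by move=> i; exact: K_decay_col.
exists (\sum_i `|T i|) => t Tt v.
have tT i : T i <= t.
  apply: le_trans Tt; apply: le_trans (ler_norm _) _; rewrite (bigD1 i)//= lerDl.
  by apply: sumr_ge0.
have -> : K t *m v = \sum_i v i 0 *: (K t *m delta_mx i 0).
  rewrite {1}[v]matrix_sum_delta mulmx_sumr; apply: eq_bigr => i _.
  by rewrite big_ord1 -scalemxAr.
apply: le_trans (enorm_sum _ _) _.
have -> : e * enorm v = \sum_(i < n) enorm v * (e / n%:R).
  rewrite sumr_const card_ord -[RHS]mulr_natr; field; by rewrite gt_eqF.
apply: ler_sum => i _; rewrite enormZ ler_pM ?enorm_ge0 ?coord_le_enorm//.
exact: hT.
Qed.

(** In the variation of constants formula the weights of the initial state add up to at most [mass],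
    so it is enough that [K] be below [1 / (2 mass)] from time [T - H] on. *)
Lemma half_life : exists2 T, 0 < T & forall x C, traj 0 x -> 0 <= C ->
  (forall u, - H <= u <= 0 -> enorm (x u) <= C) -> forall t, T <= t -> enorm (x t) <= C / 2.
Proof.
have m0 : 0 < mass by rewrite -Int_rmass ltr_pwDl//; apply: Int_ge0 => t; exact: rmass_ge0.
pose e := (2 * mass)^-1; have e0 : 0 < e by rewrite invr_gt0 mulr_gt0.
have [T0 hT0] := K_decay e0; exists (`|T0| + H); first by rewrite ltr_wpDl.
move=> x C tx C0 xC t Tt; have [bx _] := tx; have := ler_norm T0 => T0n.
have t0 : 0 <= t by apply: le_trans Tt; rewrite addr_ge0// ltW.
have -> : C / 2 = e * C + e * C * (N1 A h + bg * H ^+ 2 / 2).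
  rewrite -[X in X + _]mulr1 -mulrDr /e; move: mass m0 => q q0; field.
  by rewrite gt_eqF.
rewrite (cauchy tx t0); apply: le_trans (enormD _ _) _; apply: lerD.
  apply: le_trans (hT0 _ _ _) _; first by move: H_gt0 Tt; lra.
  by rewrite ler_wpM2l ?(ltW e0)// xC// lexx oppr_le0 ltW.
rewrite -Int_rmass -IntZ; last exact: L1_rmass.
have bKt := mlbm_refl t mlbm_K.
apply: (enorm_MInt (mL1_icc 0 H (mlbmM bKt (mlbm_rho bx)))); first by apply: L1Z; exact: L1_rmass.
move=> u; rewrite /icc; case: (boolP (0 <= u <= H)) => uH; last first.
  by rewrite scale0r enorm0 mulr_ge0 ?rmass_ge0// mulr_ge0// ltW.
rewrite scale1r -mulrA; apply: le_trans (hT0 _ _ _) _.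
  by case/andP: uH; move: Tt; lra.
by rewrite ler_wpM2l ?(ltW e0)//; exact: rho_norm.
Qed.

(** A period [T1 = T + H] halves the whole state, whose length is [H]. The growth estimate covers
    the rest of a period, and the factor 2 in the constant compensates for rounding [t / T1]
    down. *)
Lemma exponential_decay : exists2 gs : R * R, 1 <= gs.1 /\ 0 < gs.2 & forall x C, traj 0 x ->
  0 <= C -> (forall u, - H <= u <= 0 -> enorm (x u) <= C) ->
  forall t, 0 <= t -> enorm (x t) <= gs.1 * expR (- gs.2 * t) * C.
Proof.
have [T T0 hT] := half_life; pose T1 := T + H; have T10 : 0 < T1 by rewrite addr_gt0.
exists (2 * expR (M * T1), ln 2 / T1) => /=.
  split; last by rewrite divr_gt0// ln_gt0// ltr1n.
  rewrite -[leLHS]mulr1 ler_pM ?ler1n// -expR0 ler_expR mulr_ge0 ?(ltW M_gt0) ?(ltW T10)//.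
move=> x C tx C0 xC t t0.
have tk k : traj 0 (fun s => x (s + k%:R * T1)).
  by apply: traj_shift; rewrite add0r; apply: traj_sub tx; rewrite mulr_ge0// ltW.
have Ck k : 0 <= C / 2 ^+ k by rewrite divr_ge0// exprn_ge0.
have hk k : forall u, - H <= u <= 0 -> enorm (x (u + k%:R * T1)) <= C / 2 ^+ k.
  elim: k => [|k IH] u uH; first by rewrite mul0r addr0 expr0 divr1; exact: xC.
  have -> : u + k.+1%:R * T1 = u + T1 + k%:R * T1 by rewrite -natr1; ring.
  rewrite exprSr invfM mulrA; apply: (hT _ _ (tk k) (Ck k) IH).
  by rewrite /T1; move: uH; lra.
have q0 : 0 <= t / T1 by rewrite divr_ge0// ltW.
have /andP[k1 k2] := truncn_itv q0; set k := Num.truncn _ in k1 k2.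
have kt : k%:R * T1 <= t by move: k1; rewrite ler_pdivlMr.
have tS : t <= k.+1%:R * T1 by move: k2; rewrite ltr_pdivrMr// => /ltW.
set tt := t - k%:R * T1.
have tt0 : 0 <= tt by rewrite subr_ge0.
have hk' u : 0 - H <= u <= 0 -> enorm (x (u + k%:R * T1)) <= C / 2 ^+ k by rewrite sub0r; exact: hk.
have := gronwall (tk k) (Ck k) hk' tt0; rewrite {1}/tt subrK => hx.
apply: le_trans hx _; rewrite subr0.
have e1 : expR (M * tt) <= expR (M * T1).
  rewrite ler_expR ler_wpM2l ?(ltW M_gt0)// /tt lerBlDl.
  by move: tS; rewrite -natr1 mulrDl mul1r.
have e2 : (2 ^+ k)^-1 <= 2 * expR (- (ln 2 / T1) * t).
  have -> : (2 ^+ k)^-1 = 2 * expR (- (ln 2 / T1) * (k.+1%:R * T1)) :> R.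
    have -> : - (ln 2 / T1) * (k.+1%:R * T1) = - (k.+1%:R * ln 2) :> R by field; rewrite gt_eqF.
    rewrite expRN expRM_natl lnK ?posrE// exprS invfM mulrA divff ?mul1r//.
  by rewrite ler_wpM2l// ler_expR !mulNr lerN2 ler_wpM2l// divr_ge0 ?ln_ge0 ?ler1n// ltW.
rewrite -mulrA [leRHS]mulrC ler_wpM2l//.
rewrite (mulrC 2) -mulrA mulrC ler_pM ?expR_ge0 ?invr_ge0 ?exprn_ge0//.
Qed.

(** [is_solution] says nothing about [x] before [- H], and [phi] is constrained on [[- H, 0]] only.
    Setting the function to 0 before [- H] makes it measurable on the line. *)
Lemma solution_traj phi x : piecewise_continuous (- H) 0 phi -> is_solution A h H G phi x ->
  exists y, [/\ traj 0 y, forall t, 0 <= t -> y t = x t & forall t, - H <= t <= 0 -> y t = phi t].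
Proof.
move=> pc [xphi cx [s hs]]; pose x0 t := (0 <= t)%R%:R *: x t.
pose y t := (t < 0)%R%:R *: (icc (- H) 0 t *: phi t) + x0 t.
have y_ge0 t : 0 <= t -> y t = x t.
  by move=> t0; rewrite /y /x0 t0 ltNge t0 scale0r add0r scale1r.
have y_phi t : - H <= t <= 0 -> y t = phi t.
  move=> tH; case: (ltP t 0) => t0; last first.
    rewrite y_ge0//; have t00 : t = 0 by apply/eqP; rewrite eq_le t0 andbT; case/andP: tH.
    by rewrite xphi.
  by rewrite /y /x0 t0 leNgt t0 /icc tH !scale1r scale0r addr0.
have cx' T i j : {within `[0, T], continuous (fun t => x0 t i j)}.
  have := within_entry (i := i) (j := j) cx => cxi.
  apply/within_itvP => t tT e e0.
  have /within_itvP/(_ t tT e e0)[d d0 hd] :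
      {within `[0, T], continuous (fun t => x t i j)}.
    by apply: continuous_subspaceW cxi => u /=; rewrite !in_itv/= andbT => /andP[].
  exists d => // u uT ut; rewrite /x0; case/andP: tT (tT) => t0 _ tT; case/andP: uT (uT) => u0 _ uT.
  by rewrite t0 u0 !scale1r; exact: hd.
have by_ : mlbm y.
  apply: mlbmD; first by apply: mlbmZ; [exact: lbm_lt|exact: pc_mlbm].
  by apply: causal_mlbm cx' _ => t t0; rewrite /x0 leNgt t0 scale0r.
have lop_y t : 0 <= t -> lop y t = lop x t.
  move=> t0; apply: eq_lop => u /andP[u1 _]; case: (leP 0 u) => u0; first exact: y_ge0.
  have uH : - H <= u <= 0 by rewrite (ltW u0) andbT; lra.
  by rewrite y_phi// xphi.
exists y; split=> //; split=> //; exists s => T.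
apply: (@pderm_eq_on _ _ _ _ _ _ x0).
  by move=> t /andP[t0 _]; rewrite y_ge0// /x0 t0 scale1r.
move=> i j; split; first exact: cx'.
move=> t /andP[t0 _] ts; have hd := is_derive_entry i j (hs t t0 ts).
rewrite lop_y ?(ltW t0)//.
apply: near_eq_is_derive hd.
exists t => //= u; rewrite /= => ut; rewrite /x0; have u0 : 0 <= u.
  by move: ut; rewrite ltr_norml; lra.
by rewrite u0 scale1r.
Qed.

Lemma positive_block_exp_stable : exp_stable A h H G.
Proof.
have [[gam sig] /= [g1 s0] hd] := exponential_decay.
exists gam, sig; split=> // phi x pc sol t t0.
have [y [ty yx yphi]] := solution_traj pc sol.
have [C _ hC] := mlbm_enorm_bounded (- H) 0 (pc_mlbm pc).
have sub u : - H <= u <= 0 -> enorm (phi u) <= supnorm H phi.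
  move=> uH; apply: ub_le_sup; last by exists u => //=; rewrite in_itv.
  exists C => _ [w /= + <-]; rewrite in_itv/= => wH; have := hC w wH.
  by rewrite /icc wH scale1r.
rewrite -yx//; apply: hd => //.
  by apply: le_trans (sub 0 _); [exact: enorm_ge0|rewrite lexx oppr_le0 ltW].
by move=> u uH; rewrite yphi//; exact: sub.
Qed.

End Functional.

(** * Stable systems *)

Section Spectrum.
Variables (a b : R) (u v : 'cV[R]_n).
Implicit Types (s : R).

(** With [d], the parts of [exp ((a + i b) s)]: as the system is real, a complex mode is treated as
    a pair of real solutions. *)
Let c s := expR (a * s) * cos (b * s).
Let d s := expR (a * s) * sin (b * s).

Let cD t s : c (t + s) = c t * c s - d t * d s.
Proof. by rewrite /c /d !mulrDr expRD cosD; ring. Qed.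

Let dD t s : d (t + s) = d t * c s + c t * d s.
Proof. by rewrite /c /d !mulrDr expRD sinD; ring. Qed.

Let derive_exp s : is_derive s 1 (fun r => expR (a * r)) (a * expR (a * s)).
Proof.
have h1 : is_derive s 1 (fun r : R => a * r) a by apply: is_derive_eq; rewrite /GRing.scale /= mulr1.
by have := is_derive1_comp (is_derive_expR (a * s)) h1; rewrite mulrC.
Qed.

Let derive_lin s : is_derive s 1 (fun r : R => b * r) b.
Proof. by apply: is_derive_eq; rewrite /GRing.scale /= mulr1. Qed.

Let derive_c s : is_derive s 1 c (a * c s - b * d s).
Proof.
have h1 := is_derive1_comp (is_derive_cos (b * s)) (derive_lin s).
have h2 := is_deriveM (derive_exp s) h1.
by apply: is_derive_eq h2 _; rewrite /c /d /GRing.scale /=; ring.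
Qed.

Let derive_d s : is_derive s 1 d (a * d s + b * c s).
Proof.
have h1 := is_derive1_comp (is_derive_sin (b * s)) (derive_lin s).
have h2 := is_deriveM (derive_exp s) h1.
by apply: is_derive_eq h2 _; rewrite /c /d /GRing.scale /=; ring.
Qed.

Let cont_of (f : R -> R) df : (forall s, is_derive s 1 f (df s)) -> continuous f.
Proof.
by move=> hf s; apply: differentiable_continuous; apply/derivable1_diffP; case: (hf s).
Qed.

Let lbm_c : lbm c. Proof. by apply: lbm_continuous; exact: cont_of derive_c. Qed.
Let lbm_d : lbm d. Proof. by apply: lbm_continuous; exact: cont_of derive_d. Qed.

(** With [char_im], the real and imaginary parts of [s I - char_mx s] at [s = a + i b]. *)
Definition char_re := \sum_j c (- h j) *: A j + MInt (fun th => c th *: Gt th).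
Definition char_im := \sum_j d (- h j) *: A j + MInt (fun th => d th *: Gt th).

Let cexp_c s : cexp (Complex a b * s%:C%C) = Complex (c s) (d s).
Proof. by rewrite /cexp /= !mulr0 subr0 add0r. Qed.

Lemma char_mxE i k : char_mx A h H G (Complex a b) i k =
  Complex (a *+ (i == k) - char_re i k) (b *+ (i == k) - char_im i k).
Proof.
have ReM (x y z : R) : complex.Re (Complex x y * z%:C%C) = x * z by rewrite /= mulr0 subr0.
have ImM (x y z : R) : complex.Im (Complex x y * z%:C%C) = y * z by rewrite /= mulr0 add0r.
have hE j : - Complex a b * (h j)%:C%C = Complex a b * (- h j)%:C%C.
  by rewrite rmorphN /= mulrN mulNr.
have cE f : lbm f -> MInt (fun th => f th *: Gt th) i k =
    \int[lebesgue_measure]_(th in `[- H, 0]) (f th * G th i k).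
  by move=> bf; rewrite mxE Int_itv; apply: eq_Int => th; rewrite !mxE mulrCA.
have E : char_mx A h H G (Complex a b) i k = Complex a b *+ (i == k) -
    \sum_j Complex (c (- h j)) (d (- h j)) * (A j i k)%:C%C -
    Complex (\int[lebesgue_measure]_(th in `[- H, 0]) (c th * G th i k))
            (\int[lebesgue_measure]_(th in `[- H, 0]) (d th * G th i k)).
  rewrite /char_mx mxE [X in X + _]mxE [X in _ + X]mxE [X in X + _ + _]mxE [X in _ + X + _]mxE summxE.
  congr (_ - _ - _); first by apply: eq_bigr => j _; rewrite !mxE hE cexp_c.
  rewrite mxE; congr Complex; apply: eq_Rintegral => th _; rewrite !mxE cexp_c; first exact: ReM.
  exact: ImM.
rewrite E; apply/eqP; rewrite eq_complex; apply/andP; split; apply/eqP.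
  rewrite 2!(raddfB (@complex.Re R)) (raddfMn (@complex.Re R)) (raddf_sum (@complex.Re R)) /=
    /char_re [in RHS]mxE summxE opprD addrA (cE _ lbm_c).
  by congr (_ - _ - _); apply: eq_bigr => j _; rewrite mxE mulr0 subr0.
rewrite 2!(raddfB (@complex.Im R)) (raddfMn (@complex.Im R)) (raddf_sum (@complex.Im R)) /=
    /char_im [in RHS]mxE summxE opprD addrA (cE _ lbm_d).
by congr (_ - _ - _); apply: eq_bigr => j _; rewrite mxE mulr0 add0r.
Qed.

(** Together the two equations say that [char_mx] at [a + i b] annihilates [u + i v]. *)
Hypothesis re_eq : char_re *m u - char_im *m v = a *: u - b *: v.
Hypothesis im_eq : char_re *m v + char_im *m u = a *: v + b *: u.

(* Real and imaginary parts of [exp ((a + i b) s) (u + i v)]. *)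
Definition mode_re s := c s *: u - d s *: v.
Definition mode_im s := c s *: v + d s *: u.

Let mlbm_re : mlbm mode_re.
Proof. by apply: mlbmB; apply: mlbmZ => //; exact: mlbm_cst. Qed.

Let mlbm_im : mlbm mode_im.
Proof. by apply: mlbmD; apply: mlbmZ => //; exact: mlbm_cst. Qed.

Let L1_G (f : R -> R) (w : 'cV[R]_n) : lbm f -> mL1 (fun th => f th *: Gt th *m w).
Proof.
move=> bf; apply: (@mlbm_mL1 _ _ _ (- H) 0); first exact: mlbmM (mlbmZ bf bGt) (mlbm_cst w).
by move=> th thH; rewrite Gt_out// scaler0 mul0mx.
Qed.

Let L1_G' (f : R -> R) : lbm f -> mL1 (fun th => f th *: Gt th).
Proof.
move=> bf; apply: (@mlbm_mL1 _ _ _ (- H) 0); first exact: mlbmZ.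
by move=> th thH; rewrite Gt_out// scaler0.
Qed.

Let lop_re0 : lop mode_re 0 = a *: u - b *: v.
Proof.
rewrite -re_eq /char_re /char_im !mulmxDl -(MInt_mr _ (L1_G' lbm_c)) -(MInt_mr _ (L1_G' lbm_d)).
rewrite opprD [RHS]addrACA -MIntN; last exact: L1_G.
rewrite -MIntD; last 2 first.
- exact: L1_G.
- by move=> i j; apply: eq_L1 (L1N (L1_G v lbm_d i j)) => th; rewrite [RHS]mxE.
rewrite lopE !mulmx_suml -sumrB; congr (_ + _); last first.
  by apply: eq_MInt => th; rewrite add0r mulmxBr -!scalemxAr -!scalemxAl.
by apply: eq_bigr => j _; rewrite sub0r mulmxBr -!scalemxAr -!scalemxAl.
Qed.

Let lop_im0 : lop mode_im 0 = a *: v + b *: u.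
Proof.
rewrite -im_eq /char_re /char_im !mulmxDl -(MInt_mr _ (L1_G' lbm_c)) -(MInt_mr _ (L1_G' lbm_d)).
rewrite [RHS]addrACA -MIntD; [|exact: L1_G|exact: L1_G].
rewrite lopE !mulmx_suml -big_split; congr (_ + _); last first.
  by apply: eq_MInt => th; rewrite add0r mulmxDr -!scalemxAr -!scalemxAl.
by apply: eq_bigr => j _; rewrite sub0r mulmxDr -!scalemxAr -!scalemxAl.
Qed.

Let lop_comb (x y : R) : lop (fun s => x *: mode_re s + y *: mode_im s) 0 =
  x *: (a *: u - b *: v) + y *: (a *: v + b *: u).
Proof.
rewrite -lop_re0 -lop_im0 -(lopZ _ _ mlbm_re) -(lopZ _ _ mlbm_im) -lopD//.
  by apply: mlbmZ => //; exact: lbm_cst.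
by apply: mlbmZ => //; exact: lbm_cst.
Qed.

(** Shifting a mode by [t] replaces the pair by linear combinations with coefficients [c t] and
    [d t], so linearity reduces the value at [t] to the value at 0. *)
Let lop_re t : lop mode_re t = c t *: (a *: u - b *: v) + - d t *: (a *: v + b *: u).
Proof.
have := lop_shift mode_re t 0; rewrite add0r -lop_comb => <-.
rewrite (_ : (fun s => mode_re (s + t)) = (fun s => c t *: mode_re s + - d t *: mode_im s))//.
apply/funext => s; rewrite /mode_re /mode_im (addrC s) cD dD.
by move: (c t) (d t) (c s) (d s) => ? ? ? ?; apply/matrixP => i j; rewrite !mxE; ring.
Qed.

Let lop_im t : lop mode_im t = d t *: (a *: u - b *: v) + c t *: (a *: v + b *: u).
Proof.
have := lop_shift mode_im t 0; rewrite add0r -lop_comb => <-.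
rewrite (_ : (fun s => mode_im (s + t)) = (fun s => d t *: mode_re s + c t *: mode_im s))//.
apply/funext => s; rewrite /mode_re /mode_im (addrC s) cD dD.
by move: (c t) (d t) (c s) (d s) => ? ? ? ?; apply/matrixP => i j; rewrite !mxE; ring.
Qed.

Lemma mode_re_derive t : is_derive t 1 mode_re (lop mode_re t).
Proof.
apply: is_derive_matrix => i j; rewrite lop_re.
have h1 := is_deriveM (derive_c t) (is_derive_cst (u i j) t 1).
have h2 := is_deriveM (derive_d t) (is_derive_cst (v i j) t 1).
have := is_deriveB h1 h2.
rewrite (_ : (_ - _) = (fun s => mode_re s i j)); last first.
  by apply/funext => s; rewrite !mxE.
by move=> h3; apply: is_derive_eq h3 _; rewrite !mxE /GRing.scale /=; ring.
Qed.

Lemma mode_im_derive t : is_derive t 1 mode_im (lop mode_im t).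
Proof.
apply: is_derive_matrix => i j; rewrite lop_im.
have h1 := is_deriveM (derive_c t) (is_derive_cst (v i j) t 1).
have h2 := is_deriveM (derive_d t) (is_derive_cst (u i j) t 1).
have := is_deriveD h1 h2.
rewrite (_ : (_ + _) = (fun s => mode_im s i j)); last first.
  by apply/funext => s; rewrite !mxE.
by move=> h3; apply: is_derive_eq h3 _; rewrite !mxE /GRing.scale /=; ring.
Qed.

Lemma mode_norm t : 0 <= a -> 0 <= t ->
  enorm u ^+ 2 + enorm v ^+ 2 <= enorm (mode_re t) ^+ 2 + enorm (mode_im t) ^+ 2.
Proof.
move=> a0 t0; have -> : enorm (mode_re t) ^+ 2 + enorm (mode_im t) ^+ 2 =
    expR (a * t) ^+ 2 * (enorm u ^+ 2 + enorm v ^+ 2).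
  have cs : c t ^+ 2 + d t ^+ 2 = expR (a * t) ^+ 2.
    by rewrite /c /d !exprMn -mulrDr cos2Dsin2 mulr1.
  rewrite -cs !sqr_enorm /mode_re /mode_im !(dotDl, dotDr, dotNl, dotNr, dotZl, dotZr).
  by rewrite (dotC v u); ring.
rewrite ler_peMl ?addr_ge0 ?sqr_ge0// exprn_ege1//.
by rewrite -expR0 ler_expR mulr_ge0.
Qed.

End Spectrum.

(** * Consequences of exponential stability *)

Section Stable.
Hypothesis stable : exp_stable A h H G.

Lemma stable_decay : exists2 gs : R * R, 1 <= gs.1 /\ 0 < gs.2 & forall phi x,
  piecewise_continuous (- H) 0 phi -> is_solution A h H G phi x ->
  forall t, 0 <= t -> enorm (x t) <= gs.1 * expR (- gs.2 * t) * supnorm H phi.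
Proof. by have [gam [sig [g1 s0 hd]]] := stable; exists (gam, sig). Qed.

Lemma stable_smooth x : (forall t, is_derive t 1 x (lop x t)) ->
  forall e : R, 0 < e -> exists T, forall t, 0 <= t -> T <= t -> enorm (x t) <= e.
Proof.
move=> hx e e0; have [[gam sig] /= [g1 s0] hd] := stable_decay.
have cx : continuous x.
  by move=> t; apply: differentiable_continuous; apply/derivable1_diffP; case: (hx t).
have pc : piecewise_continuous (- H) 0 x.
  split; first by exists [::] => t _ _; exact: cx.
    by move=> t _; apply/cvg_ex; exists (x t); apply: cvg_at_right_filter; exact: cx.
  by move=> t _; apply/cvg_ex; exists (x t); apply: cvg_at_left_filter; exact: cx.
have sol : is_solution A h H G x x.
  by split=> //; [exact: continuous_subspaceT|exists [::]].
have {}hd := hd x x pc sol.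
set S := supnorm H x in hd.
(* By [1 + x <= exp x], this time is late enough for the exponential bound to fall below [e]. *)
pose q := gam * `|S| / (sig * e).
have q0 : 0 <= q by rewrite divr_ge0 ?mulr_ge0 ?(ltW s0) ?(ltW e0)// (le_trans _ g1).
exists q => t t0 qt; apply: le_trans (hd t t0) _.
have ES : gam * expR (- sig * t) * S <= gam * expR (- sig * t) * `|S|.
  by rewrite ler_wpM2l ?ler_norm// mulr_ge0 ?expR_ge0// (le_trans _ g1).
apply: le_trans ES _; rewrite mulNr expRN mulrAC ler_pdivrMr ?expR_gt0//.
have h1 := expR_ge1Dx (sig * t).
have h2 : e * (sig * q) = gam * `|S| by rewrite /q; field; rewrite !gt_eqF.
rewrite -h2 ler_wpM2l ?(ltW e0)//; apply: le_trans h1.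
by apply: ler_wpDl => //; rewrite ler_wpM2l// ltW.
Qed.

Lemma spectrum_re s : spectrum A h H G s -> complex.Re s < 0.
Proof.
case: s => a b /=; rewrite /spectrum /= => hdet; rewrite ltNge; apply/negP => a0.
(* [det0P] yields a row vector in the left kernel, hence the transpose. *)
have : \det (char_mx A h H G (Complex a b))^T == 0 by rewrite det_tr hdet.
move=> /det0P[w w0 hw].
pose u := \col_k complex.Re (w 0 k); pose v := \col_k complex.Im (w 0 k).
have uE k : u k 0 = complex.Re (w 0 k) by rewrite /u mxE.
have vE k : v k 0 = complex.Im (w 0 k) by rewrite /v mxE.
have row i : \sum_k w 0 k * char_mx A h H G (Complex a b) i k = 0.
  have := congr1 (fun z : 'rV_n => z 0 i) hw; rewrite !mxE => e; rewrite -[RHS]e.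
  by apply: eq_bigr => k _; rewrite [X in _ = _ * X]mxE.
have ReM (z : R[i]%C) (x y : R) : complex.Re (z * Complex x y) = complex.Re z * x - complex.Im z * y.
  by case: z.
have ImM (z : R[i]%C) (x y : R) : complex.Im (z * Complex x y) = complex.Re z * y + complex.Im z * x.
  by case: z.
have re_row i : \sum_k (u k 0 * (a *+ (i == k) - char_re a b i k) -
    v k 0 * (b *+ (i == k) - char_im a b i k)) = 0.
  have := congr1 (@complex.Re R) (row i); rewrite raddf_sum /= => e; rewrite -[RHS]e.
  by apply: eq_bigr => k _; rewrite char_mxE ReM -uE -vE.
have im_row i : \sum_k (u k 0 * (b *+ (i == k) - char_im a b i k) +
    v k 0 * (a *+ (i == k) - char_re a b i k)) = 0.
  have := congr1 (@complex.Im R) (row i); rewrite raddf_sum /= => e; rewrite -[RHS]e.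
  by apply: eq_bigr => k _; rewrite char_mxE ImM -uE -vE.
have diag (f : 'cV[R]_n) (z : R) i : \sum_k f k 0 * (z *+ (i == k)) = z * f i 0.
  rewrite (bigD1 i)//= eqxx mulr1n mulrC big1 ?addr0// => k /negbTE ki.
  by rewrite eq_sym ki mulr0.
have dot_row (f : 'cV[R]_n) (Q : 'M[R]_n) i : \sum_k f k 0 * Q i k = (Q *m f) i 0.
  by rewrite mxE; apply: eq_bigr => k _; rewrite mulrC.
have re_eq : char_re a b *m u - char_im a b *m v = a *: u - b *: v.
  apply/matrixP => i j; rewrite ord1; have := re_row i.
  under eq_bigr do rewrite !mulrBr.
  rewrite !sumrB !diag !dot_row => e; rewrite !mxE in e *.
  by move: e; lra.
have im_eq : char_re a b *m v + char_im a b *m u = a *: v + b *: u.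
  apply/matrixP => i j; rewrite ord1; have := im_row i.
  under eq_bigr do rewrite !mulrBr.
  rewrite big_split !sumrB !diag !dot_row => e; rewrite !mxE in e *.
  by move: e; rewrite /=; lra.
have uv0 : 0 < enorm u ^+ 2 + enorm v ^+ 2.
  rewrite lt_neqAle addr_ge0 ?sqr_ge0// andbT eq_sym; apply/negP.
  rewrite paddr_eq0 ?sqr_ge0// !sqrf_eq0 !enorm_eq0 => /andP[/eqP u0 /eqP v0].
  case/negP: w0; apply/eqP/matrixP => i k; rewrite ord1 [RHS]mxE.
  have := uE k; have := vE k; rewrite u0 v0 !mxE.
  by case: (w 0 k) => x y /= <- <-.
pose X := mode_re a b u v; pose Y := mode_im a b u v.
have small z : (forall t, is_derive t 1 z (lop z t)) -> forall e : R, 0 < e ->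
    exists T, forall t, 0 <= t -> T <= t -> enorm (z t) <= e.
  exact: stable_smooth.
set r := enorm u ^+ 2 + enorm v ^+ 2 in uv0.
(* If both parts had norm at most [e], their squares would add up to at most [r / 2], whereas for
   [a >= 0] the sum is at least [r]. *)
pose e := Num.sqrt (r / 4); have e0 : 0 < e by rewrite sqrtr_gt0 divr_gt0.
have [T1 hT1] := small X (mode_re_derive re_eq im_eq) e e0.
have [T2 hT2] := small Y (mode_im_derive re_eq im_eq) e e0.
pose T := `|T1| + `|T2|.
have n1 := ler_norm T1; have n2 := ler_norm T2; have p1 := normr_ge0 T1; have p2 := normr_ge0 T2.
have T0 : 0 <= T by rewrite addr_ge0.
have l1 : enorm (X T) <= e by apply: hT1 => //; rewrite /T; lra.
have l2 : enorm (Y T) <= e by apply: hT2 => //; rewrite /T; lra.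
have := mode_norm b u v a0 T0; rewrite -/r -/X -/Y => hr.
have q1 := lerXn2r 2 (enorm_ge0 (X T)) (ltW e0) l1.
have q2 := lerXn2r 2 (enorm_ge0 (Y T)) (ltW e0) l2.
have qe : e ^+ 2 = r / 4 by rewrite /e sqr_sqrtr// divr_ge0 ?(ltW uv0).
rewrite qe in q1 q2.
by move: hr q1 q2 uv0; lra.
Qed.

Lemma stable_lyapunov_condition : lyapunov_condition A h H G.
Proof.
move=> [s [/spectrum_re s1 /spectrum_re]]; rewrite raddfN /=.
by move: s1; lra.
Qed.

Lemma K_solution v : is_solution A h H G (fun t => K t *m v) (fun t => K t *m v).
Proof.
have [bx [s hs]] := K_left v; split=> //.
  apply: within_matrix => i j.
  have -> : (fun t => (K t *m v) i j) = (fun t => \sum_l K t i l * v l j).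
    by apply/funext => t; rewrite mxE.
  case: K_fund => _ _ cK _.
  apply: (@continuous_bigsum R (subspace `[(0 : R), +oo[)) => l x.
  by apply: cvgM; [exact: (within_entry (i := i) (j := l) cK)|exact: cvg_cst].
exists s => t t0 ts; apply: is_derive_matrix => i j; rewrite ord1.
have [_ hd] := hs (t + 1) i 0; apply: hd => //.
by rewrite t0 ltrDl ltr01.
Qed.

(** The columns of [K] are solutions whose initial function is zero except for a jump at its right
    end. This function is piecewise continuous, and its supremum norm is that of the value at 0. *)
Lemma K_exp_decay : exists2 gs : R * R, 1 <= gs.1 /\ 0 < gs.2 & forall t v,
  enorm (K t *m v) <= gs.1 * ((0 <= t)%R%:R * expR (- gs.2 * t)) * enorm v.
Proof.
have [[gam sig] /= [g1 s0] hd] := stable_decay.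
exists (gam, sig) => //= t v; case: (leP 0 t) => t0; last first.
  by rewrite K_neg// mul0mx enorm0 mul0r mulr0 mul0r.
rewrite mul1r; pose phi t := K t *m v.
have phi0 u : u < 0 -> phi u = 0 by move=> u0; rewrite /phi K_neg// mul0mx.
have pc : piecewise_continuous (- H) 0 phi.
  split.
  - exists [::] => u /andP[_ u0] _.
    rewrite /prop_for /continuous_at (phi0 u u0).
    apply: cvg_near_cst; exists (- u) => /=; first by rewrite oppr_gt0.
    by move=> w /= uw; apply: phi0; move: uw; rewrite ltr_norml; lra.
  - move=> u /andP[_ u0]; apply/cvg_ex; exists 0; apply: cvg_near_cst.
    exists (- u) => /=; first by rewrite oppr_gt0.
    by move=> w /= uw _; apply: phi0; move: uw; rewrite ltr_norml; lra.
  - move=> u /andP[_ u0]; apply/cvg_ex; exists 0; apply: cvg_near_cst.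
    by exists 1 => //= w uw wu; apply: phi0; exact: lt_le_trans wu u0.
apply: le_trans (hd phi phi pc (K_solution v) t t0) _.
rewrite ler_wpM2l//; first by rewrite mulr_ge0 ?expR_ge0// (le_trans _ g1).
apply: ge_sup; first by exists (enorm (phi 0)), 0 => //=; rewrite in_itv /= lexx oppr_le0 ltW.
move=> _ [u /= + <-]; rewrite in_itv /= => /andP[_]; rewrite le_eqVlt => /predU1P[->|u0].
  by rewrite /phi K_0 mul1mx.
by rewrite phi0// enorm0 enorm_ge0.
Qed.

End Stable.

(** * The Lyapunov matrix of a stable system *)

Section Converse.
Variables (gam sig : R).
Hypotheses (gam_ge1 : 1 <= gam) (sig_gt0 : 0 < sig).

Let ker t := (0 <= t)%R%:R * expR (- sig * t).

Hypothesis K_exp : forall t v, enorm (K t *m v) <= gam * ker t * enorm v.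

Let gam_ge0 : 0 <= gam. Proof. exact: le_trans gam_ge1. Qed.

Let ker_ge0 t : 0 <= ker t. Proof. by rewrite mulr_ge0 ?expR_ge0. Qed.

Let ker_le1 t : ker t <= 1.
Proof.
rewrite /ker; case: (leP 0 t) => t0; last by rewrite mul0r.
by rewrite mul1r -expR0 ler_expR mulNr oppr_le0 mulr_ge0// ltW.
Qed.

Let L1_ker : L1 ker.
Proof.
have := L1Z (sig^-1) (integrable_exponential_pdf sig_gt0 : L1 _).
apply: eq_L1 => t; rewrite /exponential_pdf patchE /ker.
case: (leP 0 t) => t0; last first.
  by rewrite memNset ?mulr0 ?mul0r//= in_itv /= andbT; apply/negP; rewrite -ltNge.
by rewrite mem_set ?mul1r ?mulrA ?mulVf ?mul1r ?gt_eqF//= in_itv /= t0.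
Qed.

Let K_le t v : enorm (K t *m v) <= gam * enorm v.
Proof.
apply: le_trans (K_exp t v) _; rewrite ler_wpM2r ?enorm_ge0// -[leRHS]mulr1.
by rewrite ler_wpM2l.
Qed.

Variable W : 'M[R]_n.
Hypothesis W_pos : posdefmx W.

Let W_sym : W^T = W. Proof. by case: W_pos. Qed.

Definition bounded_cols X B := forall t v, enorm (X t *m v) <= B * enorm v.

Lemma KWE (s t : R) (Y : 'M[R]_n) i j : ((K t)^T *m W *m Y) i j =
  dot (K t *m delta_mx i 0) (W *m (Y *m delta_mx j 0)).
Proof. by rewrite mx_entry_dot -!mulmxA dot_mulmx trmxK. Qed.

Lemma KW_entry t (Y : 'M[R]_n) B i j : enorm (Y *m delta_mx j 0) <= B ->
  `|((K t)^T *m W *m Y) i j| <= opnorm W * gam * ker t * B.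
Proof.
move=> YB; rewrite (KWE 0); apply: le_trans (norm_dot_opnorm _ _ _) _.
apply: ler_pM => //; rewrite ?mulr_ge0 ?opnorm_ge0 ?enorm_ge0//.
rewrite -mulrA ler_wpM2l ?opnorm_ge0//; apply: le_trans (K_exp _ _) _.
by rewrite enorm_delta mulr1.
Qed.

(** The second factor is left general because the derivative of [corr K] on positive times is
    [corr (rop K)]. *)
Definition corr X tau := MInt (fun t => (K t)^T *m W *m X (t + tau)).

Let bKW : mlbm (fun t => (K t)^T *m W).
Proof. by apply: mlbmM; [exact: mlbm_tr mlbm_K|exact: mlbm_cst]. Qed.

Let mL1_dom p q (X : R -> 'M[R]_(p, q)) (f : R -> R) : mlbm X -> L1 f ->
  (forall t i j, `|X t i j| <= f t) -> mL1 X.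
Proof. by move=> bX lf Xf i j; apply: (@L1_le _ _ f) => //; exact: lbm_meas (bX i j). Qed.

Let bounded_delta X B t j : bounded_cols X B -> enorm (X t *m delta_mx j 0) <= B.
Proof. by move=> XB; apply: le_trans (XB _ _) _; rewrite enorm_delta mulr1. Qed.

Lemma mL1_corr X B tau : mlbm X -> bounded_cols X B ->
  mL1 (fun t => (K t)^T *m W *m X (t + tau)).
Proof.
move=> bX XB; apply: (@mL1_dom _ _ _ (fun t => opnorm W * gam * B * ker t)).
- by apply: mlbmM => //; exact: mlbm_shift.
- exact: L1Z.
by move=> t i j; rewrite mulrAC; apply: KW_entry; exact: bounded_delta.
Qed.

Let bdK : bounded_cols K gam. Proof. exact: K_le. Qed.

Lemma rop_bounded X B : 0 <= B -> mlbm X -> bounded_cols X B ->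
  exists2 B', 0 <= B' & bounded_cols (rop X) B'.
Proof.
move=> B0 bX XB; pose I := Int (icc (- H) 0).
have I0 : 0 <= I by apply: Int_ge0 => t; exact: icc_ge0.
exists (\sum_j B * opnorm (A j) + B * bg * I).
  rewrite addr_ge0 ?mulr_ge0 ?bG_ge0//; apply: sumr_ge0 => j _.
  by rewrite mulr_ge0 ?opnorm_ge0.
move=> t v; rewrite ropE mulmxDl mulmx_suml mulrDl mulr_suml.
apply: le_trans (enormD _ _) _; apply: lerD.
  apply: le_trans (enorm_sum _ _) _; apply: ler_sum => j _.
  rewrite -mulmxA; apply: le_trans (XB _ _) _.
  by rewrite -mulrA ler_wpM2l//; exact: opnormP.
have lX := mL1_rop t bX; rewrite -(MInt_mr v lX) mulrAC -IntZ; last exact: L1_icc.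
apply: (enorm_MInt (mL1_mr v lX)); first by apply: L1Z; exact: L1_icc.
move=> th; rewrite /icc; case: (boolP (- H <= th <= 0)) => thH; last first.
  by rewrite Gt_out// mulmx0 mul0mx enorm0 mulr0.
rewrite mulr1 -mulmxA Gt_in//; apply: le_trans (XB _ _) _.
rewrite -mulrA ler_wpM2l//; apply: le_trans (opnormP _ _) _.
by rewrite ler_wpM2r ?enorm_ge0// bG_ub.
Qed.

(** The delays act on the second factor only, so the operator passes under the integral over all
    times. *)
Lemma rop_corr tau : rop (corr K) tau = corr (rop K) tau.
Proof.
pose F (z : R * R) := (K z.1)^T *m W *m (K (z.1 + z.2 + tau) *m Gt z.2).
have bF : mlbm2 F.
  apply: (mlbm2M (X := fun z => (K z.1)^T *m W)) => [i j|]; first exact: (lbm2_fst (bKW i j)).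
  apply: (mlbm2M (X := fun z => K (z.1 + z.2 + tau))) => i j; last exact: (lbm2_snd (bGt i j)).
  exact: (lbm2_add (mlbm_shift tau mlbm_K i j)).
have lf : L1 (fun t => opnorm W * gam * ker t) by exact: L1Z.
have lg : L1 (fun t => gam * bg * icc (- H) 0 t) by apply: L1Z; exact: L1_icc.
have f0 t : 0 <= opnorm W * gam * ker t by rewrite !mulr_ge0 ?opnorm_ge0.
have g0 t : 0 <= gam * bg * icc (- H) 0 t by rewrite !mulr_ge0 ?bG_ge0 ?icc_ge0.
have Ffg s t i j : `|F (s, t) i j| <= opnorm W * gam * ker s * (gam * bg * icc (- H) 0 t).
  apply: KW_entry => /=; rewrite /icc; case: (boolP (- H <= t <= 0)) => tH; last first.
    by rewrite Gt_out// mulmx0 mul0mx enorm0 mulr0.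
  rewrite mulr1 -mulmxA Gt_in//; apply: le_trans (K_le _ _) _; rewrite ler_wpM2l//.
  apply: le_trans (opnormP _ _) _; rewrite enorm_delta mulr1; exact: bG_ub.
have [EF l1 l2] := Fubini_dom bF lf lg f0 g0 Ffg.
have lK j : mL1 (fun t => (K t)^T *m W *m (K (t + (tau - h j)) *m A j)).
  by apply: eq_mL1 (mL1_mr (A j) (mL1_corr (tau - h j) mlbm_K bdK)) => t; rewrite [RHS]mulmxA.
rewrite ropE; transitivity (MInt (fun t => \sum_j (K t)^T *m W *m (K (t + (tau - h j)) *m A j) +
    MInt (fun th => F (t, th)))); last first.
  apply: eq_MInt => t; rewrite ropE mulmxDr mulmx_sumr; congr (_ + _).
    by apply: eq_bigr => j _; rewrite addrA.
  rewrite -(MInt_ml _ (mL1_rop (t + tau) mlbm_K)); apply: eq_MInt => th.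
  by rewrite /F /= (addrAC t th).
rewrite (MIntD (mL1_sum _ lK) l1) (MInt_sum _ lK) EF; congr (_ + _).
  apply: eq_bigr => j _; rewrite -(MInt_mr _ (mL1_corr (tau - h j) mlbm_K bdK)).
  by apply: eq_MInt => t; rewrite [RHS]mulmxA.
apply: eq_MInt => th; rewrite -(MInt_mr _ (mL1_corr (tau + th) mlbm_K bdK)).
by apply: eq_MInt => t; rewrite /F /= -mulmxA (addrAC t th) addrA.
Qed.

Lemma corr_sym tau : corr K (- tau) = (corr K tau)^T.
Proof.
rewrite /corr MInt_tr -(MInt_shift tau (mL1_corr (- tau) mlbm_K bdK)).
by apply: eq_MInt => t; rewrite addrK !trmx_mul trmxK W_sym mulmxA.
Qed.

(** Proved in integrated form, without differentiating under the integral. For [0 <= s] the times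
    [r + u] are nonnegative wherever [K r] is nonzero, so the jump of [K] at 0 is avoided. *)
Lemma corr_incr s t : 0 <= s -> s <= t ->
  corr K t - corr K s = MInt (fun u => ico s t u *: corr (rop K) u) /\
  mL1 (fun u => ico s t u *: corr (rop K) u).
Proof.
move=> s0 st; have [B B0 hB] := rop_bounded gam_ge0 mlbm_K bdK.
have bR := mlbm_rop mlbm_K.
pose F (z : R * R) := ico s t z.2 *: ((K z.1)^T *m W *m rop K (z.1 + z.2)).
have bF : mlbm2 F.
  move=> i j; apply: (@eq_lbm2 _ (fun z => ico s t z.2 * ((K z.1)^T *m W *m rop K (z.1 + z.2)) i j)).
    by move=> z; rewrite [RHS]mxE.
  apply: lbm2M; first exact: (lbm2_snd (lbm_ico s t)).
  apply: (mlbm2M (X := fun z => (K z.1)^T *m W)) => [k l|k l]; first exact: (lbm2_fst (bKW k l)).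
  exact: (lbm2_add (bR k l)).
have lf : L1 (fun t => opnorm W * gam * ker t) by exact: L1Z.
have lg : L1 (fun u => B * ico s t u) by apply: L1Z; exact: L1_ico.
have f0 u : 0 <= opnorm W * gam * ker u by rewrite !mulr_ge0 ?opnorm_ge0.
have g0 u : 0 <= B * ico s t u by rewrite mulr_ge0 ?ico_ge0.
have Ffg r u i j : `|F (r, u) i j| <= opnorm W * gam * ker r * (B * ico s t u).
  rewrite /F /= mxE normrM ger0_norm ?ico_ge0// mulrA mulrC ler_wpM2r ?ico_ge0//.
  by apply: KW_entry; exact: bounded_delta.
have [EF l1 l2] := Fubini_dom bF lf lg f0 g0 Ffg.
have FE u : MInt (fun r => F (r, u)) = ico s t u *: corr (rop K) u.
  by rewrite /corr -(MIntZ _ (mL1_corr u bR hB)).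
split; last exact: eq_mL1 FE l2.
have lt_ := mL1_corr t mlbm_K bdK; have ls := mL1_corr s mlbm_K bdK.
have ls' : mL1 (fun u => - ((K u)^T *m W *m K (u + s))).
  by move=> i j; apply: eq_L1 (L1N (ls i j)) => u; rewrite [RHS]mxE.
transitivity (MInt (fun u => MInt (fun r => F (u, r)))).
  rewrite /corr -(MIntN ls) -(MIntD lt_ ls'); apply: eq_MInt => u.
  rewrite -mulmxBr; clear EF l1 l2 lt_ ls ls' Ffg lf lg f0 g0 bF.
   case: (ltP u 0) => u0.
    rewrite K_neg// trmx0 !mul0mx -[LHS](@MInt0 R n n); apply: eq_MInt => r.
    by rewrite /F /= K_neg// trmx0 !mul0mx scaler0.
  have [sK hK] := K_pderm; have ust : u + s <= u + t by rewrite lerD2l.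
  have us0 : 0 <= u + s by rewrite addr_ge0.
  have := pderm_FTC ust bR (pderm_sub us0 (lexx (u + t)) (hK (u + t))) => <-.
  rewrite -(MInt_shift u (mL1_ico (u + s) (u + t) bR)).
  have lsh : mL1 (fun r => ico (u + s) (u + t) (r + u) *: rop K (r + u)).
    by move=> i j; exact: (L1_shift u (mL1_ico (u + s) (u + t) bR i j)).
  rewrite -(MInt_ml _ lsh); apply: eq_MInt => r; rewrite /F /= -scalemxAr (addrC r u).
  by congr (_ *: _); rewrite /ico !lerD2l !ltrD2l.
by rewrite EF; apply: eq_MInt => u; exact: FE.
Qed.

Lemma corr_incr_entry s t i j : 0 <= s -> s <= t -> corr K t i j - corr K s i j =
  Int (fun u => ico s t u * corr (rop K) u i j).
Proof.
move=> s0 st; transitivity ((corr K t - corr K s) i j).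
  by rewrite [RHS]mxE [X in _ = _ + X]mxE.
have [-> _] := corr_incr s0 st; rewrite [LHS]mxE; apply: eq_Int => u; by rewrite [LHS]mxE.
Qed.

Let corr_entry_lip : exists2 C, 0 <= C & forall s t i j, `|corr K t i j - corr K s i j| <= C * `|t - s|.
Proof.
have [B B0 hB] := rop_bounded gam_ge0 mlbm_K bdK.
have bR := mlbm_rop mlbm_K.
pose C := Int (fun t => opnorm W * gam * B * ker t).
have lC : L1 (fun t => opnorm W * gam * B * ker t) by exact: L1Z.
have C0 : 0 <= C by apply: Int_ge0 => t; rewrite !mulr_ge0 ?opnorm_ge0.
have bound u i j : `|corr (rop K) u i j| <= C.
  rewrite mxE; apply: norm_Int_le => // [|t]; first exact: (mL1_corr u bR hB i j).
  by rewrite mulrAC; apply: KW_entry; exact: bounded_delta.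
have pos s t i j : 0 <= s -> s <= t -> `|corr K t i j - corr K s i j| <= C * (t - s).
  move=> s0 st; rewrite corr_incr_entry// -(Int_ico st) -IntZ; last exact: L1_ico.
  apply: norm_Int_le => [||u]; last 1 first.
  - rewrite normrM (ger0_norm (ico_ge0 _ _ _)) mulrC ler_wpM2r ?ico_ge0//; exact: bound.
  - have [_ l] := corr_incr s0 st; apply: eq_L1 (l i j) => u; by rewrite [LHS]mxE.
  - by apply: L1Z; exact: L1_ico.
have pos' s t i j : 0 <= s -> 0 <= t -> `|corr K t i j - corr K s i j| <= C * `|t - s|.
  move=> s0 t0; case: (leP s t) => st; first by rewrite [X in _ * X]ger0_norm ?subr_ge0//; exact: pos.
  by rewrite distrC [X in _ * X]distrC [X in _ * X]ger0_norm ?subr_ge0 ?(ltW st)//;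
    exact: pos t0 (ltW st).
have neg t i j : corr K (- t) i j = corr K t j i by rewrite corr_sym [LHS]mxE.
exists C => // s t i j; case: (leP 0 s) => s0; case: (leP 0 t) => t0.
- exact: pos'.
- have e1 := pos' 0 s i j (lexx 0) s0; have t0' : 0 <= - t by rewrite oppr_ge0 ltW.
  have := pos' 0 (- t) j i (lexx 0) t0'; rewrite neg -[corr K 0 j i]neg oppr0 => e2.
  have -> : corr K t i j - corr K s i j =
      (corr K t i j - corr K 0 i j) - (corr K s i j - corr K 0 i j) by ring.
  apply: le_trans (ler_normB _ _) _; apply: le_trans (lerD e2 e1) _.
  rewrite -mulrDr ler_wpM2l// ?subr0 ?addr0 normrN (ltr0_norm t0) (ger0_norm s0).
  by rewrite ltr0_norm; lra.
- have e1 := pos' 0 t i j (lexx 0) t0; have s0' : 0 <= - s by rewrite oppr_ge0 ltW.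
  have := pos' 0 (- s) j i (lexx 0) s0'; rewrite neg -[corr K 0 j i]neg oppr0 => e2.
  have -> : corr K t i j - corr K s i j =
      (corr K t i j - corr K 0 i j) - (corr K s i j - corr K 0 i j) by ring.
  apply: le_trans (ler_normB _ _) _; apply: le_trans (lerD e1 e2) _.
  rewrite -mulrDr ler_wpM2l// ?subr0 ?addr0 normrN (ltr0_norm s0) (ger0_norm t0).
  by rewrite ger0_norm; lra.
- have s0' : 0 <= - s by rewrite oppr_ge0 ltW.
  have t0' : 0 <= - t by rewrite oppr_ge0 ltW.
  by have := pos' (- s) (- t) j i s0' t0'; rewrite (neg t j i) (neg s j i) -opprD normrN.
Qed.

Lemma corr_continuous i j : continuous (fun t => corr K t i j).
Proof.
have [C C0 hC] := corr_entry_lip; move=> t; apply/cvgrPdist_le => e e0.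
exists (e / (C + 1)) => /=; first by rewrite divr_gt0// ltr_wpDl.
move=> u /= ut; rewrite distrC; apply: le_trans (hC t u i j) _; rewrite distrC.
apply: (@le_trans _ _ ((C + 1) * `|t - u|)); first by rewrite ler_wpM2r ?lerDl.
by move: (ltW ut); rewrite ler_pdivlMr ?ltr_wpDl// mulrC.
Qed.

Lemma mlbm_corr : mlbm (corr K).
Proof. by move=> i j; apply: lbm_continuous; exact: corr_continuous. Qed.

(** Agrees with the entry of [corr K] on nonnegative times but is differentiable on both sides of 0,
    which is interior to the domain since the integral starts at -1. It yields the derivative at
    positive times as well as the right derivative at 0. *)
Let prim i j t := corr K 0 i j +
  (Int (fun u => ico (-1) t u * rop (corr K) u i j) - Int (fun u => ico (-1) 0 u * rop (corr K) u i j)).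

Let prim_derive i j t : -1 < t -> is_derive t 1 (prim i j) (rop (corr K) t i j).
Proof.
move=> t1; have bR := mlbm_rop mlbm_corr.
have [_ hd] := pder_int (s := [::]) (a := -1) (b := t + 1) (bR i j)
  (fun u _ _ => rop_continuous mlbm_corr corr_continuous (i := i) (j := j) (x := u)).
have h1 : is_derive t 1 (fun t => Int (fun u => ico (-1) t u * rop (corr K) u i j)) (rop (corr K) t i j).
  by apply: hd => //; rewrite t1 ltrDl ltr01.
have h2 := is_deriveB h1 (is_derive_cst (Int (fun u => ico (-1) 0 u * rop (corr K) u i j)) t 1).
have h3 := is_deriveD (is_derive_cst (corr K 0 i j) t 1) h2.
by apply: is_derive_eq h3 _; rewrite subr0 add0r.
Qed.

Let corr_prim i j t : 0 <= t -> corr K t i j = prim i j t.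
Proof.
move=> t0; have bR := mlbm_rop mlbm_corr.
have m1 : (-1 : R) <= 0 <= t by rewrite oppr_le0 ler01.
rewrite /prim (Int_ico_split m1 (bR i j)) addrAC subrr add0r.
rewrite (_ : Int _ = corr K t i j - corr K 0 i j); first by rewrite addrC subrK.
by rewrite corr_incr_entry//; apply: eq_Int => u; rewrite rop_corr.
Qed.

Lemma corr_derive t : 0 < t -> is_derive t 1 (corr K) (rop (corr K) t).
Proof.
move=> t0; apply: is_derive_matrix => i j.
have t1 : -1 < t by apply: lt_trans t0; rewrite oppr_lt0.
apply: near_eq_is_derive (prim_derive i j t1).
exists t => //= u; rewrite /= ltr_norml => /andP[_ ut]; rewrite corr_prim//.
by move: ut; lra.
Qed.

Lemma corr_derive0 : t^-1 *: (corr K t - corr K 0) @[t --> 0^'+] --> rop (corr K) 0.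
Proof.
apply: cvg_matrix => i j.
have [hd e] := prim_derive i j (ltrN10 R).
have /cvg_ex[l hl] := hd.
have le_ : l = rop (corr K) 0 i j by rewrite -e; apply/esym/cvg_lim.
have sub : (0 : R)^'+ `=>` (0 : R)^'.
  by move=> P [d /= d0 hP]; exists d => // u /= ud u0; apply: hP => //; rewrite gt_eqF.
rewrite -le_; apply: cvg_trans _ (cvg_trans (cvg_app _ sub) hl).
apply: near_eq_cvg; exists 1 => //= u /= _ u0.
have e1 := corr_prim i j (ltW u0); have e2 := corr_prim i j (lexx 0).
rewrite /GRing.scale /= mulr1 addr0 -e1 -e2.
by rewrite [RHS]mxE; congr (_ * _); rewrite [RHS]mxE; congr (_ + _); rewrite [RHS]mxE.
Qed.

Let ico_k_cvg (f : R -> R) : L1 f -> (forall t, t < 0 -> f t = 0) ->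
  Int (fun t => ico 0 k%:R t * f t) @[k --> \oo] --> Int f.
Proof.
move=> lf f0; have mf := L1_meas lf.
apply: (DCT (g := fun t => `|f t|)) => //.
- move=> k; apply: measurable_funM => //; exact: lbm_meas (lbm_ico 0 k%:R).
- exact: L1_norm.
- apply: aeW => t; apply: cvg_near_cst.
  exists (Num.truncn t).+1 => // k /= tk; case: (ltP t 0) => t0; first by rewrite f0// mulr0.
  rewrite /ico t0 /= (_ : t < k%:R) ?mul1r//.
  have /andP[_ t1] := truncn_itv t0; apply: lt_le_trans t1 _.
  by rewrite ler_nat.
move=> k t; rewrite normrM; case: (icoP 0 k%:R t) => [[_ ->]|->]; first by rewrite normr1 mul1r.
by rewrite normr0 mul0r.
Qed.

(** The two terms add up to the integral of the derivative of [K^T W K], which goes from [W] at 0 to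
    0 at infinity. *)
Lemma corr_algebraic : rop (corr K) 0 + (rop (corr K) 0)^T = - W.
Proof.
have [B B0 hB] := rop_bounded gam_ge0 mlbm_K bdK.
have bR := mlbm_rop mlbm_K; have [s hK] := K_pderm.
pose P t := (K t)^T *m W *m rop K t.
have lP : mL1 P by apply: eq_mL1 (mL1_corr 0 bR hB) => t; rewrite addr0.
have lPt : mL1 (fun t => (P t)^T) by move=> i j; apply: eq_L1 (lP j i) => t; rewrite [RHS]mxE.
have -> : rop (corr K) 0 = MInt P by rewrite rop_corr; apply: eq_MInt => t; rewrite addr0.
rewrite MInt_tr -(MIntD lP lPt).
pose D t := P t + (P t)^T; have lD := mL1D lP lPt.
have bP : mlbm P by exact: mlbmM bKW bR.
have bD : mlbm D by apply: mlbmD => //; exact: mlbm_tr.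
have FTC (k : nat) : MInt (fun t => ico 0 k%:R t *: D t) = (K k%:R)^T *m W *m K k%:R - W.
  have hd := pdermM (pdermM (pderm_tr (hK k%:R)) (@pderm_cst R n n [::] 0 k%:R W)) (hK k%:R).
  have hd' : pderm ((s ++ [::]) ++ s) 0 k%:R (fun t => (K t)^T *m W *m K t) D.
    apply: eq_pderm hd => t _.
    by rewrite mulmx0 addr0 /D /P addrC !trmx_mul trmxK W_sym mulmxA.
  by rewrite (pderm_FTC (ler0n R k) bD hd') K_0 trmx1 mul1mx mulmx1.
apply/matrixP => i j; rewrite [LHS]mxE [RHS]mxE.
have lim1 := ico_k_cvg (lD i j) _.
have D0 t : t < 0 -> (P t + (P t)^T) i j = 0.
  by move=> t0; rewrite /P K_neg// trmx0 !mul0mx trmx0 addr0 mxE.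
have {}lim1 := lim1 D0.
have lim2 : Int (fun t => ico 0 k%:R t * (P t + (P t)^T) i j) @[k --> \oo] --> - W i j.
  have E (k : nat) : Int (fun t => ico 0 k%:R t * (P t + (P t)^T) i j) =
      ((K k%:R)^T *m W *m K k%:R) i j - W i j.
    have := congr1 (fun Q : 'M[R]_n => Q i j) (FTC k).
    rewrite [X in X = _ -> _]mxE [X in _ = X -> _]mxE [X in _ = _ + X -> _]mxE => <-.
    by apply: eq_Int => t; rewrite [RHS]mxE.
  rewrite (_ : (fun k : nat => _) = (fun k : nat =>
    ((K k%:R)^T *m W *m K k%:R) i j - W i j)); last first.
    by apply/funext => k; exact: E.
  rewrite -[X in _ --> X]add0r; apply: cvgB; last exact: cvg_cst.
  apply: norm_cvg0; pose c := opnorm W * gam * gam.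
  apply: (@squeeze_cvgr _ _ _ _ (fun=> 0) (fun k : nat => c * expR (- sig) ^+ k)).
  - apply: nearW => k /=; rewrite normr_ge0 /=.
    have hk := KW_entry k%:R i (bounded_delta k%:R j bdK).
    rewrite /ker ler0n mul1r expRM_natr in hk.
    by rewrite /c [leRHS]mulrAC.
  - exact: cvg_cst.
  - rewrite -(mulr0 c); apply: cvgM; first exact: cvg_cst.
    apply: cvg_expr; rewrite ger0_norm ?expR_ge0// -expR0 ltr_expR oppr_lt0//.
exact: (cvg_unique _ lim1 lim2).
Qed.

Lemma corr_delay_lyapunov : is_delay_lyapunov_matrix A h H G W (corr K).
Proof.
split.
- by move=> t; apply: cvg_matrix => i j; exact: corr_continuous.
- by split; [exact: corr_derive|exact: corr_derive0].
- by move=> t t0; rewrite corr_sym trmxK.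
by rewrite -corr_algebraic (rop0_addtr mlbm_corr).
Qed.

Lemma corr_form a b (u v : 'cV[R]_n) : dot u (corr K (b - a) *m v) =
  Int (fun t => dot (K (t + a) *m u) (W *m (K (t + b) *m v))) /\
  L1 (fun t => dot (K (t + a) *m u) (W *m (K (t + b) *m v))).
Proof.
have l := mL1_corr (b - a) mlbm_K bdK.
have la : mL1 (fun t => (K (t + a))^T *m W *m K (t + b)).
  move=> i j; apply: eq_L1 (L1_shift a (l i j)) => t.
  by rewrite -addrA (addrC a) subrK.
have -> : corr K (b - a) = MInt (fun t => (K (t + a))^T *m W *m K (t + b)).
  rewrite /corr -(MInt_shift a l); apply: eq_MInt => t.
  by rewrite -addrA (addrC a) subrK.
rewrite -(MInt_mr v la); have [e l1] := Int_dot u (mL1_mr v la).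
have E t : dot u ((K (t + a))^T *m W *m K (t + b) *m v) = dot (K (t + a) *m u) (W *m (K (t + b) *m v)).
  by rewrite -!mulmxA dot_mulmx trmxK.
by rewrite e; split; [exact: eq_Int|exact: eq_L1 E l1].
Qed.

Lemma corr_block_sym p : (lyap_block_mx H (corr K) p.+1)^T = lyap_block_mx H (corr K) p.+1.
Proof.
rewrite /lyap_block_mx tr_mxblock; apply: eq_mxblock => i j; rewrite -corr_sym; congr (corr K _).
by rewrite -mulNr -mulNr opprB.
Qed.

Hypothesis n_gt0 : (0 < n)%N.

(* The form is the integral of [y^T W y] for a combination [y] of shifts of [K], of which
   the earliest one with a nonzero coefficient is alone on a short interval. *)
Lemma corr_block_pos p : posdefmx (lyap_block_mx H (corr K) p.+1).
Proof.
split; first exact: corr_block_sym.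
move=> w w0; have [j wj jmax] := mxcol_neq0 w0.
pose c (i : 'I_p.+1) := submxcol w i.
(* The step must be positive for [p = 0] too; there the only index is 0, so its value does not
   affect the form. *)
pose d := if p == 0%N then 1 else H / p%:R.
have d0 : 0 < d.
  by rewrite /d; case: eqP => [//|/eqP]; rewrite -lt0n => p0; rewrite divr_gt0// ltr0n.
pose y t := \sum_i K (t + (i : 'I_p.+1)%:R * d) *m c i.
have bt (i : 'I_p.+1) : mlbm (fun t => K (t + i%:R * d) *m c i).
  by apply: mlbmM (mlbm_cst _); exact: mlbm_shift mlbm_K.
have by_ : mlbm y by exact: mlbm_sum.
have formE (i k : 'I_p.+1) : dot (c i) (corr K ((k%:R - i%:R) / (p.+1%:R - 1) * H) *m c k) =
  Int (fun t => dot (K (t + i%:R * d) *m c i) (W *m (K (t + k%:R * d) *m c k))) /\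
  L1 (fun t => dot (K (t + i%:R * d) *m c i) (W *m (K (t + k%:R * d) *m c k))).
  have -> : (k%:R - i%:R) / (p.+1%:R - 1) * H = k%:R * d - i%:R * d.
    rewrite -mulrBl -natr1 addrK /d; case: (eqVneq p 0%N) => [p0|_]; last by rewrite -mulrA (mulrC _ H).
    have i0 : i = 0%N :> nat by apply/eqP; rewrite -leqn0 -p0 -ltnS.
    have k0 : k = 0%N :> nat by apply/eqP; rewrite -leqn0 -p0 -ltnS.
    by rewrite i0 k0 subrr !mul0r.
  exact: corr_form.
have dot_y t : dot (y t) (W *m y t) = \sum_i \sum_k
    dot (K (t + (i : 'I_p.+1)%:R * d) *m c i) (W *m (K (t + (k : 'I_p.+1)%:R * d) *m c k)).
  by rewrite /y mulmx_sumr dot_suml; apply: eq_bigr => i _; rewrite dot_sumr.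
have E : (w^T *m lyap_block_mx H (corr K) p.+1 *m w) 0 0 = Int (fun t => dot (y t) (W *m y t)).
  rewrite -[w]submxcolK /lyap_block_mx qform_mxblock.
  transitivity (\sum_i \sum_k Int (fun t =>
    dot (K (t + (i : 'I_p.+1)%:R * d) *m c i) (W *m (K (t + (k : 'I_p.+1)%:R * d) *m c k)))).
    by apply: eq_bigr => i _; apply: eq_bigr => k _; have [-> _] := formE i k.
  rewrite (eq_bigr (fun i => Int (fun t => \sum_k
    dot (K (t + (i : 'I_p.+1)%:R * d) *m c i)
      (W *m (K (t + (k : 'I_p.+1)%:R * d) *m c k))))); last first.
    by move=> i _; rewrite Int_sum// => k; have [_ l] := formE i k.
  rewrite -Int_sum; last by move=> i; apply: L1_sum => k; have [_ l] := formE i k.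
  by apply: eq_Int => t; rewrite dot_y.
have lE : L1 (fun t => dot (y t) (W *m y t)).
  apply: eq_L1 (L1_sum (index_enum 'I_p.+1) (fun i => L1_sum (index_enum 'I_p.+1)
    (fun k => (formE i k).2))) => t.
  by rewrite dot_y.
rewrite E; have [lm0 lm] := lambda_min_spec n_gt0 W_pos.
have cj : 0 < enorm (c j) by rewrite enorm_gt0.
(* Up to time [e] the column keeps half of its initial norm, by its Lipschitz constant, and the next
   shift, which starts a time [d] later, is still zero. *)
pose e := Num.min d (2 * (M * gam + 1))^-1.
have Mg : 0 < M * gam + 1 by rewrite ltr_wpDl// mulr_ge0// M1_ge0.
have e0 : 0 < e by rewrite lt_min d0 invr_gt0 mulr_gt0.
have ed : e <= d by rewrite ge_min lexx.
have eM : e * (2 * (M * gam + 1)) <= 1.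
  by rewrite -ler_pdivlMr ?mulr_gt0// div1r ge_min lexx orbT.
have small s : 0 <= s < e -> enorm (c j) / 2 <= enorm (K s *m c j).
  move=> /andP[s0 se]; have g0 : 0 <= gam * enorm (c j) by rewrite mulr_ge0 ?enorm_ge0.
  have := traj_lip (K_left (c j)) (lexx 0) s0 g0 (fun u _ => K_le u (c j)).
  rewrite K_0 mul1mx subr0 => l1.
  have l2 : M * (gam * enorm (c j)) * s <= enorm (c j) / 2.
    have l3 : (M * gam + 1) * s <= 1 / 2.
      apply: (@le_trans _ _ ((M * gam + 1) * e)); first by rewrite ler_wpM2l ?ltW.
      by move: eM; lra.
    have l4 : M * gam * s <= 1 / 2 by move: l3 s0; lra.
    have -> : M * (gam * enorm (c j)) * s = (M * gam * s) * enorm (c j) by ring.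
    by rewrite mulrC ler_wpM2l ?enorm_ge0//; move: l4; lra.
  have l5 : enorm (c j) <= enorm (K s *m c j - c j) + enorm (K s *m c j).
    rewrite -{1}(subKr (K s *m c j) (c j)) addrC -(enormN (K s *m c j - c j)).
    exact: enormD.
  by move: l1 l2 l5; lra.
have yE t : - (j%:R * d) <= t < - (j%:R * d) + e -> y t = K (t + j%:R * d) *m c j.
  move=> /andP[t1 t2]; rewrite /y (bigD1 j)//= big1 ?addr0// => i ij.
  case: (ltngtP i j) => [ltij|ltji|/val_inj ij']; last by rewrite ij' eqxx in ij.
    rewrite K_neg ?mul0mx//.
    have ij1 : i%:R + 1 <= j%:R :> R by rewrite natr1 ler_nat.
    have := ler_wpM2r (ltW d0) ij1; rewrite mulrDl mul1r.
    by move: t2 ed; lra.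
  by rewrite /c jmax// mulmx0.
pose q := lambda_min W * (enorm (c j) / 2) ^+ 2.
have q0 : 0 < q by rewrite mulr_gt0// exprn_gt0// divr_gt0.
apply: (@lt_le_trans _ _ (q * e)); first by rewrite mulr_gt0.
have te : - (j%:R * d) <= - (j%:R * d) + e by rewrite lerDl ltW.
have ie := Int_ico te; rewrite addrAC subrr add0r in ie.
rewrite -[X in _ * X]ie -IntZ; last exact: L1_ico.
apply: le_Int => //; first by apply: L1Z; exact: L1_ico.
move=> t; have y0 : 0 <= dot (y t) (W *m y t).
  by apply: le_trans (lm (y t)); rewrite mulr_ge0 ?dot_ge0// ltW.
case: (icoP (- (j%:R * d)) (- (j%:R * d) + e) t) => [[[t1 t2] ->]|->]; last by rewrite mulr0.
rewrite mulr1; apply: le_trans (lm (y t)); rewrite /q ler_wpM2l ?(ltW lm0)//.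
rewrite yE ?t1// -sqr_enorm lerXn2r ?nnegrE ?enorm_ge0 ?divr_ge0 ?enorm_ge0//.
by apply: small; move: t1 t2; lra.
Qed.

End Converse.

(** Positivity is given for every size because [rhat] depends on the matrix [U] that is only
    constructed here. *)
Lemma exp_stable_converse W : (0 < n)%N -> posdefmx W -> exp_stable A h H G ->
  lyapunov_condition A h H G /\ exists U, is_delay_lyapunov_matrix A h H G W U /\
    forall p, posdefmx (lyap_block_mx H U p.+1).
Proof.
move=> n0 Wp st; split; first exact: stable_lyapunov_condition.
have [[gam sig] /= [g1 s0] hK] := K_exp_decay st.
exists (corr W K); split; first exact: (corr_delay_lyapunov g1 s0 hK Wp).
by move=> p; exact: (corr_block_pos g1 s0 hK Wp n0).
Qed.

(** The derivative is bounded almost everywhere only, so the increment is written as an integral of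
    [rop K], which coincides with the derivative of [K] at positive times off a finite list. *)
Lemma K_lipschitz L : 0 <= L ->
  {ae @lebesgue_measure R, forall t, 0 <= t <= H -> opnorm ('D_1 K t) <= L} ->
  forall s t v, 0 <= s -> s <= t -> t <= H ->
  enorm (K t *m v - K s *m v) <= L * (t - s) * enorm v.
Proof.
move=> L0 hL s t v s0 st tH; have bR := mlbm_rop mlbm_K.
case: K_fund => _ _ _ [sK hK]; have [s' hs'] := K_pderm.
have c0 : 0 <= L * (t - s) * enorm v by rewrite !mulr_ge0 ?subr_ge0 ?enorm_ge0.
apply: enorm_dual => // u; rewrite -mulmxBl.
have FTC := pderm_FTC st bR (pderm_sub s0 (lexx t) (hs' t)); rewrite -FTC.
have l := mL1_mr v (mL1_ico s t bR); rewrite -(MInt_mr v (mL1_ico s t bR)).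
have [-> lu] := Int_dot u l.
have -> : L * (t - s) * enorm v * enorm u = Int (fun r => L * enorm v * enorm u * ico s t r).
  by rewrite IntZ ?Int_ico//; [ring|exact: L1_ico].
apply: ae_le_Int => //; first by apply: L1Z; exact: L1_ico.
have nK := negligible_seq (0 :: sK).
apply: negligibleS (negligibleU hL nK) => r /= nr; apply: contrapT => /not_orP[/contrapT hr /negP rs].
apply: nr; rewrite -/(0 :: sK) in rs.
case: (icoP s t r) => [[[sr rt] ->]|->]; last by rewrite scale0r mul0mx dot0r mulr0.
rewrite scale1r mulr1; move: rs; rewrite in_cons negb_or => /andP[r0 rs].
have r0' : 0 < r by rewrite lt_neqAle eq_sym r0 (le_trans s0 sr).
have [_ <-] := hK r r0' rs.
apply: le_trans (ler_norm _) _; apply: le_trans (norm_dot_opnorm _ _ _) _.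
rewrite -mulrA (mulrC (enorm u)) mulrA ler_wpM2r ?enorm_ge0// ler_wpM2r ?enorm_ge0//.
by apply: hr; rewrite ltW//= (le_trans (ltW rt) tH).
Qed.

End DelayOperators.

Theorem theorem13 (R : realType) (n m : nat) (n_gt0 : (0 < n)%N)
    (m_gt0 : (0 < m)%N)
    (A : 'I_m.+1 -> 'M[R]_n) (h : 'I_m.+1 -> R) (H : R)
    (h_0 : h ord0 = 0)
    (h_incr : forall i j : 'I_m.+1, (i < j)%N -> h i < h j)
    (h_m : h ord_max = H)
    (G : R -> 'M[R]_n) (G_pc : piecewise_continuous (- H) 0 G)
    (M1_gt0 : 0 < M1 A H G)
    (W : 'M[R]_n) (W_pos : posdefmx W)
    (K : R -> 'M[R]_n) (K_fund : is_fundamental_matrix A h H G K)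
    (L : R) (L_gt0 : 0 < L)
    (K_L : {ae @lebesgue_measure R, forall t : R, 0 <= t <= H ->
              opnorm ('D_1 K t) <= L})
    (b1 : R) (b1_itv : 0 < b1 < pi / 2)
    (b1_eq : sin b1 ^+ 4 * ((H * M1 A H G) ^+ 2 + b1 ^+ 2)
             - (H * M1 A H G) ^+ 2 = 0) :
  exp_stable A h H G <->
  lyapunov_condition A h H G /\
  exists U : R -> 'M[R]_n,
    is_delay_lyapunov_matrix A h H G W U /\
    posdefmx (lyap_block_mx H U (rhat A h H G W L b1 U)).
Proof.
have H_gt0 : 0 < H by rewrite -h_0 -h_m; exact: h_incr.
have h_itv j : 0 <= h j <= H.
  apply/andP; split.
    case: (posnP j) => [j0|j0]; last by rewrite -h_0 ltW// h_incr.
    by rewrite (_ : j = ord0) ?h_0//; exact: val_inj.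
  have : (j <= m)%N by rewrite -ltnS.
  rewrite leq_eqVlt => /predU1P[jm|jm]; last by rewrite -h_m ltW// h_incr.
  by rewrite (_ : j = ord_max) ?h_m//; exact: val_inj.
split=> [st|[_ [U [U_lyap U_pos]]]].
  have [lc [U [U_lyap U_pos]]] := exp_stable_converse H_gt0 h_itv G_pc K_fund n_gt0 W_pos st.
  by split=> //; exists U; split=> //; exact: U_pos.
have K_lip := K_lipschitz H_gt0 G_pc K_fund (ltW L_gt0) K_L.
have W_sym : W^T = W by case: W_pos.
apply: (positive_block_exp_stable H_gt0 h_itv G_pc K_fund W_sym U_lyap h_0 L_gt0 K_lip
  n_gt0 M1_gt0 W_pos b1_itv U_pos).
(* Here [p] is [rhat - 1], the absolute value of a ceiling, which is at least the ceiling whatever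
   its sign. *)
apply: le_trans (ceil_ge _) _.
by rewrite natr_absz ler_int ler_norm.
Qed.
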